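(* In $\mathcal{H}eis_k$, with $c',d',t',x'$ and the dotted bubbles $\circlearrowleft_n,\circlearrowright_n$ ($n\in\mathbb Z$) as in the context, the following relations hold. (i) For all $r\in\mathbb Z$: $\circlearrowright_r=-\delta_{r,k-1}1_{\mathbf 1}$ if $r<k$; $\circlearrowleft_r=\delta_{r,-k-1}1_{\mathbf 1}$ if $r<-k$; and for all integers $m$, $\sum_{r,s\ge0,\ r+s=m}\circlearrowright_{r+k-1}\,\circlearrowleft_{s-k-1}=-\delta_{m,0}1_{\mathbf 1}$. (ii) $(1_\uparrow\otimes d')\circ(c'\otimes 1_\uparrow)=1_\uparrow$ and $(d'\otimes 1_\downarrow)\circ(1_\downarrow\otimes c')=1_\downarrow$. (iii) $(1_\downarrow\otimes d)\circ(1_\downarrow\otimes x\otimes 1_\downarrow)\circ(c\otimes 1_\downarrow)=(d'\otimes 1_\downarrow)\circ(1_\downarrow\otimes x\otimes 1_\downarrow)\circ(1_\downarrow\otimes c')$, and $\big(1_{\downarrow\otimes\downarrow}\otimes (d\circ(1_\uparrow\otimes d\otimes 1_\downarrow))\big)\circ\big(1_{\downarrow\otimes\downarrow}\otimes s\otimes 1_{\downarrow\otimes\downarrow}\big)\circ\big(((1_\downarrow\otimes c\otimes 1_\uparrow)\circ c)\otimes 1_{\downarrow\otimes\downarrow}\big) =\big((d'\circ(1_\downarrow\otimes d'\otimes 1_\uparrow))\otimes 1_{\downarrow\otimes\downarrow}\big)\circ\big(1_{\downarrow\otimes\downarrow}\otimes s\otimes 1_{\downarrow\otimes\downarrow}\big)\circ\big(1_{\downarrow\otimes\downarrow}\otimes((1_\uparrow\otimes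 c'\otimes 1_\downarrow)\circ c')\big)$ (i.e. the right and left mates of $x$ agree, and the right and left mates of $s$ agree). (iv) For all $r\ge 0$: $(d'\otimes 1_\uparrow)\circ(1_\downarrow\otimes x^r\otimes 1_\uparrow)\circ(1_\downarrow\otimes s)\circ(c\otimes 1_\uparrow)=\sum_{m\ge0}\circlearrowleft_{r-m-1}\otimes x^m$ and $(1_\uparrow\otimes d)\circ(1_\uparrow\otimes x^r\otimes 1_\downarrow)\circ(s\otimes 1_\downarrow)\circ(1_\uparrow\otimes c')=-\sum_{m\ge0}x^m\otimes\circlearrowright_{r-m-1}$. (v) For all $r\in\mathbb Z$: $1_\uparrow\otimes\circlearrowleft_r=\circlearrowleft_r\otimes 1_\uparrow-\sum_{m\ge0}(m+1)\,\circlearrowleft_{r-m-2}\otimes x^m$ and $\circlearrowright_r\otimes 1_\uparrow=1_\uparrow\otimes\circlearrowright_r-\sum_{m\ge0}(m+1)\,x^m\otimes\circlearrowright_{r-m-2}$. (vi) Let $D_1:=(t'\otimes 1_\uparrow)\circ(1_\downarrow\otimes s)\circ(t\otimes 1_\uparrow)$ and $D_2:=(1_\uparrow\otimes t)\circ(s\otimes 1_\downarrow)\circ(1_\uparrow\otimes t')$, both endomorphisms of $\uparrow\otimes\downarrow\otimes\uparrow$. Then $D_1-D_2=\sum_{a,b,m\ge0}\circlearrowleft_{-a-b-m-3}\otimes\big((x^a\otimes 1_\downarrow)\circ c'\circ d\circ(x^b\otimes 1_\downarrow)\big)\otimes x^m$ if $k\ge2$; $D_1-D_2=0$ if $-1\le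 k\le 1$; $D_1-D_2=\sum_{a,b,m\ge0}x^m\otimes\big((1_\downarrow\otimes x^a)\circ c\circ d'\circ(1_\downarrow\otimes x^b)\big)\otimes\circlearrowright_{-a-b-m-3}$ if $k\le-2$.
   Context: Fix a commutative ring $\Bbbk$ and an integer $k$. In a strict monoidal category write $\mathbf 1$ for the unit object, $1_X$ for the identity of $X$, $a\circ b$ for composition ($a$ after $b$), $a\otimes b$ for the tensor product, and $x^n$ for the $n$-fold composite of an endomorphism ($x^0$ the identity); $\delta$ is the Kronecker delta. The Heisenberg category $\mathcal{H}eis_k$ is the strict $\Bbbk$-linear monoidal category generated by objects $\uparrow,\downarrow$ and morphisms $x:\uparrow\to\uparrow$, $s:\uparrow\otimes\uparrow\to\uparrow\otimes\uparrow$, $c:\mathbf 1\to\downarrow\otimes\uparrow$, $d:\uparrow\otimes\downarrow\to\mathbf 1$, subject to the following relations, where $t:=(1_\downarrow\otimes 1_\uparrow\otimes d)\circ(1_\downarrow\otimes s\otimes 1_\downarrow)\circ(c\otimes 1_\uparrow\otimes 1_\downarrow):\uparrow\otimes\downarrow\to\downarrow\otimes\uparrow$: (H) $s\circ s=1_{\uparrow\otimes\uparrow}$; $(s\otimes 1_\uparrow)\circ(1_\uparrow\otimes s)\circ(s\otimes 1_\uparrow)=(1_\uparrow\otimes s)\circ(s\otimes 1_\uparrow)\circ(1_\uparrow\otimes s)$; $(x\otimes 1_\uparrow)\circ s-s\circ(1_\uparrow\otimes x)=1_{\uparrow\otimes\uparrow}$. (A) $(d\otimes 1_\uparrow)\circ(1_\uparrow\otimes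 c)=1_\uparrow$ and $(1_\downarrow\otimes d)\circ(c\otimes 1_\downarrow)=1_\downarrow$. (I) If $k\ge0$, the morphism $\uparrow\otimes\downarrow\to(\downarrow\otimes\uparrow)\oplus\mathbf 1^{\oplus k}$ with components $t$ and $d\circ(x^r\otimes 1_\downarrow)$, $r=0,\dots,k-1$, is an isomorphism in the additive envelope; if $k<0$, the morphism $(\uparrow\otimes\downarrow)\oplus\mathbf 1^{\oplus(-k)}\to\downarrow\otimes\uparrow$ with components $t$ and $(1_\downarrow\otimes x^r)\circ c$, $r=0,\dots,-k-1$, is an isomorphism in the additive envelope. (Formally, one adjoins as further generators the matrix entries of a two-sided inverse, with relations saying both matrix products are identity matrices.) Define $c':\mathbf 1\to\uparrow\otimes\downarrow$ and $d':\downarrow\otimes\uparrow\to\mathbf 1$ as follows. If $k\ge 0$, the inverse of the isomorphism in (I) has components $\tau:\downarrow\otimes\uparrow\to\uparrow\otimes\downarrow$ and $e_r:\mathbf 1\to\uparrow\otimes\downarrow$ ($0\le r<k$); if $k<0$ it has components $\tau:\downarrow\otimes\uparrow\to\uparrow\otimes\downarrow$ and $f_r:\downarrow\otimes\uparrow\to\mathbf 1$ ($0\le r<-k$). Set $c':=-e_{k-1}$ if $k>0$, $c':=\tau\circ(1_\downarrow\otimes x^{-k})\circ c$ if $k\le 0$; $d':=d\circ(x^k\otimes 1_\downarrow)\circ\tau$ if $k\ge0$, $d':=f_{-k-1}$ if $k<0$. Define $t':=(d'\otimes 1_\uparrow\otimes 1_\downarrow)\circ(1_\downarrow\otimes s\otimes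 1_\downarrow)\circ(1_\downarrow\otimes 1_\uparrow\otimes c'):\downarrow\otimes\uparrow\to\uparrow\otimes\downarrow$ and $x':=(1_\downarrow\otimes d)\circ(1_\downarrow\otimes x\otimes 1_\downarrow)\circ(c\otimes 1_\downarrow)$. For $n\ge 0$ let $\circlearrowleft_n:=d'\circ(1_\downarrow\otimes x^n)\circ c$ and $\circlearrowright_n:=d\circ(x^n\otimes 1_\downarrow)\circ c'$, endomorphisms of $\mathbf 1$ (these form a commutative ring, where product equals composition equals tensor product). For $n<0$ let $\circlearrowleft_n:=\det(\circlearrowright_{i-j+k})_{i,j=1,\dots,r}$ with $r:=n+k+1$, and $\circlearrowright_n:=-\det(-\circlearrowleft_{i-j-k})_{i,j=1,\dots,r}$ with $r:=n-k+1$; determinants are $1$ if $r=0$ and $0$ if $r<0$. All sums above have only finitely many nonzero terms. *)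

(* Defs.v *)
From HB Require Import structures.
From mathcomp Require Import all_boot all_order all_algebra fingroup perm.
Set Implicit Arguments.
Unset Strict Implicit.
Unset Printing Implicit Defensive.
Import Order.TTheory GRing.Theory Num.Theory.
Local Open Scope ring_scope.

(* An object is a [seq bool]: [true] = up arrow, [false] = down arrow;       *)
(* tensor of objects is concatenation, the unit object is [::].              *)

Record lmcat (R : comPzRingType) := LMCat {
  hom : seq bool -> seq bool -> lmodType R;
  mcomp : forall X Y Z, hom Y Z -> hom X Y -> hom X Z;
  idm : forall X, hom X X;
  tens : forall X Y Z W, hom X Y -> hom Z W -> hom (X ++ Z) (Y ++ W)
}.
Arguments hom {R} l X Y.
Arguments mcomp {R l X Y Z} g f.
Arguments idm {R l} X.
Arguments tens {R l X Y Z W} f g.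

Definition castH (R : comPzRingType) (C : lmcat R) (A A' B B' : seq bool)
  (eA : A = A') (eB : B = B') (f : hom C A B) : hom C A' B' :=
  eq_rect B (fun Y => hom C A' Y) (eq_rect A (fun X => hom C X B) f A' eA) B' eB.

Record lmcat_axioms (R : comPzRingType) (C : lmcat R) : Prop := {
  compA : forall A B C0 D (h : hom C C0 D) (g : hom C B C0) (f : hom C A B),
    mcomp h (mcomp g f) = mcomp (mcomp h g) f;
  comp1f : forall A B (f : hom C A B), mcomp (idm B) f = f;
  compf1 : forall A B (f : hom C A B), mcomp f (idm A) = f;
  comp_linl : forall A B C0 (a : R) (g g' : hom C B C0) (f : hom C A B),
    mcomp (a *: g + g') f = a *: mcomp g f + mcomp g' f;
  comp_linr : forall A B C0 (a : R) (g : hom C B C0) (f f' : hom C A B),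
    mcomp g (a *: f + f') = a *: mcomp g f + mcomp g f';
  tens_linl : forall A B C0 D (a : R) (f f' : hom C A B) (g : hom C C0 D),
    tens (a *: f + f') g = a *: tens f g + tens f' g;
  tens_linr : forall A B C0 D (a : R) (f : hom C A B) (g g' : hom C C0 D),
    tens f (a *: g + g') = a *: tens f g + tens f g';
  tensA : forall A B C0 D E F (f : hom C A B) (g : hom C C0 D) (h : hom C E F),
    castH (catA A C0 E) (catA B D F) (tens f (tens g h)) = tens (tens f g) h;
  tens1f : forall A B (f : hom C A B), tens (idm [::]) f = f;
  tensf1 : forall A B (f : hom C A B), tens f (idm [::]) = castH (esym (cats0 A)) (esym (cats0 B)) f;
  tens_id : forall A B, tens (@idm _ C A) (@idm _ C B) = @idm _ C (A ++ B);
  interchange : forall A B C0 D E F (f : hom C A B) (f' : hom C B C0)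
      (g : hom C D E) (g' : hom C E F),
    mcomp (tens f' g') (tens f g) = tens (mcomp f' f) (mcomp g' g)
}.

Notation U := [:: true].
Notation Dn := [:: false].

(* "eventually in N": used to express finitely supported infinite sums
   sum_{m >= 0} F m = v  as  "for all large N, sum_{m < N} F m = v". *)
Definition eventually (P : nat -> Prop) : Prop :=
  exists N0 : nat, forall N : nat, (N0 <= N)%N -> P N.

Record heis_data (R : comPzRingType) (C : lmcat R) := HeisData {
  hx : hom C U U;
  hs : hom C [:: true; true] [:: true; true];
  hc : hom C [::] [:: false; true];
  hd : hom C [:: true; false] [::];
  (* components of the inverse of the isomorphism in (I) *)
  htau : hom C [:: false; true] [:: true; false];
  he : nat -> hom C [::] [:: true; false];     (* e_r, used when k >= 0 *)
  hf : nat -> hom C [:: false; true] [::]       (* f_r, used when k < 0  *)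
}.

Section Heis.
Context {R : comPzRingType} {C : lmcat R}.
Variable (k : int) (D : heis_data C).

Local Notation x := (hx D).
Local Notation s := (hs D).
Local Notation c := (hc D).
Local Notation d := (hd D).
Local Notation tau := (htau D).

Definition xp (n : nat) : hom C U U := iter n (mcomp x) (idm U).

Definition ht : hom C [:: true; false] [:: false; true] :=
  mcomp (tens (idm [:: false; true]) d)
   (mcomp (tens (tens (idm Dn) s) (idm Dn)) (tens c (idm [:: true; false]))).

Definition dxr (r : nat) : hom C [:: true; false] [::] := mcomp d (tens (xp r) (idm Dn)).
Definition cxr (r : nat) : hom C [::] [:: false; true] := mcomp (tens (idm Dn) (xp r)) c.

Definition delta1 (b : bool) : hom C [::] [::] := (b%:R : R) *: idm [::].

Definition heis_rels : Prop :=
  [/\ [/\ mcomp s s = idm [:: true; true],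
      mcomp (tens s (idm U)) (mcomp (tens (idm U) s) (tens s (idm U)))
        = mcomp (tens (idm U) s) (mcomp (tens s (idm U)) (tens (idm U) s)) &
      mcomp (tens x (idm U)) s - mcomp s (tens (idm U) x) = idm [:: true; true]],
      mcomp (tens d (idm U)) (tens (idm U) c) = idm U,
      mcomp (tens (idm Dn) d) (tens c (idm Dn)) = idm Dn &
      if (0 <= k)%R then
        [/\ mcomp tau ht + \sum_(r < `|k|%N) mcomp (he D r) (dxr r) = idm [:: true; false],
            mcomp ht tau = idm [:: false; true],
            forall r : nat, (r < `|k|)%N -> mcomp ht (he D r) = 0,
            forall r : nat, (r < `|k|)%N -> mcomp (dxr r) tau = 0 &
            forall r s : nat, (r < `|k|)%N -> (s < `|k|)%N ->
              mcomp (dxr r) (he D s) = delta1 (r == s)]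
      else
        [/\ mcomp ht tau + \sum_(r < `|k|%N) mcomp (cxr r) (hf D r) = idm [:: false; true],
            mcomp tau ht = idm [:: true; false],
            forall r : nat, (r < `|k|)%N -> mcomp tau (cxr r) = 0,
            forall r : nat, (r < `|k|)%N -> mcomp (hf D r) ht = 0 &
            forall r s : nat, (r < `|k|)%N -> (s < `|k|)%N ->
              mcomp (hf D r) (cxr s) = delta1 (r == s)]].

Definition cpr : hom C [::] [:: true; false] :=
  if (0 < k)%R then - he D `|k - 1|%N
  else mcomp tau (mcomp (tens (idm Dn) (xp `|k|%N)) c).

Definition dpr : hom C [:: false; true] [::] :=
  if (0 <= k)%R then mcomp d (mcomp (tens (xp `|k|%N) (idm Dn)) tau)
  else hf D `|- k - 1|%N.

Definition tpr : hom C [:: false; true] [:: true; false] :=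
  mcomp (tens dpr (idm [:: true; false]))
   (mcomp (tens (tens (idm Dn) s) (idm Dn)) (tens (idm [:: false; true]) cpr)).

Definition xpr : hom C Dn Dn :=
  mcomp (tens (idm Dn) d) (mcomp (tens (tens (idm Dn) x) (idm Dn)) (tens c (idm Dn))).

Definition ccw0 (n : nat) : hom C [::] [::] := mcomp dpr (mcomp (tens (idm Dn) (xp n)) c).
Definition cw0 (n : nat) : hom C [::] [::] := mcomp d (mcomp (tens (xp n) (idm Dn)) cpr).

Definition bmul (a b : hom C [::] [::]) : hom C [::] [::] := mcomp a b.

(* determinant of the r x r matrix (M i j)_{0 <= i,j < r} over End(1)
   (Leibniz formula); 1 if r = 0, 0 if r < 0 *)
Definition bdet (r : int) (M : int -> int -> hom C [::] [::]) : hom C [::] [::] :=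
  match r with
  | Posz n => \sum_(p : 'S_n) (((-1) ^+ p : R) *:
                 \big[bmul/idm [::]]_(i < n) M (i : nat)%:Z (p i : nat)%:Z)
  | Negz _ => 0
  end.

(* the index arguments below are always >= 0 where used *)
Definition cw_nn (z : int) : hom C [::] [::] :=
  match z with Posz n => cw0 n | Negz _ => 0 end.
Definition ccw_nn (z : int) : hom C [::] [::] :=
  match z with Posz n => ccw0 n | Negz _ => 0 end.

Definition ccw (n : int) : hom C [::] [::] :=
  match n with
  | Posz m => ccw0 m
  | Negz _ => bdet (n + k + 1) (fun i j => cw_nn (i - j + k))
  end.

Definition cw (n : int) : hom C [::] [::] :=
  match n with
  | Posz m => cw0 m
  | Negz _ => - bdet (n - k + 1) (fun i j => - ccw_nn (i - j - k))
  end.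

Definition D1 : hom C [:: true; false; true] [:: true; false; true] :=
  mcomp (tens tpr (idm U)) (mcomp (tens (idm Dn) s) (tens ht (idm U))).
Definition D2 : hom C [:: true; false; true] [:: true; false; true] :=
  mcomp (tens (idm U) ht) (mcomp (tens s (idm Dn)) (tens (idm U) tpr)).

End Heis.

(* Main.v *)
(** The right adjunction data [c], [d] present the generators [s], [x] on any
    strand, and the defining isomorphism turns every identity between
    morphisms into ↑↓ (if [k >= 0]) or out of ↓↑ (if [k < 0]) into finitely many
    tests: composing with the sideways crossing [t] and with dotted caps (cups).  Sliding a strand
    over [c'] or [d'] ("pitchfork") is proved by these tests, a test with [t]
    being the braid relation and a test with a dotted cap creating only curls
    with few dots, which vanish.  The pitchforks give the left adjunction, the
    equality of the mates and [t' = tau]; curls with more dots are computed by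
    the recursion of the affine Hecke relation.
    The matrix entries [e_r] (or [f_r]) of the inverse isomorphism are obtained
    from [c'] (or [d']) by dots and bubbles; sliding dots through [tau] then
    gives the infinite Grassmannian relation.  One of the two bubble slides is
    a pitchfork composed with a dotted cap, the other one follows since the two
    generating series of bubbles are inverse to each other.  Finally, the
    alternating braid relation is the braid relation for [t] multiplied by
    [tau] on one side, where the failure of [tau t = 1] (or [t tau = 1]) gives
    the correction term. *)

Require Import Defs.
From HB Require Import structures.
From mathcomp Require Import all_boot all_order all_algebra fingroup perm ring lra zify.
Import Order.TTheory GRing.Theory Num.Theory.
Local Open Scope ring_scope.

Set Implicit Arguments.
Unset Strict Implicit.
Unset Printing Implicit Defensive.

(** The maps [c'] and [d'] are given only as composites of entries of an inverse matrix, so no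
    zigzag for them is available when the pitchforks are proved. What makes the finitely many tests
    succeed is that with fewer than |k| dots the relevant curls vanish and the relevant bubbles are
    scalars, which pass through any strand, while the curl with |k| dots is the identity of ↑. This
    last curl is what a left zigzag turns into once a pitchfork is applied. The determinants enter
    because the dot acts on the matrix entries e_r (or f_r) like a companion matrix, whose unknown
    coefficients obey the recursion for the inverse of a power series; expanding a Hessenberg
    determinant gives the same recursion. The case k < 0 is the mirror image of k >= 0 with the
    order of composition reversed: cups are tested instead of caps, left curls replace right curls,
    and the two families of bubbles exchange their roles. *)

Local Notation hom := Defs.hom.

(** * Linear monoidal categories *)

Declare Scope cat_scope.
Delimit Scope cat_scope with cat.
Notation "g ∘ f" := (mcomp g f) (at level 40, left associativity) : cat_scope.
Notation "f ⊗ g" := (tens f g) (at level 38, left associativity) : cat_scope.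
Local Open Scope cat_scope.

Section Linearity.
Context {R : comPzRingType} {C : lmcat R} (HC : lmcat_axioms C).
Implicit Types X Y Z W : seq bool.

Lemma compDl X Y Z (g g' : hom C Y Z) (f : hom C X Y) :
  (g + g') ∘ f = g ∘ f + g' ∘ f.
Proof. by have := comp_linl HC 1 g g' f; rewrite !scale1r. Qed.

Lemma compDr X Y Z (g : hom C Y Z) (f f' : hom C X Y) :
  g ∘ (f + f') = g ∘ f + g ∘ f'.
Proof. by have := comp_linr HC 1 g f f'; rewrite !scale1r. Qed.

Lemma comp0l X Y Z (f : hom C X Y) : (0 : hom C Y Z) ∘ f = 0.
Proof. by apply: (@addrI _ (0 ∘ f)); rewrite -compDl !addr0. Qed.

Lemma comp0r X Y Z (g : hom C Y Z) : g ∘ (0 : hom C X Y) = 0.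
Proof. by apply: (@addrI _ (g ∘ 0)); rewrite -compDr !addr0. Qed.

Lemma compZl X Y Z a (g : hom C Y Z) (f : hom C X Y) : (a *: g) ∘ f = a *: (g ∘ f).
Proof. by have := comp_linl HC a g 0 f; rewrite addr0 comp0l addr0. Qed.

Lemma compZr X Y Z a (g : hom C Y Z) (f : hom C X Y) : g ∘ (a *: f) = a *: (g ∘ f).
Proof. by have := comp_linr HC a g f 0; rewrite addr0 comp0r addr0. Qed.

Lemma compNl X Y Z (g : hom C Y Z) (f : hom C X Y) : (- g) ∘ f = - (g ∘ f).
Proof. by rewrite -scaleN1r compZl scaleN1r. Qed.

Lemma compNr X Y Z (g : hom C Y Z) (f : hom C X Y) : g ∘ (- f) = - (g ∘ f).
Proof. by rewrite -scaleN1r compZr scaleN1r. Qed.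

Lemma comp_suml X Y Z I r (P : pred I) (G : I -> hom C Y Z) (f : hom C X Y) :
  (\sum_(i <- r | P i) G i) ∘ f = \sum_(i <- r | P i) G i ∘ f.
Proof. exact: (big_morph (mcomp^~ f) (fun g g' => compDl g g' f) (comp0l _ f)). Qed.

Lemma comp_sumr X Y Z I r (P : pred I) (g : hom C Y Z) (F : I -> hom C X Y) :
  g ∘ (\sum_(i <- r | P i) F i) = \sum_(i <- r | P i) g ∘ F i.
Proof. exact: (big_morph (mcomp g) (compDr g) (comp0r _ g)). Qed.

Lemma tensDl X Y Z W (f f' : hom C X Y) (g : hom C Z W) :
  (f + f') ⊗ g = f ⊗ g + f' ⊗ g.
Proof. by have := tens_linl HC 1 f f' g; rewrite !scale1r. Qed.

Lemma tensDr X Y Z W (f : hom C X Y) (g g' : hom C Z W) :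
  f ⊗ (g + g') = f ⊗ g + f ⊗ g'.
Proof. by have := tens_linr HC 1 f g g'; rewrite !scale1r. Qed.

Lemma tens0l X Y Z W (g : hom C Z W) : (0 : hom C X Y) ⊗ g = 0.
Proof. by apply: (@addrI _ (0 ⊗ g)); rewrite -tensDl !addr0. Qed.

Lemma tens0r X Y Z W (f : hom C X Y) : f ⊗ (0 : hom C Z W) = 0.
Proof. by apply: (@addrI _ (f ⊗ 0)); rewrite -tensDr !addr0. Qed.

Lemma tensZl X Y Z W a (f : hom C X Y) (g : hom C Z W) : (a *: f) ⊗ g = a *: (f ⊗ g).
Proof. by have := tens_linl HC a f 0 g; rewrite addr0 tens0l addr0. Qed.

Lemma tensZr X Y Z W a (f : hom C X Y) (g : hom C Z W) : f ⊗ (a *: g) = a *: (f ⊗ g).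
Proof. by have := tens_linr HC a f g 0; rewrite addr0 tens0r addr0. Qed.

Lemma tensNl X Y Z W (f : hom C X Y) (g : hom C Z W) : (- f) ⊗ g = - (f ⊗ g).
Proof. by rewrite -scaleN1r tensZl scaleN1r. Qed.

Lemma tensNr X Y Z W (f : hom C X Y) (g : hom C Z W) : f ⊗ (- g) = - (f ⊗ g).
Proof. by rewrite -scaleN1r tensZr scaleN1r. Qed.

Lemma tens_suml X Y Z W I r (P : pred I) (F : I -> hom C X Y) (g : hom C Z W) :
  (\sum_(i <- r | P i) F i) ⊗ g = \sum_(i <- r | P i) F i ⊗ g.
Proof. exact: (big_morph (fun f => f ⊗ g) (fun f f' => tensDl f f' g) (tens0l _ _ g)). Qed.

Lemma tens_sumr X Y Z W I r (P : pred I) (f : hom C X Y) (G : I -> hom C Z W) :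
  f ⊗ (\sum_(i <- r | P i) G i) = \sum_(i <- r | P i) f ⊗ G i.
Proof. exact: (big_morph (tens f) (tensDr f) (tens0r _ _ f)). Qed.

Definition linE := (compDl, compDr, comp0l, comp0r, compZl, compZr, compNl, compNr,
  comp_suml, comp_sumr, tensDl, tensDr, tens0l, tens0r, tensZl, tensZr, tensNl, tensNr,
  tens_suml, tens_sumr).

End Linearity.

(** * Normalisation of string diagrams by reflection *)

(* Forgetting the source and the target in the type makes the tensor product
   strictly associative, so that no casts along [catA] are needed. *)
Section Packed.
Context {R : comPzRingType} {C : lmcat R} (HC : lmcat_axioms C).
Implicit Types X Y Z W : seq bool.

Lemma castH_id X Y (eX : X = X) (eY : Y = Y) (f : hom C X Y) : castH eX eY f = f.
Proof. by rewrite (eq_axiomK eX) (eq_axiomK eY). Qed.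

Record pmor := Pk { psrc : seq bool; ptgt : seq bool; pval : hom C psrc ptgt }.
Arguments Pk {psrc ptgt} pval.

(** The value 0 on a mismatch makes composition of packed morphisms total; the lemmas below assume
    matching boundaries. The choice of equality proofs does not matter, because equality on
    [seq bool] is decidable. *)
Definition unpk X Y (p : pmor) : hom C X Y :=
  match @eqP _ (psrc p) X, @eqP _ (ptgt p) Y with
  | ReflectT eX, ReflectT eY => castH eX eY (pval p)
  | _, _ => 0
  end.

Lemma PkK X Y (f : hom C X Y) : unpk X Y (Pk f) = f.
Proof. by rewrite /unpk /=; do 2 case: eqP => // ?; rewrite castH_id. Qed.

Lemma unpkK X Y p : psrc p = X -> ptgt p = Y -> Pk (unpk X Y p) = p.
Proof. by case: p => X' Y' f /= eX eY; subst; rewrite PkK. Qed.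

Lemma Pk_cast X X' Y Y' (eX : X = X') (eY : Y = Y') (f : hom C X Y) :
  Pk (castH eX eY f) = Pk f.
Proof. by subst. Qed.

Definition pid X := Pk (@idm _ C X).
Definition pcomp (q p : pmor) := Pk (pval q ∘ unpk (psrc p) (psrc q) p).
Definition ptens (p q : pmor) := Pk (pval p ⊗ pval q).

Lemma pcompE X Y Z (g : hom C Y Z) (f : hom C X Y) : pcomp (Pk g) (Pk f) = Pk (g ∘ f).
Proof. by rewrite /pcomp /= PkK. Qed.

Lemma ptensE X Y Z W (f : hom C X Y) (g : hom C Z W) : ptens (Pk f) (Pk g) = Pk (f ⊗ g).
Proof. by []. Qed.

Lemma pcompA p q r : ptgt p = psrc q -> ptgt q = psrc r ->
  pcomp r (pcomp q p) = pcomp (pcomp r q) p.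
Proof.
case: p q r => [X Y f] [Y' Z g] [Z' W h] /= eY eZ; subst.
by rewrite !pcompE (Defs.compA HC).
Qed.

Lemma pcomp1p p : pcomp (pid (ptgt p)) p = p.
Proof. by case: p => X Y f; rewrite pcompE (comp1f HC). Qed.

Lemma pcompp1 p : pcomp p (pid (psrc p)) = p.
Proof. by case: p => X Y f; rewrite pcompE (compf1 HC). Qed.

Lemma ptensA p q r : ptens p (ptens q r) = ptens (ptens p q) r.
Proof. by rewrite /ptens /= -(tensA HC) Pk_cast. Qed.

Lemma ptens1p p : ptens (pid [::]) p = p.
Proof. by case: p => X Y f; rewrite /ptens /= (tens1f HC). Qed.

Lemma ptensp1 p : ptens p (pid [::]) = p.
Proof. by case: p => X Y f; rewrite /ptens /= (tensf1 HC) Pk_cast. Qed.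

Lemma ptens_id X Y : ptens (pid X) (pid Y) = pid (X ++ Y).
Proof. by rewrite /ptens /= (tens_id HC). Qed.

Lemma pinterchange p p' q q' : ptgt p = psrc p' -> ptgt q = psrc q' ->
  pcomp (ptens p' q') (ptens p q) = ptens (pcomp p' p) (pcomp q' q).
Proof.
case: p p' q q' => [X Y f] [Y' Z f'] [X1 Y1 g] [Y1' Z1 g'] /= e e1; subst.
by rewrite !ptensE pcompE (Defs.interchange HC) /= !PkK.
Qed.

(* A word is a list of layers, the first one being applied first; the layer *)
(* (L, i, R) stands for the i-th atom with identities on L and R beside it. *)
Definition layer := (seq bool * nat * seq bool)%type.
Variable env : seq pmor.
Definition sigma := [seq (psrc p, ptgt p) | p <- env].

Definition atom i := nth (pid [::]) env i.
Definition lay (l : layer) := ptens (pid l.1.1) (ptens (atom l.1.2) (pid l.2)).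

Fixpoint wsem X (w : seq layer) : pmor :=
  if w is l :: w' then pcomp (wsem (ptgt (lay l)) w') (lay l) else pid X.

Section Sig.
Variable sg : seq (seq bool * seq bool).
Definition asrc i := (nth ([::], [::]) sg i).1.
Definition atgt i := (nth ([::], [::]) sg i).2.
Definition lsrc (l : layer) := l.1.1 ++ asrc l.1.2 ++ l.2.
Definition ltgt (l : layer) := l.1.1 ++ atgt l.1.2 ++ l.2.

Fixpoint wt X (w : seq layer) Y : bool :=
  if w is l :: w' then (X == lsrc l) && wt (ltgt l) w' Y else X == Y.

Definition whisk A B (l : layer) : layer := (A ++ l.1.1, l.1.2, l.2 ++ B).

(* [swap l m = Some (m', l')] if the layers l and m, applied in this order, *)
(* involve disjoint strands and thus equal m' followed by l'.               *)
Definition swapl (l m : layer) : option (layer * layer) :=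
  let: (L1, i, R1) := l in let: (L2, j, R2) := m in
  let M := drop (size L2 + size (asrc j)) L1 in
  if (L1 == L2 ++ asrc j ++ M) && (R2 == M ++ atgt i ++ R1)
  then Some ((L2, j, M ++ asrc i ++ R1), (L2 ++ atgt j ++ M, i, R1)) else None.

Definition swapr (l m : layer) : option (layer * layer) :=
  let: (L1, i, R1) := l in let: (L2, j, R2) := m in
  let M := drop (size L1 + size (atgt i)) L2 in
  if (L2 == L1 ++ atgt i ++ M) && (R1 == M ++ asrc j ++ R2)
  then Some ((L1 ++ asrc i ++ M, j, R2), (L1, i, M ++ atgt j ++ R2)) else None.

Definition swap l m := if swapl l m is Some r then Some r else swapr l m.

(* The rules are pairs of layers composing to an identity. *)
Variable rules : seq (layer * layer).

(** The lengths of the strings force the strands [A] and [B] beside the rule, so there is one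
    candidate per rule and no search. *)
Definition cancels (l m : layer) := has (fun r : layer * layer =>
  let A := take (size l.1.1 - size r.1.1.1) l.1.1 in
  let B := drop (size r.1.2) l.2 in
  (l == whisk A B r.1) && (m == whisk A B r.2)) rules.

(** The layer [l] travels to later positions until it meets a partner that cancels it, and fails at
    the first layer that it can neither cancel nor pass. *)
Fixpoint push (l : layer) (w : seq layer) : option (seq layer) :=
  if w is m :: w' then
    if cancels l m then Some w' else
    if swap l m is Some (m', l') then omap (cons m') (push l' w') else None
  else None.

Fixpoint cancel1 (w : seq layer) : option (seq layer) :=
  if w is l :: w' then
    if push l w' is Some w2 then Some w2 else omap (cons l) (cancel1 w')
  else None.

(* [rw] is the reversed word preceding the layer m *)
Fixpoint pull (m : layer) (rw : seq layer) : option (seq layer) :=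
  if rw is l :: rw' then
    if cancels l m then Some rw' else
    if swap l m is Some (m', l') then omap (cons l') (pull m' rw') else None
  else None.

Fixpoint rcancel1 (rw : seq layer) : option (seq layer) :=
  if rw is l :: w' then
    if pull l w' is Some w2 then Some w2 else omap (cons l) (rcancel1 w')
  else None.

(** Both directions are tried: of two cancelling layers, sometimes only the earlier one, and
    sometimes only the later one, commutes with everything in between. *)
Definition cancel (w : seq layer) : seq layer :=
  if cancel1 w is Some w' then w' else
  if rcancel1 (rev w) is Some rw then rev rw else w.

(* Floating bubbles could be exchanged forever: they are ordered by index. *)
Definition wantl (l m : layer) :=
  if [&& nilp (asrc l.1.2), nilp (atgt l.1.2), nilp (asrc m.1.2) & nilp (atgt m.1.2)]
  then (size m.1.1 < size l.1.1)%N || ((size m.1.1 == size l.1.1) && (m.1.2 < l.1.2)%N)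
  else true.

Fixpoint passl (w : seq layer) : seq layer :=
  if w is l :: w' then
    if passl w' is m :: w2 then
      if wantl l m then
        if swapl l m is Some (m', l') then m' :: l' :: w2 else l :: m :: w2
      else l :: m :: w2
    else [:: l]
  else [::].

Fixpoint passr (w : seq layer) : seq layer :=
  if w is l :: w' then
    if passr w' is m :: w2 then
      if wantl m l then
        if swapr l m is Some (m', l') then m' :: l' :: w2 else l :: m :: w2
      else l :: m :: w2
    else [:: l]
  else [::].

(** A heuristic normal form: only its soundness [nf_weq] is proved. Sorting alternately to the left
    and to the right exposes cancelling pairs that a single order hides, and the last pass to the
    left fixes a representative. *)
Definition nf (w : seq layer) : seq layer :=
  let n := size w in
  let cl w := iter n cancel (iter n passl w) in
  let cr w := iter n cancel (iter n passr w) in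
  iter n.*2 passl (cl (cr (cl (cr (cl w))))).

End Sig.

(** The signature is a separate closed list, so that [nf] and [check] compute without touching the
    morphisms in [env]. *)
Hypothesis (sg : seq (seq bool * seq bool)) (sgE : sigma = sg).
Variable rules : seq (layer * layer).
Hypothesis rulesP : all (fun r : layer * layer => ltgt sg r.1 == lsrc sg r.2) rules /\
  forall r, r \in rules -> pcomp (lay r.2) (lay r.1) = pid (psrc (lay r.1)).

Lemma asrcE i : asrc sg i = psrc (atom i).
Proof.
rewrite /asrc /atom -sgE; have [ltis | leis] := ltnP i (size env).
  by rewrite (nth_map (pid [::])).
by rewrite !nth_default // size_map.
Qed.

Lemma atgtE i : atgt sg i = ptgt (atom i).
Proof.
rewrite /atgt /atom -sgE; have [ltis | leis] := ltnP i (size env).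
  by rewrite (nth_map (pid [::])).
by rewrite !nth_default // size_map.
Qed.

Lemma lsrcE l : lsrc sg l = psrc (lay l).
Proof. by rewrite /lsrc asrcE. Qed.

Lemma ltgtE l : ltgt sg l = ptgt (lay l).
Proof. by rewrite /ltgt atgtE. Qed.

Lemma wsem_cons X l w : wsem X (l :: w) = pcomp (wsem (ptgt (lay l)) w) (lay l).
Proof. by []. Qed.

Lemma wt_cons X l w Y :
  wt sg X (l :: w) Y = (X == psrc (lay l)) && wt sg (ptgt (lay l)) w Y.
Proof. by rewrite /= lsrcE ltgtE. Qed.

Lemma wt_types X w Y : wt sg X w Y -> psrc (wsem X w) = X /\ ptgt (wsem X w) = Y.
Proof.
elim: w X => [|l w IHw] X /=; first by move/eqP->.
by rewrite lsrcE ltgtE => /andP[/eqP-> /IHw[]].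
Qed.

Lemma wt_src X w Y : wt sg X w Y -> psrc (wsem X w) = X.
Proof. by case/wt_types. Qed.

Lemma wt_tgt X w Y : wt sg X w Y -> ptgt (wsem X w) = Y.
Proof. by case/wt_types. Qed.

Lemma wt_cat X w1 Y w2 Z : wt sg X w1 Y -> wt sg Y w2 Z -> wt sg X (w1 ++ w2) Z.
Proof.
elim: w1 X => [|l w1 IHw] X /=; first by move/eqP->.
by move=> /andP[-> /IHw] h /h.
Qed.

Lemma wsem_cat X w1 Y w2 Z : wt sg X w1 Y -> wt sg Y w2 Z ->
  wsem X (w1 ++ w2) = pcomp (wsem Y w2) (wsem X w1).
Proof.
elim: w1 X => [|l w1 IHw] X /=.
  by move/eqP-> => t; have := pcompp1 (wsem Y w2); rewrite (wt_src t).
rewrite ltgtE => /andP[_ t1] t2.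
by rewrite (IHw _ t1 t2) pcompA ?(wt_src t1) ?(wt_tgt t1) ?(wt_src t2).
Qed.

Lemma lay_whisk A B l : lay (whisk A B l) = ptens (pid A) (ptens (lay l) (pid B)).
Proof. by rewrite /lay /whisk /= -!ptens_id -!ptensA. Qed.

Lemma wt_whisk A B X w Y : wt sg X w Y ->
  wt sg (A ++ X ++ B) (map (whisk A B) w) (A ++ Y ++ B).
Proof.
elim: w X => [|l w IHw] X /=; first by move/eqP->.
move=> /andP[/eqP-> /IHw]; rewrite !lsrcE !ltgtE !lay_whisk /= => ->.
by rewrite -!catA eqxx.
Qed.

Lemma wsem_whisk A B X w Y : wt sg X w Y ->
  wsem (A ++ X ++ B) (map (whisk A B) w) = ptens (pid A) (ptens (wsem X w) (pid B)).
Proof.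
elim: w X => [|l w IHw] X /=; first by move=> _; rewrite !ptens_id.
rewrite ltgtE lay_whisk => /andP[_ t] /=; have := IHw _ t; rewrite /= -!catA => ->.
rewrite !pinterchange //= ?(wt_src t) //.
by rewrite -[in RHS](pcomp1p (pid A)) -[in RHS](pcomp1p (pid B)).
Qed.

Lemma swap_core L p M q B :
  pcomp (ptens (pid L) (ptens q (pid (M ++ ptgt p ++ B))))
        (ptens (pid (L ++ psrc q ++ M)) (ptens p (pid B)))
  = pcomp (ptens (pid (L ++ ptgt q ++ M)) (ptens p (pid B)))
          (ptens (pid L) (ptens q (pid (M ++ psrc p ++ B)))).
Proof.
rewrite -!ptens_id -!ptensA !pinterchange //=; congr ptens.
rewrite !pcomp1p pcompp1; congr ptens; congr ptens.
by rewrite (pcompp1 p).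
Qed.

Definition eqlay2 (l m m' l' : layer) :=
  [/\ pcomp (lay m) (lay l) = pcomp (lay l') (lay m'),
      psrc (lay m') = psrc (lay l), ptgt (lay m') = psrc (lay l') & ptgt (lay l') = ptgt (lay m)].

Lemma swaplP l m m' l' : swapl sg l m = Some (m', l') -> eqlay2 l m m' l'.
Proof.
case: l m => [[L1 i] R1] [[L2 j] R2]; rewrite /swapl.
set M := drop _ _; case: ifP => // /andP[/eqP e1 /eqP e2] [<- <-].
move: e1; move: M e2 => M -> ->.
by rewrite /eqlay2 /lay /= !asrcE !atgtE swap_core -!catA; split.
Qed.

Lemma swaprP l m m' l' : swapr sg l m = Some (m', l') -> eqlay2 l m m' l'.
Proof.
case: l m => [[L1 i] R1] [[L2 j] R2]; rewrite /swapr.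
set M := drop _ _; case: ifP => // /andP[/eqP e1 /eqP e2] [<- <-].
move: e1; move: M e2 => M -> ->.
by rewrite /eqlay2 /lay /= !asrcE !atgtE swap_core -!catA; split.
Qed.

Lemma swapP l m m' l' : swap sg l m = Some (m', l') -> eqlay2 l m m' l'.
Proof.
rewrite /swap; case e: swapl => [[a b]|]; last exact: swaprP.
by case=> <- <-; apply: swaplP.
Qed.

Lemma pcomp_whisk_id A B p q : ptgt p = psrc q -> pcomp q p = pid (psrc p) ->
  pcomp (ptens (pid A) (ptens q (pid B))) (ptens (pid A) (ptens p (pid B)))
  = pid (A ++ psrc p ++ B).
Proof.
move=> e1 e; rewrite !pinterchange //= ?e1 // e.
by rewrite (pcomp1p (pid A)) (pcomp1p (pid B)) !ptens_id.
Qed.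

Lemma cancelsP l m : cancels rules l m ->
  [/\ pcomp (lay m) (lay l) = pid (psrc (lay l)) & ptgt (lay m) = psrc (lay l)].
Proof.
case: rulesP => /allP r1 r2 /hasP[r rr].
move: (take _ _) (drop _ _) => A B /andP[/eqP-> /eqP->]; rewrite !lay_whisk.
have e := r2 _ rr; have /eqP := r1 _ rr; rewrite ltgtE lsrcE => e1.
split; first by rewrite (pcomp_whisk_id A B e1 e).
have : ptgt (lay r.2) = psrc (lay r.1) by have /= := congr1 ptgt e.
by move: (lay r.1) (lay r.2) => p q /= ->.
Qed.

Definition weq X (w w' : seq layer) Y := wt sg X w' Y /\ wsem X w' = wsem X w.

Lemma weq_swap X l m m' l' w Y : eqlay2 l m m' l' ->
  wt sg X (l :: m :: w) Y -> weq X (l :: m :: w) (m' :: l' :: w) Y.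
Proof.
case=> e1 e2 e3 e4; rewrite /weq !wt_cons !wsem_cons.
case/and3P=> /eqP-> /eqP em t; rewrite e2 e3 e4 !eqxx; split=> //.
have es := wt_src t.
rewrite -(@pcompA (lay m') (lay l')) ?e3 ?e4 ?es // -e1.
by rewrite (@pcompA (lay l) (lay m)) ?em ?es.
Qed.

Lemma weq_cons X l w w' Y : weq (ltgt sg l) w w' Y ->
  wt sg X (l :: w) Y -> weq X (l :: w) (l :: w') Y.
Proof. by rewrite /weq /= ltgtE => -[t ->] /andP[-> _]. Qed.

Lemma weq_trans X w1 w2 w3 Y : weq X w1 w2 Y -> weq X w2 w3 Y -> weq X w1 w3 Y.
Proof. by case=> _ e1 [t2 e2]; split=> //; rewrite e2. Qed.

Lemma weq_cancels X l m w Y : cancels rules l m ->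
  wt sg X (l :: m :: w) Y -> weq X (l :: m :: w) w Y.
Proof.
case/cancelsP=> e1 e2; rewrite /weq !wt_cons !wsem_cons => /and3P[/eqP-> /eqP em t].
have es := wt_src t; rewrite -e2; split=> //.
rewrite -pcompA ?es // e1 -e2.
by have := pcompp1 (wsem (ptgt (lay m)) w); rewrite es => ->.
Qed.

Lemma push_weq X l w w' Y : push sg rules l w = Some w' ->
  wt sg X (l :: w) Y -> weq X (l :: w) w' Y.
Proof.
elim: w X l w' => [|m w IHw] X l w' //=.
case: ifP => [lm [<-] t|_]; first exact: weq_cancels.
case e: swap => [[m' l']|] //; case ew: push => [w2|] //= [<-] t.
have [t1 e1] := weq_swap (swapP e) t.
apply: weq_trans (conj t1 e1) _; apply: weq_cons (t1).
by move: t1 => /= /andP[_ t1]; apply: IHw ew t1.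
Qed.

Lemma cancel1_weq X w w' Y : cancel1 sg rules w = Some w' ->
  wt sg X w Y -> weq X w w' Y.
Proof.
elim: w X w' => [|l w IHw] X w' //=.
case e: push => [w2|]; first by case=> <-; apply: push_weq.
case ew: cancel1 => [w2|] //= [<-] t; apply: weq_cons (t).
by move: t => /andP[_ t]; apply: IHw.
Qed.

Lemma weq_catl X w1 w2 w2' Y : (forall Z, wt sg Z w2 Y -> weq Z w2 w2' Y) ->
  wt sg X (w1 ++ w2) Y -> weq X (w1 ++ w2) (w1 ++ w2') Y.
Proof.
move=> h; elim: w1 X => [|l w1 IHw] X //=; first exact: h.
by move=> t; apply: weq_cons (t); move: t => /andP[_ t]; apply: IHw.
Qed.

Lemma pull_weq m rw rw' : pull sg rules m rw = Some rw' ->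
  forall X w Y, wt sg X (rev rw ++ m :: w) Y -> weq X (rev rw ++ m :: w) (rev rw' ++ w) Y.
Proof.
elim: rw m rw' => [|l rw IHrw] m rw' //=.
case: ifP => [lm [<-] X w Y|_].
  rewrite rev_cons cat_rcons; apply: weq_catl => Z; exact: weq_cancels.
case e: swap => [[m' l']|] //; case ew: pull => [rw2|] //= [<-] X w Y.
rewrite !rev_cons !cat_rcons => t.
have h : weq X (rev rw ++ l :: m :: w) (rev rw ++ m' :: l' :: w) Y.
  by apply: weq_catl t => Z; apply: weq_swap (swapP e).
by apply: weq_trans (h) _; apply: IHrw ew _ _ _ (proj1 h).
Qed.

Lemma rcancel1_weq rw rw' : rcancel1 sg rules rw = Some rw' ->
  forall X w Y, wt sg X (rev rw ++ w) Y -> weq X (rev rw ++ w) (rev rw' ++ w) Y.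
Proof.
elim: rw rw' => [|l rw IHrw] rw' //=.
case e: pull => [w2|].
  by case=> <- X w Y; rewrite rev_cons cat_rcons; apply: pull_weq.
case ew: rcancel1 => [w2|] //= [<-] X w Y.
by rewrite !rev_cons !cat_rcons; apply: IHrw.
Qed.

Lemma cancel_weq X w Y : wt sg X w Y -> weq X w (cancel sg rules w) Y.
Proof.
rewrite /cancel => t; case e1: cancel1 => [w'|]; first exact: cancel1_weq.
case e2: rcancel1 => [rw|]; last by split.
by have := rcancel1_weq e2 (w := [::]); rewrite revK !cats0; apply.
Qed.

Lemma passl_weq X w Y : wt sg X w Y -> weq X w (passl sg w) Y.
Proof.
elim: w X => [|l w IHw] X /= => [|t]; first by split.
have t' := t; move: t' => /andP[_ /IHw hw].
have h := weq_cons hw t.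
move: h; case: passl => [|m w2] // h; case: wantl => //.
case e: swapl => [[m' l']|] //; apply: weq_trans (h) _.
exact: weq_swap (swaplP e) (proj1 h).
Qed.

Lemma passr_weq X w Y : wt sg X w Y -> weq X w (passr sg w) Y.
Proof.
elim: w X => [|l w IHw] X /= => [|t]; first by split.
have t' := t; move: t' => /andP[_ /IHw hw].
have h := weq_cons hw t.
move: h; case: passr => [|m w2] // h; case: wantl => //.
case e: swapr => [[m' l']|] //; apply: weq_trans (h) _.
exact: weq_swap (swaprP e) (proj1 h).
Qed.

Lemma weq_iter (F : seq layer -> seq layer) X n w Y :
  (forall w, wt sg X w Y -> weq X w (F w) Y) -> wt sg X w Y -> weq X w (iter n F w) Y.
Proof.
move=> h t; elim: n => [|n IHn] /=; first by split.
by apply: weq_trans (IHn) _; apply: h; case: IHn.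
Qed.

Lemma nf_weq X w Y : wt sg X w Y -> weq X w (nf sg rules w) Y.
Proof.
have cl n w' : wt sg X w' Y -> weq X w' (iter n (cancel sg rules) (iter n (passl sg) w')) Y.
  move=> t; have h := weq_iter n (fun w => @passl_weq X w Y) t.
  by apply: weq_trans (h) _; apply: weq_iter (proj1 h) => ?; apply: cancel_weq.
have cr n w' : wt sg X w' Y -> weq X w' (iter n (cancel sg rules) (iter n (passr sg) w')) Y.
  move=> t; have h := weq_iter n (fun w => @passr_weq X w Y) t.
  by apply: weq_trans (h) _; apply: weq_iter (proj1 h) => ?; apply: cancel_weq.
move=> t; rewrite /nf; set n := size w.
have h1 := cl n _ t; have h2 := weq_trans h1 (cr n _ (proj1 h1)).
have h3 := weq_trans h2 (cl n _ (proj1 h2)); have h4 := weq_trans h3 (cr n _ (proj1 h3)).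
have h5 := weq_trans h4 (cl n _ (proj1 h4)).
apply: weq_trans (h5) _; apply: weq_iter (proj1 h5) => ?; exact: passl_weq.
Qed.

(** Coefficients are integers only; a scalar of [R] has to be split off with [congr] before
    reification. *)
Definition lcomb := seq (int * seq layer).
Definition lsem X Y (l : lcomb) : hom C X Y := \sum_(p <- l) unpk X Y (wsem X p.2) *~ p.1.

Definition reif X Y (f : hom C X Y) (l : lcomb) :=
  all (fun p => wt sg X p.2 Y) l /\ f = lsem X Y l.

Lemma reif_atom X Y (f : hom C X Y) i : nth (pid [::]) env i = Pk f ->
  reif f [:: (1, [:: ([::], i, [::])])].
Proof.
move=> e; have {}e : atom i = Pk f by []; have le : lay ([::], i, [::]) = Pk f.
  by rewrite /lay e ptensp1 ptens1p.
split; first by rewrite /= lsrcE ltgtE le /= !eqxx.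
by rewrite /lsem big_seq1 [wsem _ _]wsem_cons le /pid pcompE (comp1f HC) mulr1z PkK.
Qed.

Lemma reif_id X : reif (idm X) [:: (1, [::])].
Proof. by split; rewrite /= ?eqxx // /lsem big_seq1 /= mulr1z PkK. Qed.

Lemma reif_comp X Y Z (g : hom C Y Z) (f : hom C X Y) lg lf :
  reif g lg -> reif f lf ->
  reif (g ∘ f) [seq (p.1 * q.1, q.2 ++ p.2) | p <- lg, q <- lf].
Proof.
case=> /allP tg -> [/allP tf ->]; split.
  apply/allP=> _ /allpairsP[[p q] /= [/tg tp /tf tq ->]] /=; exact: wt_cat tq tp.
rewrite /lsem big_allpairs_dep /= comp_suml // big_seq [RHS]big_seq.
apply: eq_bigr => p /tg tp; rewrite comp_sumr // big_seq [RHS]big_seq.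
apply: eq_bigr => q /tf tq.
have -> : wsem X (q.2 ++ p.2) = Pk (unpk Y Z (wsem Y p.2) ∘ unpk X Y (wsem X q.2)).
  rewrite (wsem_cat tq tp) -pcompE !unpkK ?(wt_src tp) ?(wt_tgt tp) //.
    by rewrite (wt_src tq). by rewrite (wt_tgt tq).
rewrite PkK; move: (unpk _ _ _) (unpk _ _ _) => F G.
by rewrite -!scaler_int compZl // compZr // scalerA intrM.
Qed.

Lemma reif_tens X Y Z W (f : hom C X Y) (g : hom C Z W) lf lg :
  reif f lf -> reif g lg ->
  reif (f ⊗ g) [seq (p.1 * q.1, map (whisk [::] Z) p.2 ++ map (whisk Y [::]) q.2)
                | p <- lf, q <- lg].
Proof.
case=> /allP tf -> [/allP tg ->].
have t1 p : p \in lf -> wt sg (X ++ Z) (map (whisk [::] Z) p.2) (Y ++ Z).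
  by move/tf/(wt_whisk [::] Z).
have t2 q : q \in lg -> wt sg (Y ++ Z) (map (whisk Y [::]) q.2) (Y ++ W).
  by move/tg/(wt_whisk Y [::]); rewrite !cats0.
split.
  apply/allP=> _ /allpairsP[[p q] /= [/t1 tp /t2 tq ->]] /=; exact: wt_cat tp tq.
rewrite /lsem big_allpairs_dep /= tens_suml // big_seq [RHS]big_seq.
apply: eq_bigr => p lp; rewrite tens_sumr // big_seq [RHS]big_seq.
apply: eq_bigr => q lq.
have -> : wsem (X ++ Z) (map (whisk [::] Z) p.2 ++ map (whisk Y [::]) q.2)
    = Pk (unpk X Y (wsem X p.2) ⊗ unpk Z W (wsem Z q.2)).
  rewrite (wsem_cat (t1 _ lp) (t2 _ lq)).
  have := wsem_whisk Y [::] (tg _ lq); rewrite cats0 => ->.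
  have := wsem_whisk [::] Z (tf _ lp); rewrite /= => ->.
  rewrite ptensp1 ptens1p.
  have -> : Pk (unpk X Y (wsem X p.2) ⊗ unpk Z W (wsem Z q.2))
     = ptens (Pk (unpk X Y (wsem X p.2))) (Pk (unpk Z W (wsem Z q.2))) by [].
  have [eX eY] := wt_types (tf _ lp); have [eZ eW] := wt_types (tg _ lq).
  rewrite !unpkK //.
  rewrite pinterchange //=.
by have := pcomp1p (wsem X p.2); have := pcompp1 (wsem Z q.2); rewrite eY eZ => -> ->.
rewrite PkK; move: (unpk _ _ _) (unpk _ _ _) => F G.
by rewrite -!scaler_int tensZl // tensZr // scalerA intrM.
Qed.

Lemma reif_add X Y (f g : hom C X Y) lf lg : reif f lf -> reif g lg ->
  reif (f + g) (lf ++ lg).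
Proof. by case=> tf -> [tg ->]; split; rewrite ?all_cat ?tf // /lsem big_cat. Qed.

Lemma reif_opp X Y (f : hom C X Y) lf : reif f lf ->
  reif (- f) [seq (- p.1, p.2) | p <- lf].
Proof.
case=> tf ->; split; first by rewrite all_map.
by rewrite /lsem big_map raddf_sum /=; apply: eq_bigr => p _; rewrite mulrNz.
Qed.

Lemma reif_zero X Y : reif (0 : hom C X Y) [::].
Proof. by split=> //; rewrite /lsem big_nil. Qed.

Definition collect (w : seq layer) (l : lcomb) : int :=
  foldr (fun p a => if p.2 == w then p.1 + a else a) 0 l.

Definition lnf (rs : seq (layer * layer)) (l : lcomb) : lcomb :=
  [seq (p.1, nf sg rs p.2) | p <- l].

Definition check (rs : seq (layer * layer)) (l1 l2 : lcomb) : bool :=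
  let n1 := lnf rs l1 in let n2 := lnf rs l2 in
  all (fun p => collect p.2 n1 == collect p.2 n2) (n1 ++ n2).

Lemma collectE w l : collect w l = \sum_(p <- l | p.2 == w) p.1.
Proof. by elim: l => [|p l IHl]; rewrite ?big_nil // big_cons /= IHl. Qed.

Lemma lsem_nf X Y l : all (fun p => wt sg X p.2 Y) l -> lsem X Y (lnf rules l) = lsem X Y l.
Proof.
move/allP=> t; rewrite /lsem big_map big_seq [RHS]big_seq; apply: eq_bigr => p /t tp /=.
by have [_ ->] := nf_weq tp.
Qed.

Lemma lsem_collect X Y (l : lcomb) (ws : seq (seq layer)) : uniq ws ->
  {subset [seq p.2 | p <- l] <= ws} ->
  lsem X Y l = \sum_(w <- ws) unpk X Y (wsem X w) *~ collect w l.
Proof.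
move=> u sub; rewrite (eq_bigr (fun w => \sum_(p <- l | p.2 == w) unpk X Y (wsem X p.2) *~ p.1)).
  rewrite (exchange_big_dep xpredT) //= /lsem big_seq [RHS]big_seq; apply: eq_bigr => p lp.
  have pw : p.2 \in ws by apply: sub; apply: map_f.
  under eq_bigl => w do rewrite eq_sym; rewrite -big_filter.
  suff -> : [seq w <- ws | w == p.2] = [:: p.2] by rewrite big_seq1.
  by rewrite -(filter_pred1_uniq u pw).
move=> w _; rewrite collectE mulrz_sumr; apply: eq_bigr => p /eqP-> //.
Qed.

Lemma checkP X Y (f g : hom C X Y) lf lg : reif f lf -> reif g lg ->
  check rules lf lg -> f = g.
Proof.
case=> tf -> [tg ->]; rewrite -(lsem_nf tf) -(lsem_nf tg) /check.
move: (lnf _ lf) (lnf _ lg) => nf1 nf2 /allP h.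
pose ws := undup [seq p.2 | p <- nf1 ++ nf2].
rewrite (@lsem_collect _ _ nf1 ws) ?undup_uniq //; last first.
  by move=> w /mapP[p pl ->]; rewrite mem_undup map_f // mem_cat pl.
rewrite (@lsem_collect _ _ nf2 ws) ?undup_uniq //; last first.
  by move=> w /mapP[p pl ->]; rewrite mem_undup map_f // mem_cat pl orbT.
rewrite big_seq [RHS]big_seq; apply: eq_bigr => w; rewrite mem_undup => /mapP[p pl ->].
by rewrite (eqP (h _ pl)).
Qed.

End Packed.
Arguments Pk {R C psrc ptgt} pval.

Section Rules.
Context {R : comPzRingType} {C : lmcat R} (HC : lmcat_axioms C).
Variables (env : seq (@pmor R C)) (sg : seq (seq bool * seq bool)) (sgE : sigma env = sg).

Definition rules_ok (rs : seq (layer * layer)) :=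
  all (fun r : layer * layer => ltgt sg r.1 == lsrc sg r.2) rs /\
  forall r, r \in rs -> pcomp (lay env r.2) (lay env r.1) = pid (psrc (lay env r.1)).

Lemma rules_nil : rules_ok [::].
Proof. by []. Qed.

Lemma rules_cons X (f : hom C X X) l m rs : f = idm X ->
  reif env sg f [:: (1, [:: l; m])] -> rules_ok rs -> rules_ok ((l, m) :: rs).
Proof.
move=> -> [/andP[t _] e] [r1 r2]; have {}t : wt sg X [:: l; m] X by [].
move: e; rewrite /lsem big_seq1 mulr1z => /(congr1 Pk).
rewrite (unpkK (wt_src sgE t) (wt_tgt sgE t)) !wsem_cons => e.
move: t; rewrite !(wt_cons sgE) => /and3P[/eqP eX e1 _].
split=> /=; first by rewrite (ltgtE sgE) (lsrcE sgE) e1.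
move=> r; rewrite inE => /orP[/eqP-> {r}|/r2] //.
suff: pcomp (lay env m) (lay env l) = pid (psrc (lay env l)) by [].
by rewrite -eX [RHS]e; congr pcomp; rewrite -[LHS](pcomp1p HC).
Qed.

End Rules.
Lemma eq_by (V : zmodType) (a b u v : V) : u = v -> a + v = b + u -> a = b.
Proof. by move=> -> /addIr. Qed.

Notation DD := [:: false; false].

Definition smate (R : comPzRingType) (C : lmcat R) (D : heis_data C) : hom C DD DD :=
  (idm DD ⊗ (hd D ∘ (idm U ⊗ hd D ⊗ idm Dn))) ∘
  (idm DD ⊗ hs D ⊗ idm DD) ∘ (((idm Dn ⊗ hc D ⊗ idm U) ∘ hc D) ⊗ idm DD).

(* [mon rs] proves equalities that follow from the axioms of a strict monoidal
   category, bilinearity, and the relations in the tuple [rs], each of which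
   equates a composite of two layers with an identity; [lc hs rs] proves
   [a = b] if [a - b] is the sum of the [l - r] for the [l = r] in [hs]. *)
Ltac cat_insert f acc :=
  let rec mem l := lazymatch l with
    | nil => constr:(false)
    | cons (@Pk _ _ _ _ f) _ => constr:(true)
    | cons _ ?l' => mem l'
    end in
  lazymatch mem acc with
  | true => acc
  | false =>
    lazymatch type of f with
    | GRing.Lmodule.sort (@Defs.hom ?R ?C ?X ?Y) => constr:(cons (@Pk R C X Y f) acc)
    end
  end.

Ltac cat_atoms e acc :=
  lazymatch e with
  | @mcomp _ _ _ _ _ ?g ?f => let acc := cat_atoms g acc in cat_atoms f acc
  | @tens _ _ _ _ _ _ ?f ?g => let acc := cat_atoms f acc in cat_atoms g acc
  | @idm _ _ _ => acc
  | (?a + ?b)%R => let acc := cat_atoms a acc in cat_atoms b acc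
  | (- ?a)%R => cat_atoms a acc
  | 0%R => acc
  | _ => cat_insert e acc
  end.

Ltac cat_index f l :=
  lazymatch l with
  | cons (@Pk _ _ _ _ f) _ => constr:(0%N)
  | cons _ ?l' => let n := cat_index f l' in constr:(S n)
  end.

Ltac cat_reify HC env sg l sgE e :=
  lazymatch e with
  | @mcomp _ _ ?X ?Y ?Z ?g ?f =>
    let pg := cat_reify HC env sg l sgE g in let pf := cat_reify HC env sg l sgE f in
    constr:(@reif_comp _ _ HC env sg sgE X Y Z g f _ _ pg pf)
  | @tens _ _ ?X ?Y ?Z ?W ?f ?g =>
    let pf := cat_reify HC env sg l sgE f in let pg := cat_reify HC env sg l sgE g in
    constr:(@reif_tens _ _ HC env sg sgE X Y Z W f g _ _ pf pg)
  | @idm _ _ ?X => constr:(@reif_id _ _ env sg X)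
  | (?a + ?b)%R =>
    let pa := cat_reify HC env sg l sgE a in let pb := cat_reify HC env sg l sgE b in
    constr:(reif_add pa pb)
  | (- ?a)%R => let pa := cat_reify HC env sg l sgE a in constr:(reif_opp pa)
  | 0%R => lazymatch type of e with
    | context [@Defs.hom _ _ ?X ?Y] => constr:(@reif_zero _ _ env sg X Y)
    end
  | _ => let i := cat_index e l in
    lazymatch type of e with
    | GRing.Lmodule.sort (@Defs.hom _ _ ?X ?Y) =>
      constr:(@reif_atom _ _ HC env sg sgE X Y e i erefl)
    end
  end.

Ltac rule_atoms rs acc :=
  lazymatch rs with
  | tt => acc
  | pair ?a ?b => let acc := rule_atoms a acc in rule_atoms b acc
  | _ => lazymatch type of rs with ?f = _ => cat_atoms f acc end
  end.

Ltac cat_rules HC env sg l sgE rs rest :=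
  lazymatch rs with
  | tt => rest
  | pair ?a ?b =>
    let rest := cat_rules HC env sg l sgE b rest in cat_rules HC env sg l sgE a rest
  | _ =>
    lazymatch type of rs with ?f = @idm _ _ ?X =>
      let p := cat_reify HC env sg l sgE f in
      lazymatch type of p with reif _ _ _ ?lf =>
        let w := eval vm_compute in lf in
        lazymatch w with cons (_, cons ?a (cons ?b nil)) nil =>
          constr:(@rules_cons _ _ HC env sg sgE X f a b _ rs p rest)
        end
      end
    end
  end.

Ltac mon rs :=
  cbv beta delta [ht dxr cxr xpr smate tpr D1 D2];
  lazymatch goal with
  | HC : @lmcat_axioms ?R ?C |- ?a = ?b =>
    let l := rule_atoms rs (@nil (@pmor R C)) in
    let l := cat_atoms a l in let l := cat_atoms b l in
    let env := fresh "env" in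
    pose env := l;
    let sg := eval lazy in (sigma l) in
    let sgE := constr:(erefl : sigma env = sg) in
    let pr := cat_rules HC env sg l sgE rs (rules_nil env sg) in
    let pa := cat_reify HC env sg l sgE a in
    let pb := cat_reify HC env sg l sgE b in
    refine (@checkP _ _ HC env sg sgE _ pr _ _ _ _ _ _ pa pb _);
    vm_compute; exact erefl
  end.

Ltac lc_steps hs :=
  lazymatch hs with
  | tt => idtac
  | pair ?a ?b => lc_steps a; lc_steps b
  | _ => let H := fresh "H" in have H := hs; cbv beta in H; refine (eq_by H _)
  end.
Ltac lc hs rs := lc_steps hs; mon rs.

Section Contexts.
Context {R : comPzRingType} {C : lmcat R}.

(** Instances of a relation inside a larger diagram, in the form in which [lc] adds them to a goal.
    The bracketing of [g] and [f] is immaterial, since the normalisation absorbs it. *)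
Lemma ctx A X Y (l r : hom C X Y) B (e : l = r) Z W
    (g : hom C (A ++ Y ++ B) Z) (f : hom C W (A ++ X ++ B)) :
  g ∘ (idm A ⊗ (l ⊗ idm B)) ∘ f = g ∘ (idm A ⊗ (r ⊗ idm B)) ∘ f.
Proof. by rewrite e. Qed.

Lemma ctxl A X Y (l r : hom C X Y) B (e : l = r) Z (g : hom C (A ++ Y ++ B) Z) :
  g ∘ (idm A ⊗ (l ⊗ idm B)) = g ∘ (idm A ⊗ (r ⊗ idm B)).
Proof. by rewrite e. Qed.

Lemma ctxr A X Y (l r : hom C X Y) B (e : l = r) W (f : hom C W (A ++ X ++ B)) :
  (idm A ⊗ (l ⊗ idm B)) ∘ f = (idm A ⊗ (r ⊗ idm B)) ∘ f.
Proof. by rewrite e. Qed.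

Lemma ctx0 A X Y (l r : hom C X Y) B (e : l = r) :
  idm A ⊗ (l ⊗ idm B) = idm A ⊗ (r ⊗ idm B).
Proof. by rewrite e. Qed.

End Contexts.
Arguments ctx {R C} A {X Y l r} B e {Z W} g f.
Arguments ctxl {R C} A {X Y l r} B e {Z} g.
Arguments ctxr {R C} A {X Y l r} B e {W} f.
Arguments ctx0 {R C} A {X Y l r} B e.

Arguments Defs.xp : simpl never.

(** * Right adjunction and dotted crossings *)

Section Basics.
Context {R : comPzRingType} {C : lmcat R} (HC : lmcat_axioms C).
Context {k : int} {D : heis_data C} (HD : heis_rels k D).
Local Notation x := (hx D).
Local Notation s := (hs D).
Local Notation c := (hc D).
Local Notation d := (hd D).
Local Notation t := (ht D).
Local Notation x' := (xpr D).
Local Notation s' := (smate D).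
Local Notation xp := (xp D).
Local Notation iU := (@idm _ C U).
Local Notation iD := (@idm _ C Dn).

Lemma heis_ss : s ∘ s = idm [:: true; true].
Proof. by case: HD => -[]. Qed.

Lemma heis_braid : (s ⊗ iU) ∘ ((iU ⊗ s) ∘ (s ⊗ iU)) = (iU ⊗ s) ∘ ((s ⊗ iU) ∘ (iU ⊗ s)).
Proof. by case: HD => -[]. Qed.

Lemma heis_hecke : (x ⊗ iU) ∘ s - s ∘ (iU ⊗ x) = idm [:: true; true].
Proof. by case: HD => -[]. Qed.

Lemma heis_zig : (d ⊗ iU) ∘ (iU ⊗ c) = iU.
Proof. by case: HD => -[]. Qed.

Lemma heis_zag : (iD ⊗ d) ∘ (c ⊗ iD) = iD.
Proof. by case: HD => -[]. Qed.

Let ss := heis_ss.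
Let zig := heis_zig.
Let zag := heis_zag.

Lemma xp0 : xp 0 = iU.
Proof. by []. Qed.

Lemma xpS n : xp n.+1 = x ∘ xp n.
Proof. by []. Qed.

Lemma xpSr n : xp n.+1 = xp n ∘ x.
Proof.
elim: n => [|n IHn]; first by rewrite xpS ?xp0; mon tt.
by rewrite xpS {1}IHn xpS; mon tt.
Qed.

Lemma xpD m n : xp (m + n) = xp m ∘ xp n.
Proof.
elim: m => [|m IHm]; first by rewrite add0n ?xp0; mon tt.
by rewrite addSn !xpS IHm; mon tt.
Qed.

Lemma hecke_r : (iU ⊗ x) ∘ s = s ∘ (x ⊗ iU) - idm [:: true; true].
Proof. lc (ctx [::] [::] (esym heis_hecke) s s) ss. Qed.

Lemma xp_s r : (xp r ⊗ iU) ∘ s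
  = s ∘ (iU ⊗ xp r) + \sum_(i < r) xp i ⊗ xp (r - i.+1).
Proof.
elim: r => [|r IHr]; first by rewrite big_ord0 addr0 ?xp0; mon tt.
have -> : (xp r.+1 ⊗ iU) ∘ s = (x ⊗ iU) ∘ ((xp r ⊗ iU) ∘ s) by rewrite xpS; mon tt.
rewrite IHr big_ord_recl subn1 /= ?xp0 (compDr HC) (comp_sumr HC) addrA; congr (_ + _).
  by rewrite xpS; lc (ctxr [::] [::] heis_hecke (iU ⊗ xp r)) tt.
by apply: eq_bigr => i _; rewrite subSS /bump leq0n add1n xpS; mon tt.
Qed.

Lemma s_xp r : (iU ⊗ xp r) ∘ s
  = s ∘ (xp r ⊗ iU) - \sum_(i < r) xp i ⊗ xp (r - i.+1).
Proof.
elim: r => [|r IHr]; first by rewrite big_ord0 subr0 ?xp0; mon tt.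
have -> : (iU ⊗ xp r.+1) ∘ s = (iU ⊗ x) ∘ ((iU ⊗ xp r) ∘ s) by rewrite xpS; mon tt.
rewrite IHr big_ord_recr subnn /= ?xp0 (compDr HC) (compNr HC) (comp_sumr HC).
rewrite opprD [LHS]addrC [RHS]addrCA; congr (_ + _).
  congr (- _); apply: eq_bigr => i _; rewrite (subSn (ltn_ord i)) xpS; mon tt.
by rewrite xpS; lc (ctxr [::] [::] hecke_r (xp r ⊗ iU)) tt.
Qed.

(** The affine Hecke relation rotated by [c] and [d]: its identity term becomes the cup above the
    cap, [c ∘ d]. *)
Lemma t_x : t ∘ (x ⊗ iD) = (iD ⊗ x) ∘ t - c ∘ d.
Proof. by lc (ctx Dn Dn (esym heis_hecke) (iD ⊗ iU ⊗ d) (c ⊗ iU ⊗ iD)) (zig,zag). Qed.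

Lemma t_xp r : t ∘ (xp r ⊗ iD) = (iD ⊗ xp r) ∘ t
  - \sum_(i < r) (iD ⊗ xp i) ∘ c ∘ d ∘ (xp (r - i.+1) ⊗ iD).
Proof.
elim: r => [|r IHr]; first by rewrite big_ord0 subr0 ?xp0; mon tt.
have -> : t ∘ (xp r.+1 ⊗ iD) = (iD ⊗ x) ∘ (t ∘ (xp r ⊗ iD)) - c ∘ d ∘ (xp r ⊗ iD).
  by rewrite xpS; lc (ctxr [::] [::] t_x (xp r ⊗ iD)) tt.
rewrite IHr big_ord_recl subn1 /= ?xp0 (compDr HC) (compNr HC) (comp_sumr HC) opprD.
rewrite [RHS]addrA [LHS]addrAC; congr (_ + _); last first.
  by congr (- _); apply: eq_bigr => i _; rewrite subSS /bump leq0n add1n xpS; mon tt.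
by rewrite xpS; mon tt.
Qed.

Lemma t_xpr : t ∘ (iU ⊗ x') = (x' ⊗ iU) ∘ t - c ∘ d.
Proof. by lc (ctx Dn Dn hecke_r (iD ⊗ iU ⊗ d) (c ⊗ iU ⊗ iD)) (zig,zag). Qed.

Lemma d_xpr : d ∘ (iU ⊗ x') = d ∘ (x ⊗ iD).
Proof. by mon (zig, zag). Qed.

Lemma xpr_c : (x' ⊗ iU) ∘ c = (iD ⊗ x) ∘ c.
Proof. by mon (zig, zag). Qed.

(** The braid relation with one strand turned down; in [braid_smate] two strands are turned down. *)
Lemma braid_t : (t ⊗ iU) ∘ (iU ⊗ t) ∘ (s ⊗ iD) = (iD ⊗ s) ∘ (t ⊗ iU) ∘ (iU ⊗ t).
Proof.
by lc (ctx Dn Dn (esym heis_braid) (iD ⊗ iU ⊗ iU ⊗ d) (c ⊗ iU ⊗ iU ⊗ iD)) (zig,zag).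
Qed.

Lemma braid_smate : (iD ⊗ t) ∘ (t ⊗ iD) ∘ (iU ⊗ s') = (s' ⊗ iU) ∘ (iD ⊗ t) ∘ (t ⊗ iD).
Proof.
by lc (ctx DD DD (esym heis_braid) (iD ⊗ iD ⊗ iU ⊗ (d ∘ (iU ⊗ d ⊗ iD)))
   (((iD ⊗ c ⊗ iU) ∘ c) ⊗ iU ⊗ iD ⊗ iD)) (zig,zag).
Qed.

End Basics.

(** * Curls *)

Section Curls.
Context {R : comPzRingType} {C : lmcat R} (HC : lmcat_axioms C).
Context {k : int} {D : heis_data C} (HD : heis_rels k D).
Local Notation x := (hx D).
Local Notation s := (hs D).
Local Notation c := (hc D).
Local Notation d := (hd D).
Local Notation t := (ht D).
Local Notation s' := (smate D).
Local Notation xp := (xp D).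
Local Notation iU := (@idm _ C U).
Local Notation iD := (@idm _ C Dn).
Let ss := heis_ss HD.
Let zig := heis_zig HD.
Let zag := heis_zag HD.

(** With [e := c'] and [f := d'] the two curls are the left sides of (iv). *)
Definition rcurl (e : hom C [::] [:: true; false]) n : hom C U U :=
  (iU ⊗ d) ∘ ((iU ⊗ xp n ⊗ iD) ∘ ((s ⊗ iD) ∘ (iU ⊗ e))).
Definition lcurl (f : hom C [:: false; true] [::]) n : hom C U U :=
  (f ⊗ iU) ∘ ((iD ⊗ xp n ⊗ iU) ∘ ((iD ⊗ s) ∘ (c ⊗ iU))).

Lemma rcurl0 e : rcurl e 0 = (d ⊗ iU) ∘ (iU ⊗ (t ∘ e)).
Proof. by rewrite /rcurl xp0; mon (zig, zag). Qed.

Lemma lcurl0 f : lcurl f 0 = ((f ∘ t) ⊗ iU) ∘ (iU ⊗ c).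
Proof. by rewrite /lcurl xp0; mon (zig, zag). Qed.

Lemma rcurlS e n : rcurl e n.+1 = rcurl e n ∘ x - iU ⊗ (d ∘ ((xp n ⊗ iD) ∘ e)).
Proof.
rewrite /rcurl (xpSr HC).
lc (ctx [::] Dn (hecke_r HC HD) (iU ⊗ (d ∘ (xp n ⊗ iD))) (iU ⊗ e)) tt.
Qed.

Lemma lcurlS f n : lcurl f n.+1 = lcurl f n ∘ x + (f ∘ ((iD ⊗ xp n) ∘ c)) ⊗ iU.
Proof.
rewrite /lcurl (xpSr HC).
lc (ctx Dn [::] (heis_hecke HD) ((f ∘ (iD ⊗ xp n)) ⊗ iU) (c ⊗ iU)) tt.
Qed.

Lemma s_xp_s n : s ∘ (xp n ⊗ iU) ∘ s = iU ⊗ xp n + \sum_(i < n) (xp i ⊗ xp (n - i.+1)) ∘ s.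
Proof.
rewrite -(comp_suml HC); set S := \sum_(i < n) _.
have e : s ∘ (xp n ⊗ iU) = (iU ⊗ xp n) ∘ s + S by rewrite (s_xp HC HD) subrK.
by rewrite e (compDl HC); congr (_ + _); mon ss.
Qed.

Lemma s_1xp_s n : s ∘ (iU ⊗ xp n) ∘ s = xp n ⊗ iU - \sum_(i < n) (xp i ⊗ xp (n - i.+1)) ∘ s.
Proof.
rewrite -(comp_suml HC); set S := \sum_(i < n) _.
have e : s ∘ (iU ⊗ xp n) = (xp n ⊗ iU) ∘ s - S by rewrite (xp_s HC HD) addrK.
by rewrite e (compDl HC) (compNl HC); congr (_ + _); mon ss.
Qed.

(** In [s_xp_s] the dots of the correction lie above the remaining crossing, which then closes up to
    a curl. The comparison of [D1] and [D2] needs them below it. *)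
Lemma s_xp_s_below n : s ∘ (xp n ⊗ iU) ∘ s = iU ⊗ xp n + \sum_(i < n) s ∘ (xp i ⊗ xp (n - i.+1)).
Proof.
rewrite -(comp_sumr HC) -(Defs.compA HC) (xp_s HC HD) (compDr HC); congr (_ + _).
by mon ss.
Qed.

Lemma s_1xp_s_below n : s ∘ (iU ⊗ xp n) ∘ s = xp n ⊗ iU - \sum_(i < n) s ∘ (xp i ⊗ xp (n - i.+1)).
Proof.
rewrite -(comp_sumr HC) -(Defs.compA HC) (s_xp HC HD) (compDr HC) (compNr HC); congr (_ - _).
by mon ss.
Qed.

(** Straightening [t] into [s] puts the dots between two crossings, where [s_xp_s] applies. For few
    dots this is the dotted-cap test of the pitchfork; for arbitrary [n] it yields the bubble
    slide. *)
Lemma rslide e n : ((d ∘ (xp n ⊗ iD)) ⊗ iU) ∘ ((iU ⊗ t) ∘ ((s ⊗ iD) ∘ (iU ⊗ e)))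
  = iU ⊗ (d ∘ ((xp n ⊗ iD) ∘ e)) + \sum_(i < n) xp i ∘ rcurl e (n - i.+1).
Proof.
rewrite [LHS](_ : _ = (iU ⊗ d) ∘ (idm [::] ⊗ ((s ∘ (xp n ⊗ iU) ∘ s) ⊗ iD)) ∘ (iU ⊗ e)).
  by rewrite s_xp_s !(linE HC); congr (_ + _); [| apply: eq_bigr => i _; rewrite /rcurl]; mon tt.
by mon (zig, zag).
Qed.

Lemma lslide (f : hom C [:: false; true] [::]) n : (f ⊗ iU) ∘ ((iD ⊗ s) ∘ ((t ⊗ iU) ∘ (iU ⊗ ((iD ⊗ xp n) ∘ c))))
  = (f ∘ ((iD ⊗ xp n) ∘ c)) ⊗ iU - \sum_(i < n) xp (n - i.+1) ∘ lcurl f i.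
Proof.
rewrite [LHS](_ : _ = (f ⊗ iU) ∘ (iD ⊗ ((s ∘ (iU ⊗ xp n) ∘ s) ⊗ idm [::])) ∘ (c ⊗ iU)).
  rewrite s_1xp_s !(linE HC); congr (_ - _); [| apply: eq_bigr => i _; rewrite /lcurl]; mon tt.
by mon (zig, zag).
Qed.

Lemma d_xp_smate (e : hom C [::] [:: true; false]) n :
  ((d ∘ (xp n ⊗ iD)) ⊗ iD) ∘ ((iU ⊗ s') ∘ (e ⊗ iD))
  = (iD ⊗ d) ∘ ((t ∘ ((xp n ⊗ iD) ∘ e)) ⊗ iD).
Proof. by mon (zig, zag). Qed.

Lemma lcurl_below (f : hom C [:: false; true] [::]) n :
  (f ⊗ iU) ∘ ((iD ⊗ s) ∘ (((iD ⊗ xp n) ∘ c) ⊗ iU))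
  = xp n ∘ lcurl f 0 + \sum_(i < n) (f ∘ ((iD ⊗ xp i) ∘ c)) ⊗ xp (n - i.+1).
Proof.
have e : s ∘ (xp n ⊗ iU) = (iU ⊗ xp n) ∘ s + \sum_(i < n) xp i ⊗ xp (n - i.+1).
  by rewrite (s_xp HC HD) subrK.
rewrite [LHS](_ : _ = (f ⊗ iU) ∘ (iD ⊗ (s ∘ (xp n ⊗ iU))) ∘ (c ⊗ iU)); last by mon tt.
rewrite e !(linE HC); congr (_ + _); first by rewrite /lcurl xp0; mon tt.
by apply: eq_bigr => i _; mon tt.
Qed.

Lemma smate_xp_c (f : hom C [:: false; true] [::]) n :
  (iD ⊗ f) ∘ ((s' ⊗ iU) ∘ (iD ⊗ ((iD ⊗ xp n) ∘ c)))
  = (iD ⊗ (f ∘ ((iD ⊗ xp n) ∘ t))) ∘ (c ⊗ iD).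
Proof. by mon (zig, zag). Qed.

(** Abstract in [c'] and [d'], because the one-dot relation [h] has the same shape for both signs of
    k. *)
Lemma tau_xp_of (c' : hom C [::] [:: true; false]) (d' : hom C [:: false; true] [::])
    (h : (x ⊗ iD) ∘ htau D = htau D ∘ (iD ⊗ x) - c' ∘ d') n :
  (xp n ⊗ iD) ∘ htau D = htau D ∘ (iD ⊗ xp n)
    - \sum_(i < n) (xp i ⊗ iD) ∘ c' ∘ d' ∘ (iD ⊗ xp (n - i.+1)).
Proof.
elim: n => [|n IHn]; first by rewrite big_ord0 subr0 xp0; mon tt.
rewrite [LHS](_ : _ = (x ⊗ iD) ∘ ((xp n ⊗ iD) ∘ htau D)); last by rewrite xpS; mon tt.
rewrite IHn big_ord_recl subn1 /= ?xp0 (compDr HC) (compNr HC) (comp_sumr HC) opprD.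
rewrite [RHS]addrA; congr (_ - _); last first.
  by apply: eq_bigr => i _; rewrite subSS /bump leq0n add1n xpS; mon tt.
by rewrite xpS; lc (ctxr [::] [::] h (iD ⊗ xp n)) tt.
Qed.

End Curls.
Arguments rcurl {R C} D e n.
Arguments lcurl {R C} D f n.

(** * Nonnegative central charge *)

Section NonNegative.
Context {R : comPzRingType} {C : lmcat R} (HC : lmcat_axioms C).
Context {K : nat} {D : heis_data C} (HD : heis_rels K%:Z D).
Local Notation x := (hx D).
Local Notation s := (hs D).
Local Notation c := (hc D).
Local Notation d := (hd D).
Local Notation t := (ht D).
Local Notation tau := (htau D).
Local Notation e := (he D).
Local Notation x' := (xpr D).
Local Notation s' := (smate D).
Local Notation xp := (xp D).
Local Notation iU := (@idm _ C U).
Local Notation iD := (@idm _ C Dn).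
Local Notation c' := (cpr K%:Z D).
Local Notation d' := (dpr K%:Z D).
Local Notation cw0 := (cw0 K%:Z D).
Local Notation ccw0 := (ccw0 K%:Z D).
Local Notation one := (@idm _ C [::]).
Let ss := heis_ss HD.
Let zig := heis_zig HD.
Let zag := heis_zag HD.

Lemma tau_t : tau ∘ t + \sum_(r < K) e r ∘ dxr D r = idm [:: true; false].
Proof. by case: HD => _ _ _ []. Qed.

Lemma t_tau : t ∘ tau = idm [:: false; true].
Proof. by case: HD => _ _ _ []. Qed.

Lemma t_e r : (r < K)%N -> t ∘ e r = 0.
Proof. by case: HD => _ _ _ [_ _ h _ _] /h. Qed.

Lemma dxr_tau r : (r < K)%N -> dxr D r ∘ tau = 0.
Proof. by case: HD => _ _ _ [_ _ _ h _] /h. Qed.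

Lemma dxr_e r q : (r < K)%N -> (q < K)%N -> dxr D r ∘ e q = ((r == q)%:R : R) *: one.
Proof. by case: HD => _ _ _ [_ _ _ _ h] hr hq; apply: h. Qed.

(** Equations instead of a substitution, so that [c'], [d'] and [HD] keep their dependence on [K]
    and single occurrences can be rewritten. *)
Lemma K_cases : K = 0%N \/ exists n, [/\ K = n.+1, (0 < K)%N & (n < K)%N].
Proof. by case: K => [|n]; [left | right; exists n]. Qed.

Lemma cprE0 : K = 0%N -> c' = tau ∘ c.
Proof. by move=> ->; rewrite /cpr [`|_|%N]/= xp0 (tens_id HC) (comp1f HC). Qed.

Lemma cprE n : K = n.+1 -> c' = - e n.
Proof.
move=> ->; rewrite /cpr; have -> : `|n.+1%:Z - 1|%N = n by rewrite -addn1 PoszD addrK.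
by [].
Qed.

Lemma dprE : d' = d ∘ ((xp K ⊗ iD) ∘ tau).
Proof. by []. Qed.

Lemma detect L Z A (f g : hom C A (L ++ [:: true; false] ++ Z)) :
  (idm L ⊗ (t ⊗ idm Z)) ∘ f = (idm L ⊗ (t ⊗ idm Z)) ∘ g ->
  (forall r, (r < K)%N ->
     (idm L ⊗ (dxr D r ⊗ idm Z)) ∘ f = (idm L ⊗ (dxr D r ⊗ idm Z)) ∘ g) ->
  f = g.
Proof.
move=> et er.
have h (u : hom C A (L ++ [:: true; false] ++ Z)) :
    u = (idm L ⊗ (tau ⊗ idm Z)) ∘ ((idm L ⊗ (t ⊗ idm Z)) ∘ u) +
      \sum_(r < K) (idm L ⊗ (e r ⊗ idm Z)) ∘ ((idm L ⊗ (dxr D r ⊗ idm Z)) ∘ u).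
  rewrite -{1}[u](comp1f HC) -(tens_id HC) -(tens_id HC) -tau_t !(linE HC).
  rewrite (Defs.compA HC) !(Defs.interchange HC) !(comp1f HC); congr (_ + _).
  by apply: eq_bigr => r _; rewrite (Defs.compA HC) !(Defs.interchange HC) !(comp1f HC).
by rewrite (h f) (h g) et; congr (_ + _); apply: eq_bigr => r _; rewrite er.
Qed.

(** Since [c'] is minus the last [e], these bubbles are, up to sign, entries of the matrix product
    that equals the identity. *)
Lemma cw0_small r : (r < K)%N -> cw0 r = - (((r.+1 == K)%:R : R) *: one).
Proof.
case EK: K => [//|n] rn; rewrite eqSS -(dxr_e (q := n)) ?EK // /Defs.cw0 -EK (cprE EK).
mon tt.
Qed.

Lemma cw0_lt r : (r.+1 < K)%N -> cw0 r = 0.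
Proof.
by move=> rK; rewrite cw0_small ?(ltnW rK) // (ltn_eqF rK) scale0r oppr0.
Qed.

Lemma cw0_pred n : K = n.+1 -> cw0 n = - one.
Proof. by move=> EK; rewrite cw0_small ?EK // eqxx scale1r. Qed.

Lemma t_cpr_gt0 : (0 < K)%N -> t ∘ c' = 0.
Proof. by case EK: K => [//|n] _; rewrite -EK (cprE EK) (compNr HC) t_e ?EK // oppr0. Qed.

Lemma t_cpr_eq0 : K = 0%N -> t ∘ c' = c.
Proof. by move=> EK; rewrite cprE0 // (Defs.compA HC) t_tau (comp1f HC). Qed.

Lemma t_xp_cprE r : t ∘ ((xp r ⊗ iD) ∘ c') = (iD ⊗ xp r) ∘ (t ∘ c')
  - \sum_(i < r) (iD ⊗ xp i) ∘ c ∘ cw0 (r - i.+1).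
Proof.
rewrite (Defs.compA HC) (t_xp HC HD) (compDl HC) (compNl HC) (comp_suml HC); congr (_ - _).
  by mon tt.
by apply: eq_bigr => i _; rewrite /Defs.cw0; mon tt.
Qed.

Lemma t_xp_cpr r : (r < K)%N -> t ∘ ((xp r ⊗ iD) ∘ c') = 0.
Proof.
move=> rK; rewrite t_xp_cprE t_cpr_gt0 ?(leq_ltn_trans _ rK) // (comp0r HC) sub0r.
rewrite big1 ?oppr0 // => i _; rewrite cw0_lt ?(comp0r HC) //.
by apply: leq_ltn_trans rK; rewrite -subSn // subSS leq_subr.
Qed.

(** For [K > 0] the only surviving correction carries the bubble [cw0 K.-1 = - one], and its two
    signs cancel. This is the rotated form of the zigzag on ↓. *)
Lemma t_xpK_cpr : t ∘ ((xp K ⊗ iD) ∘ c') = c.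
Proof.
have [EK | [n [EK K0 nK]]] := K_cases.
  by rewrite [X in xp X]EK xp0 -[RHS]t_cpr_eq0 //; mon tt.
rewrite [X in xp X]EK t_xp_cprE t_cpr_gt0 // (comp0r HC) sub0r big_ord_recl /= subn1 /=.
rewrite (cw0_pred EK) xp0 big1 => [|i _]; first by rewrite addr0; mon tt.
rewrite cw0_lt ?(comp0r HC) // EK ltnS subSS /bump leq0n add1n.
by rewrite -subSn // subSS leq_subr.
Qed.

(** The decomposition [tau_t] is inserted above the left side. For [K > 0] only its last summand
    survives and gives [- c' ∘ d']; for [K = 0] this term comes instead from the correction [c ∘ d]
    in [t_x]. *)
Lemma tau_x : (x ⊗ iD) ∘ tau = tau ∘ (iD ⊗ x) - c' ∘ d'.
Proof.
(* The sum runs over an interval of naturals, so that the bound [K] can be rewritten without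
   changing the types of the summands. *)
have E : (x ⊗ iD) ∘ tau - \sum_(0 <= r < K) e r ∘ (dxr D r.+1 ∘ tau)
    = tau ∘ (iD ⊗ x) - tau ∘ c ∘ (d ∘ tau).
  have h1 : (x ⊗ iD) ∘ tau
      = tau ∘ t ∘ (x ⊗ iD) ∘ tau + \sum_(0 <= r < K) e r ∘ (dxr D r.+1 ∘ tau).
    rewrite big_mkord -[LHS](comp1f HC) -tau_t (compDl HC) (comp_suml HC); congr (_ + _).
      by mon tt.
    by apply: eq_bigr => r _; rewrite /dxr (xpSr HC); mon tt.
  rewrite {1}h1 addrK.
  by lc (ctx [::] [::] (t_x HC HD) tau tau, ctxl [::] [::] t_tau (tau ∘ (iD ⊗ x))) tt.
have [EK | [n [EK K0 nK]]] := K_cases.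
  move: E; rewrite [X in index_iota 0 X]EK big_geq // subr0 => ->.
  by rewrite dprE [X in xp X]EK xp0 (cprE0 EK); mon tt.
move: E; rewrite [X in index_iota 0 X]EK big_mkord big_ord_recr big1 /= => [|i _]; last first.
  by rewrite dxr_tau ?(comp0r HC) // EK ltnS.
rewrite add0r; have -> : d ∘ tau = 0.
  by rewrite -[RHS](@dxr_tau 0) // /dxr xp0; mon tt.
rewrite (comp0r HC) subr0 => <-; by rewrite dprE (cprE EK) /dxr -EK; mon tt.
Qed.

Lemma tau_xp n : (xp n ⊗ iD) ∘ tau = tau ∘ (iD ⊗ xp n)
  - \sum_(i < n) (xp i ⊗ iD) ∘ c' ∘ d' ∘ (iD ⊗ xp (n - i.+1)).
Proof. exact: (tau_xp_of HC tau_x). Qed.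

Lemma rcurl_lt j : (j < K)%N -> rcurl D c' j = 0.
Proof.
elim: j => [|j IHj] jK.
  by rewrite (rcurl0 HC HD) t_cpr_gt0 // (linE HC) (linE HC).
by rewrite (rcurlS HC HD) IHj ?(ltnW jK) // -/(cw0 j) (cw0_lt jK) !(linE HC) subr0.
Qed.

(** The first curl that does not vanish: for [K > 0] the recursion reaches the bubble [- one]
    here. *)
Lemma rcurlK : rcurl D c' K = iU.
Proof.
have [EK | [n [EK K0 nK]]] := K_cases.
  by rewrite [X in rcurl _ _ X]EK (rcurl0 HC HD) t_cpr_eq0.
rewrite [X in rcurl _ _ X]EK (rcurlS HC HD) rcurl_lt // -/(cw0 n) (cw0_pred EK) (comp0l HC).
by rewrite sub0r; mon tt.
Qed.

Lemma pitchfork_t : (iU ⊗ t) ∘ ((s ⊗ iD) ∘ (iU ⊗ c')) = c' ⊗ iU.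
Proof.
apply: (@detect [::] U).
  have [EK | K0] := posnP K.
    have h := t_cpr_eq0 EK.
    by lc (ctxr [::] [::] (braid_t HC HD) (iU ⊗ c'), ctxl U [::] h ((iD ⊗ s) ∘ (t ⊗ iU)),
           esym (ctx0 [::] U h)) (zig, zag, ss).
  have h := t_cpr_gt0 K0.
  by lc (ctxr [::] [::] (braid_t HC HD) (iU ⊗ c'), ctxl U [::] h ((iD ⊗ s) ∘ (t ⊗ iU)),
           esym (ctx0 [::] U h)) (zig, zag, ss).
move=> r rK; rewrite [LHS](_ : _ =
  ((d ∘ (xp r ⊗ iD)) ⊗ iU) ∘ ((iU ⊗ t) ∘ ((s ⊗ iD) ∘ (iU ⊗ c')))); last by mon tt.
rewrite (rslide HC HD) big1 => [|i _]; last first.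
  rewrite rcurl_lt ?(comp0r HC) //; apply: leq_ltn_trans rK; exact: leq_subr.
rewrite addr0 [RHS](_ : _ = cw0 r ⊗ iU); last by rewrite /Defs.cw0; mon tt.
(* Below degree [K] the bubble is a scalar, hence the same on either side of the strand. *)
by rewrite -/(cw0 r) cw0_small // !(linE HC); congr (- (_ *: _)); mon tt.
Qed.

Lemma pitchfork_tau : (iU ⊗ tau) ∘ (c' ⊗ iU) = (s ⊗ iD) ∘ (iU ⊗ c').
Proof.
rewrite -pitchfork_t.
have -> : (iU ⊗ tau) ∘ ((iU ⊗ t) ∘ ((s ⊗ iD) ∘ (iU ⊗ c')))
    = (iU ⊗ (tau ∘ t)) ∘ ((s ⊗ iD) ∘ (iU ⊗ c')) by mon tt.
(* The failure of [tau ∘ t = 1] contributes only curls with fewer than [K] dots. *)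
rewrite -[tau ∘ t](addrK (\sum_(r < K) e r ∘ dxr D r)) tau_t !(linE HC).
rewrite big1 => [|r _]; first by rewrite subr0; mon tt.
rewrite [LHS](_ : _ = (iU ⊗ e r) ∘ rcurl D c' r); last by rewrite /rcurl; mon tt.
by rewrite rcurl_lt // (comp0r HC).
Qed.

Lemma zigzag_up : (iU ⊗ d') ∘ (c' ⊗ iU) = iU.
Proof.
rewrite dprE -[RHS]rcurlK /rcurl.
by lc (ctxl [::] [::] pitchfork_tau (iU ⊗ (d ∘ (xp K ⊗ iD)))) tt.
Qed.

Lemma dxr_smate_cpr r : (r < K)%N -> (dxr D r ⊗ iD) ∘ ((iU ⊗ s') ∘ (c' ⊗ iD)) = 0.
Proof.
by move=> rK; rewrite /dxr (d_xp_smate HC HD) t_xp_cpr // (tens0l HC) (comp0r HC).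
Qed.

Lemma mate_pitchfork_t : (t ⊗ iD) ∘ ((iU ⊗ s') ∘ (c' ⊗ iD)) = iD ⊗ c'.
Proof.
apply: (@detect Dn [::]).
  have [EK | K0] := posnP K.
    have h := t_cpr_eq0 EK.
    by lc (ctxr [::] [::] (braid_smate HC HD) (c' ⊗ iD),
       ctxl [::] Dn h ((s' ⊗ iU) ∘ (iD ⊗ t)), esym (ctx0 Dn [::] h)) (zig, zag, ss).
  have h := t_cpr_gt0 K0.
  by lc (ctxr [::] [::] (braid_smate HC HD) (c' ⊗ iD),
       ctxl [::] Dn h ((s' ⊗ iU) ∘ (iD ⊗ t)), esym (ctx0 Dn [::] h)) (zig, zag, ss).
move=> r rK.
have h : (iD ⊗ xp r) ∘ t = t ∘ (xp r ⊗ iD)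
    + \sum_(i < r) (iD ⊗ xp i) ∘ c ∘ d ∘ (xp (r - i.+1) ⊗ iD).
  by rewrite (t_xp HC HD) subrK.
rewrite [LHS](_ : _ = (iD ⊗ d) ∘ ((((iD ⊗ xp r) ∘ t) ⊗ iD) ∘ ((iU ⊗ s') ∘ (c' ⊗ iD)))).
  rewrite h !(linE HC) big1 => [|i _].
    rewrite addr0 [LHS](_ : _ = cw0 r ⊗ iD); last by rewrite /Defs.cw0; mon (zig, zag, ss).
    rewrite [RHS](_ : _ = iD ⊗ cw0 r); last by rewrite /Defs.cw0; mon tt.
    by rewrite cw0_small // !(linE HC); congr (- (_ *: _)); mon tt.
  rewrite [LHS](_ : _ = (iD ⊗ d) ∘ (((iD ⊗ xp i) ∘ c) ⊗ iD) ∘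
     ((dxr D (r - i.+1) ⊗ iD) ∘ ((iU ⊗ s') ∘ (c' ⊗ iD)))); last by mon tt.
  rewrite dxr_smate_cpr ?(comp0r HC) //; apply: leq_ltn_trans rK; exact: leq_subr.
by mon tt.
Qed.

Lemma mate_pitchfork_tau : (tau ⊗ iD) ∘ (iD ⊗ c') = (iU ⊗ s') ∘ (c' ⊗ iD).
Proof.
rewrite -mate_pitchfork_t.
have -> : (tau ⊗ iD) ∘ ((t ⊗ iD) ∘ ((iU ⊗ s') ∘ (c' ⊗ iD)))
    = ((tau ∘ t) ⊗ iD) ∘ ((iU ⊗ s') ∘ (c' ⊗ iD)) by mon tt.
rewrite -[tau ∘ t](addrK (\sum_(r < K) e r ∘ dxr D r)) tau_t !(linE HC).
rewrite big1 => [|r _]; first by rewrite subr0; mon tt.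
rewrite [LHS](_ : _ = (e r ⊗ iD) ∘ ((dxr D r ⊗ iD) ∘ ((iU ⊗ s') ∘ (c' ⊗ iD)))).
  by rewrite dxr_smate_cpr // (comp0r HC).
by mon tt.
Qed.

Lemma zigzag_down : (d' ⊗ iD) ∘ (iD ⊗ c') = iD.
Proof.
rewrite dprE [LHS](_ : _ = ((d ∘ (xp K ⊗ iD)) ⊗ iD) ∘ ((tau ⊗ iD) ∘ (iD ⊗ c'))).
  by rewrite mate_pitchfork_tau (d_xp_smate HC HD) t_xpK_cpr.
by mon tt.
Qed.

(** Under the test with [t] the corrections of [t_xpr] and [t_x] are both [c ∘ d] and cancel; under
    a dotted cap [x'] becomes one more dot. *)
Lemma xpr_cpr : (iU ⊗ x') ∘ c' = (x ⊗ iD) ∘ c'.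
Proof.
apply: (@detect [::] [::]).
  have [EK | K0] := posnP K.
    have h := t_cpr_eq0 EK.
    by lc (ctxr [::] [::] (t_xpr HC HD) c', esym (ctxr [::] [::] (t_x HC HD) c'),
       ctxl [::] [::] h (x' ⊗ iU), esym (ctxl [::] [::] h (iD ⊗ x)), xpr_c HC HD) tt.
  have h := t_cpr_gt0 K0.
    by lc (ctxr [::] [::] (t_xpr HC HD) c', esym (ctxr [::] [::] (t_x HC HD) c'),
       ctxl [::] [::] h (x' ⊗ iU), esym (ctxl [::] [::] h (iD ⊗ x))) tt.
move=> r rK.
have xx : xp r ∘ x = x ∘ xp r by rewrite -xpS (xpSr HC).
by lc (ctxr [::] [::] (d_xpr HC HD) ((xp r ⊗ iD) ∘ c'), esym (ctx [::] Dn xx d c')) tt.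
Qed.

Lemma x_mates :
  (iD ⊗ d) ∘ ((iD ⊗ x ⊗ iD) ∘ (c ⊗ iD)) = (d' ⊗ iD) ∘ ((iD ⊗ x ⊗ iD) ∘ (iD ⊗ c')).
Proof.
by lc (ctxl Dn [::] xpr_cpr (d' ⊗ iD), esym (ctxl [::] [::] zigzag_down x')) tt.
Qed.

(** By the two pitchforks both sides equal [(iU ⊗ tau ⊗ iD) ∘ (c' ⊗ c')]. *)
Lemma s_mates : (s ⊗ iD ⊗ iD) ∘ ((iU ⊗ c' ⊗ iD) ∘ c')
  = (iU ⊗ iU ⊗ s') ∘ ((iU ⊗ c' ⊗ iD) ∘ c').
Proof.
by lc (esym (ctxr [::] Dn pitchfork_tau c'), ctxr U [::] mate_pitchfork_tau c') tt.
Qed.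

Lemma tprE : tpr K%:Z D = tau.
Proof.
by lc (esym (ctxl Dn [::] pitchfork_tau (d' ⊗ iU ⊗ iD)), ctxl [::] U zigzag_down tau) tt.
Qed.

End NonNegative.

(** * Bubbles *)

(* Cramer's rule: the vector [v] of smaller determinants is mapped by the matrix
   to a multiple of the last basis vector, and the relevant cofactor is 1. *)
Lemma hessenberg_det (E : comPzRingType) (h : int -> E) n :
  h (-1) = -1 -> (forall z : int, z < -1 -> h z = 0) ->
  \det (\matrix_(i < n.+1, j < n.+1) h (i%:Z - j%:Z)) =
  \sum_(m < n.+1) h (n%:Z - m%:Z) * \det (\matrix_(i < m, j < m) h (i%:Z - j%:Z)).
Proof.
move=> h1 h0; pose M m : 'M[E]_m := \matrix_(i < m, j < m) h (i%:Z - j%:Z).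
rewrite -/(M n.+1); have [m] := ubnP n; elim: m => // m IHm in n *; rewrite ltnS => nm.
pose v : 'cV[E]_n.+1 := \col_i \det (M i).
pose S := \sum_(m < n.+1) h (n%:Z - m%:Z) * \det (M m).
(* In row [i < n] the entries up to column [i] sum, by induction, to the minor of size [i + 1],
   which the entry -1 in the next column cancels; entries further right are 0. *)
have Mv : M n.+1 *m v = \col_i (if i == ord_max then S else 0).
  apply/matrixP=> i j; rewrite !mxE; case: eqP => [->|/eqP ni].
    by apply: eq_bigr => l _; rewrite !mxE.
  have {ni} ni : (i < n)%N by rewrite ltn_neqAle -ltnS ltn_ord andbT.
  pose F (l : nat) := h (i%:Z - l%:Z) * \det (M l).
  rewrite [LHS](eq_bigr (fun l : 'I_n.+1 => F l)) => [|l _]; last by rewrite !mxE.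
  rewrite -(big_mkord xpredT) (big_cat_nat (n := i.+2)) //= [X in _ + X]big1_seq => [|l].
    rewrite addr0 big_mkord big_ord_recr /= /F (IHm i (leq_trans ni nm)).
    by rewrite -/(M i.+1) -addn1 PoszD opprD addNKr h1 mulN1r subrr.
  rewrite mem_index_iota => /andP[_ /andP[il _]]; rewrite /F h0 ?mul0r //.
  by rewrite ltrBlDr addrC -ltrBlDr opprK ltz_nat addn1.
(* Without the first column and the last row the matrix is triangular with -1 on the diagonal, so
   its sign cancels that of the cofactor. *)
have Z0 : cofactor (M n.+1) ord_max ord0 = 1.
  rewrite /cofactor det_trig => [|]; last first.
    apply/is_trig_mxP=> i j ij; rewrite !mxE h0 //= /bump leq0n leqNgt ltn_ord add0n.
    by rewrite ltrBlDr add1n addrC -ltrBlDr opprK ltz_nat addn1 ltnS.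
  rewrite (eq_bigr (fun=> -1)) => [|i _]; last first.
    rewrite !mxE /= /bump leq0n leqNgt ltn_ord add0n add1n -addn1 PoszD opprD addNKr.
    exact: h1.
  by rewrite prodr_const card_ord addn0 -exprD addnn -mul2n exprM sqrrN expr1n expr1n.
(* Entry 0 of [v] is the empty determinant 1, so entry 0 of [\adj M *m (M *m v)] is the determinant
   itself. *)
have := congr1 (fun w => (\adj (M n.+1) *m w) ord0 ord0) Mv.
rewrite mulmxA mul_adj_mx mul_scalar_mx !mxE /= => e.
rewrite [LHS](_ : _ = \det (M n.+1) * \det (M 0)); last by rewrite (det_mx00 (M 0)) mulr1.
rewrite {}e big_ord_recr big1 /= => [|i _].
  by rewrite !mxE Z0 eqxx mul1r add0r.
rewrite !mxE; case: eqP => [e|_]; last by rewrite mulr0.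
by have := ltn_ord i; rewrite -[X in (X < _)%N]/(nat_of_ord (widen_ord (leqnSn n) i)) e ltnn.
Qed.

Section Convolution.
Variable A : pzRingType.
Implicit Types f g h : nat -> A.

(** Product of formal power series with coefficients in a ring that may be noncommutative, such as
    the endomorphisms of ↑. *)
Definition conv f g (m : nat) : A := \sum_(i < m.+1) f i * g (m - i)%N.

Lemma conv_rev f g m : conv f g m = \sum_(i < m.+1) f (m - i)%N * g i.
Proof.
rewrite /conv (reindex_inj rev_ord_inj) /=.
by apply: eq_bigr => i _; rewrite subSS subKn // -ltnS.
Qed.

Lemma convA f g h m : conv f (conv g h) m = conv (conv f g) h m.
Proof.
rewrite [RHS]conv_rev.
pose coef3 j k := f j * (g (m - j - k)%N * h k).
transitivity (\sum_(j < m.+1) \sum_(k < m.+1 | (k <= m - j)%N) coef3 j k).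
  apply: eq_bigr => /= j _; rewrite conv_rev big_distrr /=.
  by rewrite (big_ord_narrow_leq (leq_subr _ _)).
rewrite (exchange_big_dep predT) //=; apply: eq_bigr => k _.
transitivity (\sum_(j < m.+1 | (j <= m - k)%N) coef3 j k).
  apply: eq_bigl => j; rewrite -ltnS -(ltnS j) -!subSn ?leq_ord //.
  by rewrite -subn_gt0 -(subn_gt0 j) -!subnDA addnC.
rewrite (big_ord_narrow_leq (leq_subr _ _)) big_distrl /=.
by apply: eq_bigr => j _; rewrite /coef3 -!subnDA addnC mulrA.
Qed.

Definition delta (m : nat) : A := (m == 0%N)%:R.

Lemma conv_deltal f g m : (forall i, f i = - delta i) -> conv f g m = - g m.
Proof.
move=> fE; rewrite /conv big_ord_recl big1 => [|i _].
  by rewrite fE mulN1r subn0 addr0.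
by rewrite fE mulNr mul0r oppr0.
Qed.

Lemma conv_deltar f g m : (forall i, g i = - delta i) -> conv f g m = - f m.
Proof.
move=> gE; rewrite conv_rev big_ord_recl big1 => [|i _].
  by rewrite gE mulrN1 subn0 addr0.
by rewrite gE mulrN mulr0 oppr0.
Qed.

Lemma conv_ext f g f' g' m :
  (forall i, f i = f' i) -> (forall i, g i = g' i) -> conv f g m = conv f' g' m.
Proof. by move=> ff gg; apply: eq_bigr => i _; rewrite ff gg. Qed.

Lemma conv_opp f g m :
  (forall i, f i = - g i) -> forall h, (conv f h m = - conv g h m) * (conv h f m = - conv h g m).
Proof.
by move=> fg h; split; rewrite -sumrN; apply: eq_bigr => i _; rewrite fg ?mulNr ?mulrN.
Qed.

End Convolution.

(** The aliases carry the axioms [HC], on which the ring structures depend; [bubble] is kept apart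
    because it is also commutative. *)
Definition endo (R : comPzRingType) (C : lmcat R) (HC : lmcat_axioms C) (X : seq bool) : Type :=
  Defs.hom C X X.
Definition bubble (R : comPzRingType) (C : lmcat R) (HC : lmcat_axioms C) : Type :=
  Defs.hom C [::] [::].

Section EndoRing.
Context {R : comPzRingType} {C : lmcat R} (HC : lmcat_axioms C).

HB.instance Definition _ X := GRing.Zmodule.copy (endo HC X) (Defs.hom C X X).
HB.instance Definition _ := GRing.Zmodule.copy (bubble HC) (Defs.hom C [::] [::]).

Let mul X (a b : endo HC X) : endo HC X := mcomp a b.

Fact endo_mulA X : associative (@mul X). Proof. by move=> a b c; apply: (Defs.compA HC). Qed.
Fact endo_mul1 X : left_id (@idm _ C X : endo HC X) (@mul X).
Proof. by move=> a; apply: (Defs.comp1f HC). Qed.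
Fact endo_mulr1 X : right_id (@idm _ C X : endo HC X) (@mul X).
Proof. by move=> a; apply: (Defs.compf1 HC). Qed.
Fact endo_mulDl X : left_distributive (@mul X) +%R.
Proof. by move=> a b c; apply: (compDl HC). Qed.
Fact endo_mulDr X : right_distributive (@mul X) +%R.
Proof. by move=> a b c; apply: (compDr HC). Qed.
Fact bubble_mulC : commutative (@mul [::]).
Proof. move=> a b; rewrite /mul; rewrite /endo in a b *; mon tt. Qed.

HB.instance Definition _ X := GRing.Zmodule_isPzRing.Build (endo HC X)
  (@endo_mulA X) (@endo_mul1 X) (@endo_mulr1 X) (@endo_mulDl X) (@endo_mulDr X).
HB.instance Definition _ := GRing.Zmodule_isComPzRing.Build (bubble HC)
  (@endo_mulA [::]) bubble_mulC (@endo_mul1 [::]) (@endo_mulDl [::]).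

Lemma bubbleC (a b : hom C [::] [::]) : a ∘ b = b ∘ a.
Proof. exact: bubble_mulC. Qed.

Lemma bdetE n (f : int -> int -> hom C [::] [::]) :
  bdet n%:Z f = \det (\matrix_(i < n, j < n) (f i j : bubble HC)).
Proof.
rewrite /bdet /determinant; apply: eq_bigr => p _.
have -> (a : hom C [::] [::]) : ((-1) ^+ p : R) *: a = ((-1) ^+ p : bubble HC) * a.
  case: (odd_perm p); rewrite ?expr0 ?expr1 ?scale1r; last exact: (esym (mul1r (a : bubble HC))).
  by rewrite scaleN1r mulN1r.
apply: (congr1 (fun b : bubble HC => (-1) ^+ p * b)).
by apply: eq_bigr => i _; rewrite mxE.
Qed.

Lemma bdet0 (f : int -> int -> hom C [::] [::]) : bdet 0%:Z f = idm [::].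
Proof. by rewrite (bdetE 0) det_mx00. Qed.

End EndoRing.

(** * Grassmannian relation and braid difference for nonnegative central charge *)

Section NonNegativeBubbles.
Context {R : comPzRingType} {C : lmcat R} (HC : lmcat_axioms C).
Context {K : nat} {D : heis_data C} (HD : heis_rels K%:Z D).
Local Notation x := (hx D).
Local Notation s := (hs D).
Local Notation c := (hc D).
Local Notation d := (hd D).
Local Notation t := (ht D).
Local Notation tau := (htau D).
Local Notation e := (he D).
Local Notation xp := (xp D).
Local Notation iU := (@idm _ C U).
Local Notation iD := (@idm _ C Dn).
Local Notation c' := (cpr K%:Z D).
Local Notation d' := (dpr K%:Z D).
Local Notation cw0 := (cw0 K%:Z D).
Local Notation ccw0 := (ccw0 K%:Z D).
Local Notation cw := (cw K%:Z D).
Local Notation ccw := (ccw K%:Z D).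
Local Notation one := (@idm _ C [::]).
(** Shifted so that both generating series start in degree 0, with leading coefficients -1 and 1. *)
Local Notation A i := (cw ((i : nat)%:Z + K%:Z - 1)).
Local Notation B i := (ccw ((i : nat)%:Z - K%:Z - 1)).

Lemma cw_nn_hess (z : int) : z < -1 -> cw_nn K%:Z D (z + K%:Z) = 0.
Proof.
move=> z1; case E: (z + K%:Z) => [m|m] //=; apply: (cw0_lt HC HD).
by rewrite -ltz_nat -addn1 PoszD -E addrAC gtrDr -ltrBrDr sub0r.
Qed.

Lemma cw_nn_hess1 : (0 < K)%N -> cw_nn K%:Z D (-1 + K%:Z) = - one.
Proof.
case: (K_cases (K := K)) => [-> //|[n [EK _ _]] _].
have -> : -1 + K%:Z = n%:Z by rewrite EK -addn1 PoszD addrC addrK.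
exact: cw0_pred.
Qed.

Lemma ccw_det i : (i <= K)%N -> B i = bdet i%:Z (fun i j => cw_nn K%:Z D (i - j + K%:Z)).
Proof.
move=> iK; have -> : i%:Z - K%:Z - 1 = Negz (K - i).
  by rewrite NegzE -addn1 PoszD -subzn // opprD opprB.
rewrite /Defs.ccw; have -> // : Negz (K - i) + K%:Z + 1 = i%:Z.
by rewrite NegzE -addn1 PoszD -subzn // opprD opprB addrAC subrK subrK.
Qed.

Lemma ccwE n : B (K.+1 + n) = ccw0 n.
Proof.
by have -> : (K.+1 + n)%:Z - K%:Z - 1 = n%:Z by rewrite PoszD -addn1 PoszD; ring.
Qed.

Lemma cwE n : A n.+1 = cw0 (K + n).
Proof. by have -> : n.+1%:Z + K%:Z - 1 = (K + n)%:Z by rewrite PoszD -addn1 PoszD; ring. Qed.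

Lemma cw_first : A 0 = - one.
Proof.
rewrite add0r; case: (K_cases (K := K)) => [EK|[n [EK _ _]]].
  by rewrite EK sub0r; apply: (congr1 (fun b => - b) (bdet0 HC _)).
by have -> : K%:Z - 1 = n%:Z; [rewrite EK -addn1 PoszD addrK | apply: cw0_pred].
Qed.

Lemma ccw_first : B 0 = one.
Proof. by rewrite ccw_det // (bdet0 HC). Qed.

(** The determinants are of Hessenberg type because [cw0] vanishes below [K.-1] and is -1 there. *)
Lemma ccw_rec i : (i < K)%N -> B i.+1 = \sum_(j < i.+1) cw0 (K + i - j) ∘ B j.
Proof.
move=> iK; have K0 : (0 < K)%N by apply: leq_ltn_trans iK.
rewrite ccw_det // (bdetE HC).
rewrite (@hessenberg_det _ (fun z => cw_nn K%:Z D (z + K%:Z) : bubble HC)) /=.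
- apply: eq_bigr => j _; rewrite ccw_det ?(bdetE HC); last first.
    by apply: leq_trans (ltnW iK); rewrite -ltnS.
  have ji : (j <= K + i)%N by rewrite (leq_trans _ (leq_addl _ _)) // -ltnS.
  by have -> : i%:Z - j%:Z + K%:Z = (K + i - j)%:Z by rewrite -subzn // PoszD; ring.
- exact: cw_nn_hess1.
- exact: cw_nn_hess.
Qed.

Lemma x_e r : (r < K)%N -> (x ⊗ iD) ∘ e r
  = \sum_(q < K) e q ∘ (dxr D q.+1 ∘ e r) - tau ∘ c ∘ (d ∘ e r).
Proof.
move=> rK; have h : tau ∘ t ∘ ((x ⊗ iD) ∘ e r) = - (tau ∘ c ∘ (d ∘ e r)).
  by lc (ctx [::] [::] (t_x HC HD) tau (e r),
      ctxl [::] [::] (t_e HD rK) (tau ∘ (iD ⊗ x))) tt.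
rewrite -h -[LHS](comp1f HC) -(tau_t HD) (compDl HC) (comp_suml HC) addrC; congr (_ + _).
by apply: eq_bigr => q _; rewrite /dxr (xpSr HC); mon tt.
Qed.

(** The dot acts as a companion matrix: it lowers the index of [e] by one and adds a multiple of the
    last [e], which is [- c']. *)
Lemma e_step r : (r.+1 < K)%N ->
  e r = (x ⊗ iD) ∘ e r.+1 + c' ∘ (dxr D K ∘ e r.+1).
Proof.
move=> rK; rewrite x_e //.
have -> : d ∘ e r.+1 = 0.
  rewrite -[RHS](scale0r one) -(dxr_e HD (r := 0) (q := r.+1)) ?(leq_ltn_trans _ rK) //.
  by rewrite /dxr xp0; mon tt.
case: (K_cases (K := K)) => [EK|[n [EK _ nK]]]; first by rewrite EK in rK.
rewrite -(big_mkord xpredT (fun q => e q ∘ (dxr D q.+1 ∘ e r.+1))) [X in index_iota _ X]EK.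
have rn : (r < n)%N by rewrite -ltnS -EK.
rewrite big_mkord big_ord_recr /= (bigD1 (Ordinal rn)) //= big1 => [|i ne]; last first.
  have iK : (i.+1 < K)%N by rewrite EK ltnS.
  rewrite (dxr_e HD) // eqSS.
  have -> : (i == r :> nat) = false by apply/negbTE.
  by rewrite scale0r (comp0r HC).
rewrite (dxr_e HD) // eqxx scale1r.
rewrite (compf1 HC) (comp0r HC) subr0 addr0 -EK (cprE EK) (compNl HC) addrK //.
Qed.

Lemma tau_c_step : (0 < K)%N ->
  tau ∘ c = - ((x ⊗ iD) ∘ e 0 + c' ∘ (dxr D K ∘ e 0)).
Proof.
move=> K0; rewrite x_e //.
have -> : d ∘ e 0 = one.
  by rewrite -[RHS]scale1r -(dxr_e HD (r := 0) (q := 0)) // /dxr xp0; mon tt.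
case: (K_cases (K := K)) => [EK|[n [EK _ nK]]]; first by rewrite EK in K0.
rewrite -(big_mkord xpredT (fun q => e q ∘ (dxr D q.+1 ∘ e 0))) [X in index_iota _ X]EK.
rewrite big_mkord big_ord_recr /= big1 => [|i _]; last first.
  have iK : (i.+1 < K)%N by rewrite EK ltnS.
  by rewrite (dxr_e HD) // scale0r (comp0r HC).
by rewrite (compf1 HC) add0r -EK (cprE EK) (compNl HC) addrAC subrr sub0r opprK.
Qed.

(** Descending from the last entry [- c']; the coefficient that appears at each step is identified
    with the next bubble by [ccw_rec]. *)
Lemma eE j : (j < K)%N -> e (K.-1 - j) = - \sum_(i < j.+1) (xp (j - i) ⊗ iD) ∘ c' ∘ B i.
Proof.
elim: j => [|j IHj] jK.
  case: (K_cases (K := K)) => [EK|[n [EK _ nK]]]; first by rewrite EK in jK.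
  have -> : K.-1 = n by rewrite EK.
  by rewrite big_ord1 !subn0 ccw_first xp0 (cprE EK); mon tt.
have jr : (K.-1 - j)%N = (K.-1 - j.+1).+1.
  by case: (K_cases (K := K)) jK => [->//|[n [-> _ _]]]; rewrite !ltnS /= => jn; rewrite subnSK.
rewrite e_step -jr; last by case: (K) jK => //= n _; rewrite ltnS leq_subr.
have {}IHj := IHj (ltnW jK).
have -> : dxr D K ∘ e (K.-1 - j) = - B j.+1.
  rewrite ccw_rec ?(ltnW jK) // IHj (compNr HC) (comp_sumr HC); congr (- _).
  apply: eq_bigr => i _; rewrite /dxr /Defs.cw0 -addnBA ?(leq_ord i) // (xpD HC); mon tt.
rewrite IHj (compNr HC) (compNr HC) -opprD; congr (- _).
rewrite (comp_sumr HC) [RHS]big_ord_recr /= subnn xp0; congr (_ + _); last by mon tt.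
apply: eq_bigr => i _; rewrite (subSn (leq_ord i)) xpS; mon tt.
Qed.

(** One more step of the same descent, in which [- tau ∘ c] plays the role of an entry of index
    -1. *)
Lemma tau_c : tau ∘ c = \sum_(i < K.+1) (xp (K - i) ⊗ iD) ∘ c' ∘ B i.
Proof.
case: (K_cases (K := K)) => [EK|[n [EK K0 nK]]].
  rewrite -(cprE0 HC EK) -(big_mkord xpredT (fun i => (xp (K - i) ⊗ iD) ∘ c' ∘ B i)).
  rewrite [X in index_iota _ X.+1]EK big_mkord big_ord1 subn0 ccw_first [X in xp X]EK xp0.
  by mon tt.
have := eE nK; rewrite {1}EK subnn => h0.
rewrite (tau_c_step K0).
have -> : dxr D K ∘ e 0 = - B n.+1.
  rewrite ccw_rec // h0 (compNr HC) (comp_sumr HC); congr (- _).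
  apply: eq_bigr => i _; rewrite /dxr /Defs.cw0 -addnBA ?(leq_ord i) // (xpD HC); mon tt.
rewrite -EK big_ord_recr /= subnn xp0 (compNr HC) opprD opprK; congr (_ + _); last by mon tt.
rewrite h0 (compNr HC) opprK (comp_sumr HC).
rewrite -(big_mkord xpredT (fun i => (xp (K - i) ⊗ iD) ∘ c' ∘ B i)) [X in index_iota _ X]EK.
rewrite big_mkord; apply: eq_bigr => i _.
have -> : (K - i)%N = (n - i).+1 by rewrite EK (subSn (leq_ord i)).
by rewrite xpS; mon tt.
Qed.

(** In positive degrees up to [K] this is the determinant recursion. Beyond, the bubble [ccw0 n]
    contains [tau] with [n] dots below it: sliding them up splits off products of bubbles, and
    [tau_c] expands the rest. *)
Lemma grassmann m : \sum_(r < m.+1) A r ∘ B (m - r) = - (((m == 0)%N%:R : R) *: one).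
Proof.
rewrite big_ord_recl subn0 cw_first; case: m => [|m].
  by rewrite big_ord0 addr0 scale1r ccw_first (compNl HC) (comp1f HC).
rewrite scale0r oppr0 (compNl HC) (comp1f HC).
under eq_bigr => i _ do rewrite lift0 cwE subSS.
apply/eqP; rewrite addrC subr_eq0; apply/eqP.
have [mK | Km] := ltnP m K.
  rewrite ccw_rec // [RHS](reindex_inj rev_ord_inj) /=; apply: eq_bigr => i _.
  by rewrite subSS -addnBA ?leq_subr // subKn // -ltnS.
have [n ->] : exists n, m = (K + n)%N by exists (m - K)%N; rewrite subnKC.
rewrite -addSn ccwE {1}/Defs.ccw0 (dprE (K := K)).
have -> : d ∘ (xp K ⊗ iD ∘ tau) ∘ (iD ⊗ xp n ∘ c) =
   (d ∘ (xp (K + n) ⊗ iD)) ∘ (tau ∘ c) + \sum_(q < n) cw0 (K + q) ∘ ccw0 (n - q.+1).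
  rewrite [LHS](_ : _ = (d ∘ (xp K ⊗ iD)) ∘ (tau ∘ (iD ⊗ xp n)) ∘ c); last by mon tt.
  have -> : tau ∘ (iD ⊗ xp n) = (xp n ⊗ iD) ∘ tau +
     \sum_(i < n) (xp i ⊗ iD) ∘ c' ∘ d' ∘ (iD ⊗ xp (n - i.+1)).
    by rewrite (tau_xp HC HD) subrK.
  rewrite !(linE HC); congr (_ + _); first by rewrite (xpD HC); mon tt.
  by apply: eq_bigr => q _; rewrite /Defs.cw0 /Defs.ccw0 (xpD HC); mon tt.
rewrite tau_c (comp_sumr HC) addrC.
rewrite -(big_mkord xpredT (fun q => cw0 (K + q) ∘ B (K + n - q))).
rewrite (big_cat_nat (n := n)) //=; last by apply: leqW; apply: leq_addl.
rewrite big_mkord; congr (_ + _).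
  apply: eq_bigr => q _.
  have -> : (K + n - q)%N = (K.+1 + (n - q.+1))%N by have := ltn_ord q; lia.
  by rewrite ccwE.
rewrite [RHS](_ : _ = \sum_(0 + n <= q < K.+1 + n) cw0 (K + q) ∘ B (K + n - q)) //.
rewrite big_addn addnK big_mkord [RHS](reindex_inj rev_ord_inj) /=.
apply: eq_bigr => i _; have iK := leq_ord i.
have -> : (K + n - (K.+1 - i.+1 + n))%N = i by lia.
have -> : (K + (K.+1 - i.+1 + n))%N = (K + n + (K - i))%N by lia.
by rewrite /Defs.cw0 (xpD HC _ (K - i)); mon tt.
Qed.

Lemma dxrK_e j : (j < K)%N -> dxr D K ∘ e (K.-1 - j) = - B j.+1.
Proof.
move=> jK; rewrite ccw_rec // eE // (compNr HC) (comp_sumr HC); congr (- _).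
apply: eq_bigr => i _; rewrite /dxr /Defs.cw0 -addnBA ?(leq_ord i) // (xpD HC); mon tt.
Qed.

Lemma dpr_tE : d' ∘ t = \sum_(i < K.+1) B i ∘ dxr D (K - i).
Proof.
rewrite dprE [LHS](_ : _ = dxr D K ∘ (tau ∘ t)); last by mon tt.
rewrite -[tau ∘ t](addrK (\sum_(r < K) e r ∘ dxr D r)) (tau_t HD) (compDr HC) (compNr HC).
rewrite (compf1 HC) (comp_sumr HC) big_ord_recl ccw_first subn0 (comp1f HC); congr (_ + _).
rewrite -sumrN (reindex_inj rev_ord_inj); apply: eq_bigr => i _.
rewrite lift0 /= (Defs.compA HC) (_ : (K - i.+1)%N = (K.-1 - i)%N) ?dxrK_e //; last by lia.
by rewrite (compNl HC) opprK.
Qed.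

(** A version of [eE] whose range does not depend on [r]: the added bubbles are determinants of
    negative size, hence 0. *)
Lemma e_sum r N : (r < K)%N -> (K <= N)%N ->
  e r = - \sum_(a < N) (xp a ⊗ iD) ∘ c' ∘ ccw (- r%:Z - a%:Z - 2).
Proof.
move=> rK KN; have rE : r = (K.-1 - (K.-1 - r))%N by lia.
rewrite {1}rE eE; last by lia.
congr (- _); rewrite (reindex_inj rev_ord_inj) /=.
rewrite -(big_mkord xpredT (fun a => (xp a ⊗ iD) ∘ c' ∘ ccw (- r%:Z - a%:Z - 2))).
rewrite (big_cat_nat (n := (K.-1 - r).+1)) //=; last by lia.
rewrite [X in _ + X]big1_seq ?addr0 => [|a]; last first.
  rewrite mem_index_iota => /andP[_ /andP[ra _]].
  have lt0 : - r%:Z - a%:Z - 2 + K%:Z + 1 < 0 by lia.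
  have -> : - r%:Z - a%:Z - 2 = Negz (r + a).+1 by rewrite NegzE; lia.
  rewrite /Defs.ccw; have -> : Negz (r + a).+1 + K%:Z + 1 = Negz (r + a - K) by rewrite !NegzE; lia.
  exact: comp0r.
rewrite big_mkord; apply: eq_bigr => i _; have ij := leq_ord i.
have -> : (K.-1 - r - ((K.-1 - r).+1 - i.+1))%N = i by lia.
by congr (_ ∘ ccw _); lia.
Qed.


(** By [braid_t] and [t ∘ tau = 1], [D1] is [D2] followed by [tau ∘ t] on the two left strands. *)
Lemma braid_difference : D1 K%:Z D - D2 K%:Z D
  = - \sum_(r < K) \sum_(i < r) (e r ∘ dxr D i) ⊗ xp (r - i.+1).
Proof.
rewrite /D1 /D2 (tprE HC HD).
have -> : (tau ⊗ iU) ∘ ((iD ⊗ s) ∘ (t ⊗ iU))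
    = ((tau ∘ t) ⊗ iU) ∘ ((iU ⊗ t) ∘ ((s ⊗ iD) ∘ (iU ⊗ tau))).
  by lc (esym (ctx [::] [::] (braid_t HC HD) (tau ⊗ iU) (iU ⊗ tau)),
         esym (ctxl U [::] (t_tau HD) ((tau ⊗ iU) ∘ (iD ⊗ s) ∘ (t ⊗ iU)))) tt.
rewrite -[tau ∘ t](addrK (\sum_(r < K) e r ∘ dxr D r)) (tau_t HD) !(linE HC).
rewrite [X in X - _ - _](_ : _ = (iU ⊗ t) ∘ ((s ⊗ iD) ∘ (iU ⊗ tau))); last by mon tt.
rewrite addrAC subrr sub0r; congr (- _); apply: eq_bigr => r _.
rewrite [LHS](_ : _ = (e r ⊗ iU) ∘
   ((iU ⊗ d) ∘ ((s ∘ (xp r ⊗ iU) ∘ s) ⊗ iD) ∘ (iU ⊗ tau))); last first.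
  by mon (heis_zig HD, heis_zag HD).
(* The leading term contains [dxr D r ∘ tau = 0]. *)
rewrite (s_xp_s_below HC HD) !(linE HC) [X in X + _](_ : _ = 0) ?add0r; last first.
  have h := dxr_tau HD (ltn_ord r).
  by lc (ctxl U [::] h (e r ⊗ iU)) tt.
apply: eq_bigr => i _; have ir := ltn_ord i.
rewrite [LHS](_ : _ = (e r ⊗ iU) ∘ ((d ⊗ iU) ∘
    (iU ⊗ (t ∘ (xp (r - i.+1) ⊗ iD) ∘ tau)) ∘ (xp i ⊗ iD ⊗ iU))); last first.
  by mon (heis_zig HD, heis_zag HD).
have -> : t ∘ (xp (r - i.+1) ⊗ iD) ∘ tau = iD ⊗ xp (r - i.+1).
  rewrite (t_xp HC HD) (compDl HC) (compNl HC) (comp_suml HC) big1 => [|q _].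
    by lc (ctxl [::] [::] (t_tau HD) (iD ⊗ xp (r - i.+1))) tt.
  rewrite [LHS](_ : _ = (iD ⊗ xp q) ∘ c ∘ (dxr D (r - i.+1 - q.+1) ∘ tau)); last by mon tt.
  by rewrite (dxr_tau HD) ?(comp0r HC) //; have := ltn_ord r; lia.
by mon tt.
Qed.

End NonNegativeBubbles.

(** * Negative central charge *)

(* Here [k = Negz n = - K]. *)
Section Negative.
Context {R : comPzRingType} {C : lmcat R} (HC : lmcat_axioms C).
Context {n : nat} {D : heis_data C} (HD : heis_rels (Negz n) D).
Local Notation K := n.+1.
Local Notation x := (hx D).
Local Notation s := (hs D).
Local Notation c := (hc D).
Local Notation d := (hd D).
Local Notation t := (ht D).
Local Notation tau := (htau D).
Local Notation f := (hf D).
Local Notation x' := (xpr D).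
Local Notation s' := (smate D).
Local Notation xp := (xp D).
Local Notation iU := (@idm _ C U).
Local Notation iD := (@idm _ C Dn).
Local Notation c' := (cpr (Negz n) D).
Local Notation d' := (dpr (Negz n) D).
Local Notation cw0 := (cw0 (Negz n) D).
Local Notation ccw0 := (ccw0 (Negz n) D).
Local Notation one := (@idm _ C [::]).
Let ss := heis_ss HD.
Let zig := heis_zig HD.
Let zag := heis_zag HD.

Lemma neg_t_tau : t ∘ tau + \sum_(r < K) cxr D r ∘ f r = idm [:: false; true].
Proof. by case: HD => _ _ _ []. Qed.

Lemma neg_tau_t : tau ∘ t = idm [:: true; false].
Proof. by case: HD => _ _ _ []. Qed.

Lemma tau_cxr r : (r < K)%N -> tau ∘ cxr D r = 0.
Proof. by case: HD => _ _ _ [_ _ h _ _] /h. Qed.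

Lemma f_t r : (r < K)%N -> f r ∘ t = 0.
Proof. by case: HD => _ _ _ [_ _ _ h _] /h. Qed.

Lemma f_cxr r q : (r < K)%N -> (q < K)%N -> f r ∘ cxr D q = ((r == q)%:R : R) *: one.
Proof. by case: HD => _ _ _ [_ _ _ _ h] hr hq; apply: h. Qed.

Lemma neg_cprE : c' = tau ∘ cxr D K.
Proof. by []. Qed.

Lemma neg_dprE : d' = f n.
Proof.
rewrite /dpr; have -> : `|- Negz n - 1|%N = n by rewrite NegzE opprK -addn1 PoszD addrK.
by [].
Qed.

(** Now the identity of ↓↑ is the one that factors through [t] and the dotted cups, so tests are
    applied from below. *)
Lemma codetect L Z A (g h : hom C (L ++ [:: false; true] ++ Z) A) :
  g ∘ (idm L ⊗ (t ⊗ idm Z)) = h ∘ (idm L ⊗ (t ⊗ idm Z)) ->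
  (forall r, (r < K)%N ->
     g ∘ (idm L ⊗ (cxr D r ⊗ idm Z)) = h ∘ (idm L ⊗ (cxr D r ⊗ idm Z))) ->
  g = h.
Proof.
move=> et er.
have e (u : hom C (L ++ [:: false; true] ++ Z) A) :
    u = (u ∘ (idm L ⊗ (t ⊗ idm Z))) ∘ (idm L ⊗ (tau ⊗ idm Z)) +
      \sum_(r < K) (u ∘ (idm L ⊗ (cxr D r ⊗ idm Z))) ∘ (idm L ⊗ (f r ⊗ idm Z)).
  rewrite -{1}[u](compf1 HC) -(tens_id HC) -(tens_id HC) -neg_t_tau !(linE HC).
  rewrite -(Defs.compA HC) !(Defs.interchange HC) !(comp1f HC); congr (_ + _).
  by apply: eq_bigr => r _; rewrite -(Defs.compA HC) !(Defs.interchange HC) !(comp1f HC).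
by rewrite (e g) (e h) et; congr (_ + _); apply: eq_bigr => r _; rewrite er.
Qed.

Lemma ccw0_small r : (r < K)%N -> ccw0 r = ((r == n)%:R : R) *: one.
Proof. by move=> rK; rewrite eq_sym -f_cxr // /Defs.ccw0 neg_dprE. Qed.

Lemma ccw0_lt r : (r < n)%N -> ccw0 r = 0.
Proof. by move=> rn; rewrite ccw0_small ?ltnS ?(ltnW rn) // (ltn_eqF rn) scale0r. Qed.

Lemma ccw0_last : ccw0 n = one.
Proof. by rewrite ccw0_small // eqxx scale1r. Qed.

Lemma dpr_t : d' ∘ t = 0.
Proof. by rewrite neg_dprE f_t. Qed.

Lemma dpr_xp_tE r : d' ∘ ((iD ⊗ xp r) ∘ t)
  = \sum_(i < r) ccw0 i ∘ d ∘ (xp (r - i.+1) ⊗ iD).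
Proof.
have -> : (iD ⊗ xp r) ∘ t = t ∘ (xp r ⊗ iD)
    + \sum_(i < r) (iD ⊗ xp i) ∘ c ∘ d ∘ (xp (r - i.+1) ⊗ iD).
  by rewrite (t_xp HC HD) subrK.
rewrite (compDr HC) (Defs.compA HC) dpr_t (comp0l HC) add0r (comp_sumr HC).
by apply: eq_bigr => i _; rewrite /Defs.ccw0; mon tt.
Qed.

Lemma dpr_xp_t r : (r < K)%N -> d' ∘ ((iD ⊗ xp r) ∘ t) = 0.
Proof.
move=> rK; rewrite dpr_xp_tE big1 // => i _.
by rewrite ccw0_lt ?(leq_trans (ltn_ord i)) // !(comp0l HC).
Qed.

Lemma dpr_xpK_t : d' ∘ ((iD ⊗ xp K) ∘ t) = d.
Proof.
rewrite dpr_xp_tE big_ord_recr subnn big1 /= => [|i _]; last by rewrite ccw0_lt // !(comp0l HC).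
by rewrite add0r ccw0_last xp0; mon tt.
Qed.

Lemma tau_c0 : tau ∘ c = 0.
Proof. by rewrite -[RHS](tau_cxr (r := 0)) // /cxr xp0; mon tt. Qed.

(** The decomposition [neg_t_tau] is inserted below the dot; its last summand is
    [tau ∘ cxr D K ∘ f n = c' ∘ d'], and the correction in [t_x] dies because [tau ∘ c = 0]. *)
Lemma neg_tau_x : (x ⊗ iD) ∘ tau = tau ∘ (iD ⊗ x) - c' ∘ d'.
Proof.
have -> : tau ∘ (iD ⊗ x) = tau ∘ (iD ⊗ x) ∘ t ∘ tau + c' ∘ d'.
  rewrite -[LHS](compf1 HC) -neg_t_tau (compDr HC) (comp_sumr HC); congr (_ + _).
    by mon tt.
  rewrite big_ord_recr big1 /= => [|i _].
    by rewrite add0r neg_cprE neg_dprE /cxr xpS; mon tt.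
  have iK : (i.+1 < K)%N by rewrite ltnS.
  rewrite [LHS](_ : _ = (tau ∘ cxr D i.+1) ∘ f i); first by rewrite tau_cxr // (comp0l HC).
  by rewrite /cxr xpS; mon tt.
rewrite addrK.
by lc (ctx [::] [::] (t_x HC HD) tau tau, esym (ctxr [::] [::] tau_c0 (d ∘ tau)),
       esym (ctxr [::] [::] neg_tau_t ((x ⊗ iD) ∘ tau))) tt.
Qed.

Lemma neg_tau_xp m : (xp m ⊗ iD) ∘ tau = tau ∘ (iD ⊗ xp m)
  - \sum_(i < m) (xp i ⊗ iD) ∘ c' ∘ d' ∘ (iD ⊗ xp (m - i.+1)).
Proof. exact: (tau_xp_of HC neg_tau_x). Qed.

Lemma lcurl_lt j : (j < K)%N -> lcurl D d' j = 0.
Proof.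
elim: j => [|j IHj] jK; first by rewrite (lcurl0 HC HD) dpr_t !(linE HC).
by rewrite (lcurlS HC HD) IHj ?(ltnW jK) // -/(ccw0 j) (ccw0_lt jK) !(linE HC) addr0.
Qed.

Lemma lcurl_below_lt r : (r < K)%N ->
  (d' ⊗ iU) ∘ ((iD ⊗ s) ∘ (cxr D r ⊗ iU)) = 0.
Proof.
move=> rK; rewrite (lcurl_below HC HD) lcurl_lt // (comp0r HC) add0r big1 // => i _.
by rewrite -/(ccw0 i) ccw0_lt ?(leq_trans (ltn_ord i)) // (tens0l HC).
Qed.

(** The dots sit on the cup, below the crossing, because [c' = tau ∘ cxr D K] brings them there; the
    surviving term is the bubble [ccw0 n = one]. *)
Lemma lcurl_belowK : (d' ⊗ iU) ∘ ((iD ⊗ s) ∘ (cxr D K ⊗ iU)) = iU.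
Proof.
rewrite (lcurl_below HC HD) lcurl_lt // (comp0r HC) add0r big_ord_recr big1 /= => [|i _].
  by rewrite add0r -/(ccw0 n) ccw0_last subnn xp0; mon tt.
by rewrite -/(ccw0 i) ccw0_lt // (tens0l HC).
Qed.

Lemma copitchfork_t : (d' ⊗ iU) ∘ ((iD ⊗ s) ∘ (t ⊗ iU)) = iU ⊗ d'.
Proof.
have h := dpr_t; apply: (@codetect U [::]).
  by lc (esym (ctxl [::] [::] (braid_t HC HD) (d' ⊗ iU)), ctxr [::] U h ((iU ⊗ t) ∘ (s ⊗ iD)),
         esym (ctx0 U [::] h)) tt.
move=> r rK; rewrite [LHS](_ : _ =
  (d' ⊗ iU) ∘ ((iD ⊗ s) ∘ ((t ⊗ iU) ∘ (iU ⊗ ((iD ⊗ xp r) ∘ c))))); last by mon tt.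
rewrite (lslide HC HD) big1 => [|i _]; last first.
  by rewrite lcurl_lt ?(comp0r HC) // (ltn_trans (ltn_ord i)).
rewrite subr0 -/(ccw0 r) [RHS](_ : _ = iU ⊗ ccw0 r); last by rewrite /Defs.ccw0; mon tt.
by rewrite ccw0_small // !(linE HC); congr (_ *: _); mon tt.
Qed.

Lemma copitchfork_tau : (iU ⊗ d') ∘ (tau ⊗ iU) = (d' ⊗ iU) ∘ (iD ⊗ s).
Proof.
rewrite -copitchfork_t.
have -> : (d' ⊗ iU) ∘ ((iD ⊗ s) ∘ (t ⊗ iU)) ∘ (tau ⊗ iU)
    = (d' ⊗ iU) ∘ ((iD ⊗ s) ∘ ((t ∘ tau) ⊗ iU)) by mon tt.
rewrite -[t ∘ tau](addrK (\sum_(r < K) cxr D r ∘ f r)) neg_t_tau !(linE HC).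
rewrite big1 => [|r _]; first by rewrite subr0; mon tt.
rewrite [LHS](_ : _ = (d' ⊗ iU) ∘ ((iD ⊗ s) ∘ (cxr D r ⊗ iU)) ∘ (f r ⊗ iU)).
  by rewrite lcurl_below_lt // (comp0l HC).
by mon tt.
Qed.

Lemma neg_zigzag_up : (iU ⊗ d') ∘ (c' ⊗ iU) = iU.
Proof.
rewrite neg_cprE -[RHS]lcurl_belowK.
by lc (ctxr [::] [::] copitchfork_tau (cxr D K ⊗ iU)) tt.
Qed.

Lemma dpr_smate_cxr r : (r < K)%N -> (iD ⊗ d') ∘ ((s' ⊗ iU) ∘ (iD ⊗ cxr D r)) = 0.
Proof.
by move=> rK; rewrite /cxr (smate_xp_c HC HD) dpr_xp_t // (tens0r HC) (comp0l HC).
Qed.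

Lemma mate_copitchfork_t : (iD ⊗ d') ∘ ((s' ⊗ iU) ∘ (iD ⊗ t)) = d' ⊗ iD.
Proof.
have h := dpr_t; apply: (@codetect [::] Dn).
  by lc (esym (ctxl [::] [::] (braid_smate HC HD) (iD ⊗ d')),
         ctxr Dn [::] h ((t ⊗ iD) ∘ (iU ⊗ s')), esym (ctx0 [::] Dn h)) tt.
move=> r rK; rewrite [LHS](_ : _ =
  (iD ⊗ d') ∘ ((s' ⊗ iU) ∘ ((iD ⊗ (t ∘ (xp r ⊗ iD))) ∘ (c ⊗ iD)))); last by mon tt.
rewrite (t_xp HC HD) !(linE HC) big1 => [|i _].
  rewrite subr0 [LHS](_ : _ = iD ⊗ ccw0 r); last by rewrite /Defs.ccw0; mon (zig, zag, ss).
  rewrite [RHS](_ : _ = ccw0 r ⊗ iD); last by rewrite /Defs.ccw0; mon tt.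
  by rewrite ccw0_small // !(linE HC); congr (_ *: _); mon tt.
rewrite [LHS](_ : _ = ((iD ⊗ d') ∘ ((s' ⊗ iU) ∘ (iD ⊗ cxr D i)))
   ∘ (iD ⊗ (d ∘ (xp (r - i.+1) ⊗ iD))) ∘ (c ⊗ iD)); last by mon tt.
by rewrite dpr_smate_cxr ?(ltn_trans (ltn_ord i)) // !(comp0l HC).
Qed.

Lemma mate_copitchfork_tau : (d' ⊗ iD) ∘ (iD ⊗ tau) = (iD ⊗ d') ∘ (s' ⊗ iU).
Proof.
rewrite -mate_copitchfork_t.
have -> : (iD ⊗ d') ∘ ((s' ⊗ iU) ∘ (iD ⊗ t)) ∘ (iD ⊗ tau)
    = (iD ⊗ d') ∘ ((s' ⊗ iU) ∘ (iD ⊗ (t ∘ tau))) by mon tt.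
rewrite -[t ∘ tau](addrK (\sum_(r < K) cxr D r ∘ f r)) neg_t_tau !(linE HC).
rewrite big1 => [|r _]; first by rewrite subr0; mon tt.
rewrite [LHS](_ : _ = (iD ⊗ d') ∘ ((s' ⊗ iU) ∘ (iD ⊗ cxr D r)) ∘ (iD ⊗ f r)).
  by rewrite dpr_smate_cxr // (comp0l HC).
by mon tt.
Qed.

Lemma neg_zigzag_down : (d' ⊗ iD) ∘ (iD ⊗ c') = iD.
Proof.
rewrite neg_cprE [LHS](_ : _ = ((d' ⊗ iD) ∘ (iD ⊗ tau)) ∘ (iD ⊗ cxr D K)); last by mon tt.
rewrite mate_copitchfork_tau -(Defs.compA HC) /cxr (smate_xp_c HC HD) dpr_xpK_t.
exact: zag.
Qed.

Lemma dpr_xpr : d' ∘ (x' ⊗ iU) = d' ∘ (iD ⊗ x).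
Proof.
have h := dpr_t; apply: (@codetect [::] [::]).
  by lc (esym (ctxl [::] [::] (t_xpr HC HD) d'), ctxl [::] [::] (t_x HC HD) d',
       ctxr [::] [::] h (iU ⊗ x'), esym (ctxr [::] [::] h (x ⊗ iD))) tt.
move=> r rK.
have xx : xp r ∘ x = x ∘ xp r by rewrite -xpS (xpSr HC).
by lc (ctxl [::] [::] (xpr_c HC HD) (d' ∘ (iD ⊗ xp r)), ctx Dn [::] xx d' c) tt.
Qed.

Lemma neg_x_mates :
  (iD ⊗ d) ∘ ((iD ⊗ x ⊗ iD) ∘ (c ⊗ iD)) = (d' ⊗ iD) ∘ ((iD ⊗ x ⊗ iD) ∘ (iD ⊗ c')).
Proof.
by lc (ctxr [::] Dn dpr_xpr (iD ⊗ c'), esym (ctxr [::] [::] neg_zigzag_down x')) tt.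
Qed.

Lemma neg_s_mates : d' ∘ (iD ⊗ d' ⊗ iU) ∘ (iD ⊗ iD ⊗ s)
  = d' ∘ (iD ⊗ d' ⊗ iU) ∘ (s' ⊗ iU ⊗ iU).
Proof.
by lc (esym (ctxl Dn [::] copitchfork_tau d'), ctxl [::] U mate_copitchfork_tau d') tt.
Qed.

Lemma neg_tprE : tpr (Negz n) D = tau.
Proof.
by lc (esym (ctxr [::] Dn copitchfork_tau (iD ⊗ iU ⊗ c')), ctxr U [::] neg_zigzag_down tau) tt.
Qed.

End Negative.

(** * Grassmannian relation and braid difference for negative central charge *)

Section NegativeBubbles.
Context {R : comPzRingType} {C : lmcat R} (HC : lmcat_axioms C).
Context {n : nat} {D : heis_data C} (HD : heis_rels (Negz n) D).
Local Notation K := n.+1.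
Local Notation x := (hx D).
Local Notation c := (hc D).
Local Notation s := (hs D).
Local Notation d := (hd D).
Local Notation t := (ht D).
Local Notation tau := (htau D).
Local Notation f := (hf D).
Local Notation xp := (xp D).
Local Notation iU := (@idm _ C U).
Local Notation iD := (@idm _ C Dn).
Local Notation c' := (cpr (Negz n) D).
Local Notation d' := (dpr (Negz n) D).
Local Notation cw0 := (cw0 (Negz n) D).
Local Notation ccw0 := (ccw0 (Negz n) D).
Local Notation cw := (cw (Negz n) D).
Local Notation ccw := (ccw (Negz n) D).
Local Notation one := (@idm _ C [::]).
Local Notation A i := (cw ((i : nat)%:Z + Negz n - 1)).
Local Notation B i := (ccw ((i : nat)%:Z - Negz n - 1)).

Lemma ccw_nn_hess (z : int) : z < -1 -> - ccw_nn (Negz n) D (z - Negz n) = 0.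
Proof.
move=> z1; case E: (z - Negz n) => [m|m] /=; rewrite ?oppr0 //.
by rewrite (ccw0_lt HD) ?oppr0 //; rewrite NegzE in E; lia.
Qed.

Lemma ccw_nn_hess1 : - ccw_nn (Negz n) D (-1 - Negz n) = - one.
Proof.
have -> : -1 - Negz n = n%:Z by rewrite NegzE; lia.
by rewrite /= (ccw0_last HD).
Qed.

(** Here the clockwise series begins with determinants, while all coefficients [B m] are actual
    dotted diagrams. *)
Lemma cw_det i : (i <= K)%N ->
  A i = - bdet i%:Z (fun i j => - ccw_nn (Negz n) D (i - j - Negz n)).
Proof.
move=> iK; have -> : i%:Z + Negz n - 1 = Negz (K - i) by rewrite !NegzE; lia.
rewrite /Defs.cw; have -> // : Negz (K - i) - Negz n + 1 = i%:Z by rewrite !NegzE; lia.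
Qed.

Lemma neg_cwE m : A (K.+1 + m) = cw0 m.
Proof. by have -> : (K.+1 + m)%:Z + Negz n - 1 = m%:Z by rewrite NegzE; lia. Qed.

Lemma neg_ccwE m : B m = ccw0 (n + m).
Proof. by have -> : m%:Z - Negz n - 1 = (n + m)%:Z by rewrite NegzE; lia. Qed.

Lemma neg_cw_first : A 0 = - one.
Proof. by rewrite cw_det // (bdet0 HC). Qed.

Lemma cw_rec i : (i < K)%N -> A i.+1 = - \sum_(j < i.+1) A j ∘ ccw0 (K + i - j).
Proof.
move=> iK; rewrite cw_det // (bdetE HC).
rewrite (@hessenberg_det _ (fun z => - ccw_nn (Negz n) D (z - Negz n) : bubble HC)) /=.
- congr (- _); apply: eq_bigr => j _; have ji := leq_ord j.
  rewrite cw_det ?(leq_trans ji (ltnW iK)) // (bdetE HC).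
  have -> : i%:Z - j%:Z - Negz n = (K + i - j)%:Z by rewrite NegzE; lia.
  by rewrite /= (compNl HC) (bubbleC HC) mulNr.
- exact: ccw_nn_hess1.
- exact: ccw_nn_hess.
Qed.

Lemma f_x r : (r < K)%N -> f r ∘ (iD ⊗ x)
  = \sum_(q < K) (f r ∘ cxr D q.+1) ∘ f q + (f r ∘ c) ∘ (d ∘ tau).
Proof.
move=> rK; have h : f r ∘ (iD ⊗ x) ∘ t ∘ tau = (f r ∘ c) ∘ (d ∘ tau).
  by lc (esym (ctx [::] [::] (t_x HC HD) (f r) tau),
      ctxr [::] [::] (f_t HD rK) ((x ⊗ iD) ∘ tau)) tt.
rewrite -h -[LHS](compf1 HC) -(neg_t_tau HD) (compDr HC) (comp_sumr HC) addrC; congr (_ + _).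
  by apply: eq_bigr => q _; rewrite /cxr xpS; mon tt.
by mon tt.
Qed.

Lemma f_step r : (r < n)%N ->
  f r = f r.+1 ∘ (iD ⊗ x) - (f r.+1 ∘ cxr D K) ∘ d'.
Proof.
move=> rn; rewrite f_x //.
have -> : f r.+1 ∘ c = 0.
  rewrite -[RHS](scale0r one) -(f_cxr HD (r := r.+1) (q := 0)) //.
  by rewrite /cxr xp0; mon tt.
rewrite big_ord_recr /= (bigD1 (Ordinal rn)) //= big1 => [|i ne]; last first.
  have iK : (i.+1 < K)%N by rewrite ltnS.
  rewrite (f_cxr HD) // eqSS eq_sym.
  have -> : (i == r :> nat) = false by apply/negbTE.
  by rewrite scale0r (comp0l HC).
rewrite (f_cxr HD) // eqxx scale1r.
by rewrite (comp1f HC) (comp0l HC) !addr0 neg_dprE addrK.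
Qed.

Lemma d_tau_step : d ∘ tau = f 0 ∘ (iD ⊗ x) - (f 0 ∘ cxr D K) ∘ d'.
Proof.
rewrite f_x //.
have -> : f 0 ∘ c = one.
  by rewrite -[RHS]scale1r -(f_cxr HD (r := 0) (q := 0)) // /cxr xp0; mon tt.
rewrite big_ord_recr /= big1 => [|i _]; last first.
  have iK : (i.+1 < K)%N by rewrite ltnS.
  by rewrite (f_cxr HD) // scale0r (comp0l HC).
by rewrite (comp1f HC) add0r neg_dprE addrC addrA [- _ + _]addrC subrr add0r.
Qed.

Lemma fE j : (j < K)%N -> f (n - j) = - \sum_(i < j.+1) A i ∘ d' ∘ (iD ⊗ xp (j - i)).
Proof.
elim: j => [|j IHj] jK.
  by rewrite big_ord1 !subn0 neg_cw_first xp0 neg_dprE; mon tt.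
have jr : (n - j)%N = (n - j.+1).+1 by lia.
rewrite f_step -?jr; last by lia.
have {}IHj := IHj (ltnW jK).
have -> : f (n - j) ∘ cxr D K = A j.+1.
  rewrite cw_rec ?(ltnW jK) // IHj (compNl HC) (comp_suml HC); congr (- _).
  apply: eq_bigr => i _; have ij := leq_ord i.
  have -> : (K + j - i)%N = (j - i + K)%N by lia.
  by rewrite /cxr /Defs.ccw0 (xpD HC); mon tt.
rewrite IHj (compNl HC) -opprD; congr (- _).
rewrite (comp_suml HC) [RHS]big_ord_recr /= subnn xp0; congr (_ + _); last by mon tt.
apply: eq_bigr => i _; rewrite (subSn (leq_ord i)) (xpSr HC); mon tt.
Qed.

(** The map [d ∘ tau] plays the role of an entry of [f] of index -1, this time without a sign. *)
Lemma d_tau : d ∘ tau = - \sum_(i < K.+1) A i ∘ d' ∘ (iD ⊗ xp (K - i)).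
Proof.
have := fE (ltnSn n); rewrite subnn => h0; rewrite d_tau_step.
have -> : f 0 ∘ cxr D K = A K.
  rewrite cw_rec // h0 (compNl HC) (comp_suml HC); congr (- _).
  apply: eq_bigr => i _; have ij := leq_ord i.
  have -> : (K + n - i)%N = (n - i + K)%N by lia.
  by rewrite /cxr /Defs.ccw0 (xpD HC); mon tt.
rewrite big_ord_recr /= subnn xp0 opprD; congr (_ + _); last by mon tt.
rewrite h0 (compNl HC) (comp_suml HC); congr (- _); apply: eq_bigr => i _.
by rewrite (subSn (leq_ord i)) (xpSr HC); mon tt.
Qed.

Lemma neg_grassmann m : \sum_(r < m.+1) A r ∘ B (m - r) = - (((m == 0)%N%:R : R) *: one).
Proof.
case: m => [|m].
  rewrite big_ord1 neg_cw_first neg_ccwE addn0 (ccw0_last HD) scale1r (compNl HC).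
  by rewrite (comp1f HC).
rewrite scale0r oppr0.
have [mK | Km] := ltnP m K.
  rewrite big_ord_recr /= subnn neg_ccwE addn0 (ccw0_last HD) (compf1 HC) (cw_rec mK).
  apply/eqP; rewrite subr_eq0; apply/eqP; apply: eq_bigr => i _; have im := leq_ord i.
  by rewrite neg_ccwE; have -> : (n + (m.+1 - i))%N = (K + m - i)%N by lia.
have [p ->] : exists p, m = (K + p)%N by exists (m - K)%N; rewrite subnKC.
have cwp : cw0 p = d ∘ tau ∘ cxr D (K + p) - \sum_(i < p) cw0 i ∘ ccw0 (K + p - i.+1).
  rewrite {1}/Defs.cw0 neg_cprE.
  rewrite [LHS](_ : _ = d ∘ ((xp p ⊗ iD) ∘ tau) ∘ cxr D K); last by mon tt.
  rewrite (neg_tau_xp HC HD) !(linE HC); congr (_ - _).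
    by rewrite /cxr addnC (xpD HC); mon tt.
  apply: eq_bigr => i _; have ip := ltn_ord i.
  have -> : (K + p - i.+1)%N = (p - i.+1 + K)%N by lia.
  by rewrite /Defs.cw0 /Defs.ccw0 /cxr (xpD HC); mon tt.
rewrite -(big_mkord xpredT (fun r => A r ∘ B ((K + p).+1 - r))).
rewrite (big_cat_nat (n := K.+1)) //=; last by rewrite -addSn leqW // leq_addr.
rewrite [X in _ + X](_ : _ = d ∘ tau ∘ cxr D (K + p)).
  rewrite d_tau (compNl HC) (comp_suml HC) big_mkord.
  apply/eqP; rewrite subr_eq0; apply/eqP; apply: eq_bigr => i _; have iK := leq_ord i.
  rewrite neg_ccwE; have -> : (n + ((K + p).+1 - i))%N = (K - i + (K + p))%N by lia.
  by rewrite /cxr /Defs.ccw0 (xpD HC); mon tt.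
rewrite [LHS](_ : _ = \sum_(0 + K.+1 <= i < p.+1 + K.+1) A i ∘ B ((K + p).+1 - i)); last first.
  by congr (\sum_(_ <= i < _) _); lia.
rewrite big_addn addnK big_mkord big_ord_recr /=.
rewrite (addnC p) neg_cwE neg_ccwE.
have -> : (n + ((K + p).+1 - (K.+1 + p)))%N = n by lia.
rewrite (ccw0_last HD) (compf1 HC) cwp addrC.
rewrite [X in _ + X](_ : _ = \sum_(i < p) cw0 i ∘ ccw0 (K + p - i.+1)) ?subrK //.
apply: eq_bigr => i _; have ip := ltn_ord i.
rewrite addnC neg_cwE neg_ccwE.
by have -> : (n + ((K + p).+1 - (K.+1 + i)))%N = (K + p - i.+1)%N by lia.
Qed.

Lemma f_cxrK j : (j < K)%N -> f (n - j) ∘ cxr D K = A j.+1.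
Proof.
move=> jK; rewrite cw_rec // fE // (compNl HC) (comp_suml HC); congr (- _).
apply: eq_bigr => i _; have ij := leq_ord i.
have -> : (K + j - i)%N = (j - i + K)%N by lia.
by rewrite /cxr /Defs.ccw0 (xpD HC); mon tt.
Qed.

Lemma t_cprE : t ∘ c' = - \sum_(i < K.+1) cxr D (K - i) ∘ A i.
Proof.
rewrite neg_cprE [LHS](_ : _ = (t ∘ tau) ∘ cxr D K); last by mon tt.
rewrite -[t ∘ tau](addrK (\sum_(r < K) cxr D r ∘ f r)) (neg_t_tau HD) (compDl HC) (compNl HC).
rewrite (comp1f HC) (comp_suml HC) [in RHS]big_ord_recl neg_cw_first subn0 opprD; congr (_ + _).
  by mon tt.
congr (- _); rewrite (reindex_inj rev_ord_inj); apply: eq_bigr => i _.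
by rewrite lift0 /= -(Defs.compA HC) subSS f_cxrK.
Qed.

Lemma f_sum r N : (r < K)%N -> (K <= N)%N ->
  f r = - \sum_(b < N) cw (- r%:Z - b%:Z - 2) ∘ d' ∘ (iD ⊗ xp b).
Proof.
move=> rK KN; have rE : r = (n - (n - r))%N by lia.
rewrite {1}rE fE; last by lia.
congr (- _); rewrite (reindex_inj rev_ord_inj) /=.
rewrite -(big_mkord xpredT (fun b => cw (- r%:Z - b%:Z - 2) ∘ d' ∘ (iD ⊗ xp b))).
rewrite (big_cat_nat (n := (n - r).+1)) //=; last by lia.
rewrite [X in _ + X]big1_seq ?addr0 => [|b]; last first.
  rewrite mem_index_iota => /andP[_ /andP[rb _]].
  have -> : - r%:Z - b%:Z - 2 = Negz (r + b).+1 by rewrite NegzE; lia.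
  rewrite /Defs.cw; have -> : Negz (r + b).+1 - Negz n + 1 = Negz (r + b - K) by rewrite !NegzE; lia.
  by rewrite /= oppr0 !(comp0l HC).
rewrite big_mkord; apply: eq_bigr => i _; have ij := leq_ord i.
have -> : (n - r - ((n - r).+1 - i.+1))%N = i by lia.
by congr (cw _ ∘ _ ∘ _); rewrite NegzE; lia.
Qed.


(** Now [D2] is [D1] preceded by [t ∘ tau] on the two right strands. *)
Lemma neg_braid_difference : D1 (Negz n) D - D2 (Negz n) D
  = - \sum_(r < K) \sum_(i < r) xp (r - i.+1) ⊗ (cxr D i ∘ f r).
Proof.
rewrite /D1 /D2 (neg_tprE HC HD).
have -> : (iU ⊗ t) ∘ ((s ⊗ iD) ∘ (iU ⊗ tau))
    = (tau ⊗ iU) ∘ ((iD ⊗ s) ∘ ((t ⊗ iU) ∘ (iU ⊗ (t ∘ tau)))).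
  by lc (ctx [::] [::] (braid_t HC HD) (tau ⊗ iU) (iU ⊗ tau),
         esym (ctxr [::] U (neg_tau_t HD) ((iU ⊗ t) ∘ (s ⊗ iD) ∘ (iU ⊗ tau)))) tt.
rewrite -[t ∘ tau](addrK (\sum_(r < K) cxr D r ∘ f r)) (neg_t_tau HD) !(linE HC).
rewrite [X in _ - (X - _)](_ : _ = (tau ⊗ iU) ∘ ((iD ⊗ s) ∘ (t ⊗ iU))); last by mon tt.
rewrite opprB addrC subrK -sumrN; apply: eq_bigr => r _.
rewrite [LHS](_ : _ = (tau ⊗ iU) ∘ (iD ⊗ (s ∘ (iU ⊗ xp r) ∘ s)) ∘ (c ⊗ iU) ∘ (iU ⊗ f r)).
  rewrite (s_1xp_s_below HC HD) !(linE HC) [X in X - _](_ : _ = 0) ?sub0r; last first.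
    have h := tau_cxr HD (ltn_ord r).
    by lc (ctxr [::] U h (iU ⊗ f r)) tt.
  congr (- _); apply: eq_bigr => i _; have ir := ltn_ord i.
  (* After sliding the dots up, [tau] meets [t] and cancels in the main term, while the corrections
     contain [tau ∘ cxr D q = 0]. *)
  have e : s ∘ (xp i ⊗ iU) = (iU ⊗ xp i) ∘ s + \sum_(q < i) xp q ⊗ xp (i - q.+1).
    by rewrite (s_xp HC HD) subrK.
  rewrite [LHS](_ : _ = (tau ⊗ iU) ∘ (iD ⊗ (s ∘ (xp i ⊗ iU))) ∘ (c ⊗ iU)
      ∘ (xp (r - i.+1) ⊗ f r)); last by mon tt.
  rewrite e !(linE HC) big1 => [|q _].
    rewrite addr0; have h := neg_tau_t HD.
    by lc (ctx [::] U h (iU ⊗ iD ⊗ xp i) ((iU ⊗ c) ∘ (xp (r - i.+1) ⊗ f r))) (heis_zig HD, heis_zag HD).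
  rewrite [LHS](_ : _ = ((tau ∘ cxr D q) ⊗ xp (i - q.+1)) ∘ (xp (r - i.+1) ⊗ f r)); last by mon tt.
  by rewrite (tau_cxr HD) ?(linE HC) //; have := ltn_ord r; have := ltn_ord q; lia.
by mon (heis_zig HD, heis_zag HD).
Qed.

End NegativeBubbles.

(** * Truncation and reindexing of finite sums *)

Section Sums.
Variable V : zmodType.

Lemma sum_truncate (F : nat -> V) M N : (M <= N)%N -> (forall m, (M <= m)%N -> F m = 0) ->
  \sum_(m < N) F m = \sum_(m < M) F m.
Proof.
move=> MN F0; rewrite -!(big_mkord xpredT) (big_cat_nat (n := M)) //=.
rewrite [X in _ + X]big1_seq ?addr0 // => m.
by rewrite mem_index_iota => /andP[_ /andP[Mm _]]; apply: F0.
Qed.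

(** A value [m] is a sum of two naturals in [m + 1] ways, the origin of the factor [m + 1] in the
    bubble slides. *)
Lemma sum_shifts (F : nat -> V) r N : (r <= N)%N -> (forall m, (r <= m)%N -> F m = 0) ->
  \sum_(i < r) \sum_(m < N) F (i + m)%N = \sum_(m < N) F m *+ m.+1.
Proof.
move=> rN F0; rewrite [RHS](@sum_truncate (fun m => F m *+ m.+1) r) //; last first.
  by move=> m /F0->; rewrite mul0rn.
have -> : \sum_(i < r) \sum_(m < N) F (i + m)%N = \sum_(i < r) \sum_(m < r - i) F (i + m)%N.
  apply: eq_bigr => i _; apply: (@sum_truncate (fun m => F (i + m)%N)); first by lia.
  by move=> m im; apply: F0; lia.
elim: r {rN F0} => [|r IHr]; first by rewrite !big_ord0.
rewrite big_ord_recr /= subSnn big_ord1 addn0 [RHS]big_ord_recr /= -IHr mulrSr addrA.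
congr (_ + _); rewrite -[X in F X *+ _]/(r : nat).
rewrite (eq_bigr (fun i : 'I_r => \sum_(m < r - i) F (i + m)%N + F r)) => [|i _].
  by rewrite big_split sumr_const card_ord.
have ir := ltn_ord i; rewrite (subSn (ltnW ir)) big_ord_recr /=.
by congr (_ + F _); lia.
Qed.

(** The pairs are grouped by [r = i + m + 1], the index of the matrix entry in the braid
    difference. *)
Lemma sum_antidiagonals (H : nat -> nat -> V) K N : (K <= N)%N ->
  (forall i m, (K <= (i + m).+1)%N -> H i m = 0) ->
  \sum_(i < N) \sum_(m < N) H i m = \sum_(r < K) \sum_(i < r) H i (r - i.+1)%N.
Proof.
move=> KN H0; transitivity (\sum_(i < K) \sum_(m < K - i.+1) H i m).
  rewrite (@sum_truncate (fun i => \sum_(m < N) H i m) K) // => [|i Ki]; last first.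
    by apply: big1 => m _; apply: H0; lia.
  apply: eq_bigr => i _; apply: sum_truncate; first by lia.
  by move=> m Km; apply: H0; lia.
elim: K {KN H0} => [|K IHK]; first by rewrite !big_ord0.
rewrite big_ord_recr /= subnn big_ord0 addr0 [RHS]big_ord_recr /= -IHK -big_split /=.
apply: eq_bigr => i _; have iK := ltn_ord i.
by rewrite (_ : (K.+1 - i.+1)%N = (K - i.+1).+1) ?big_ord_recr //; lia.
Qed.

End Sums.

(** * Bubbles of low index and the Grassmannian relation for every k *)

Section LowBubbles.
Context {R : comPzRingType} {C : lmcat R} (HC : lmcat_axioms C).
Context {k : int} {D : heis_data C} (HD : heis_rels k D).
Local Notation one := (@idm _ C [::]).

Lemma bdet_le0 (z : int) (f : int -> int -> Defs.hom C [::] [::]) : z <= 0 ->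
  bdet z f = ((z == 0)%:R : R) *: one.
Proof.
case: z => [[|m]|m] // _; first by rewrite scale1r bdet0.
by rewrite /= scale0r.
Qed.

(** A negative index below k gives a determinant of size at most 0; a nonnegative one forces k > 0,
    where the bubble is a matrix entry. *)
Lemma cw_low r : r < k -> cw k D r = - (((r == k - 1)%:R : R) *: one).
Proof.
case: r => [r|r] rk; last first.
  rewrite /cw bdet_le0; last by lia.
  by congr (- (_%:R *: _)); congr nat_of_bool; apply/eqP/eqP; lia.
case: k HD rk => // K HK; rewrite ltz_nat => rK.
rewrite /cw (cw0_small HC HK rK); congr (- (_%:R *: _)); congr nat_of_bool.
by apply/eqP/eqP; lia.
Qed.

Lemma ccw_low r : r < - k -> ccw k D r = ((r == - k - 1)%:R : R) *: one.
Proof.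
case: r => [r|r] rk; last first.
  rewrite /ccw bdet_le0; last by lia.
  by congr (_%:R *: _); congr nat_of_bool; apply/eqP/eqP; lia.
case: k HD rk => [K|n] HK rK; first by exfalso; lia.
have rn : (r < n.+1)%N by rewrite NegzE in rK; lia.
rewrite /ccw (ccw0_small HK rn); congr (_%:R *: _); congr nat_of_bool.
by apply/eqP/eqP; rewrite ?NegzE; lia.
Qed.

Lemma cw_eq0 r : r < k - 1 -> cw k D r = 0.
Proof.
move=> rk; rewrite cw_low; last by lia.
by have -> : (r == k - 1) = false; [apply/eqP; lia | rewrite scale0r oppr0].
Qed.

Lemma ccw_eq0 r : r < - k - 1 -> ccw k D r = 0.
Proof.
move=> rk; rewrite ccw_low; last by lia.
by have -> : (r == - k - 1) = false; [apply/eqP; lia | rewrite scale0r].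
Qed.

Lemma grassmann_nat m :
  \sum_(r < m.+1) cw k D (r%:Z + k - 1) ∘ ccw k D ((m - r)%N%:Z - k - 1)
  = - (((m == 0)%N%:R : R) *: one).
Proof.
by case: k HD => [K|n] HK; [apply: (grassmann HC HK) | apply: (neg_grassmann HC HK)].
Qed.

Lemma grassmann_int m :
  \sum_(r < `|m|.+1 | (r%:Z <= m)) cw k D (r%:Z + k - 1) ∘ ccw k D ((m - r%:Z) - k - 1)
  = - (((m == 0)%:R : R) *: one).
Proof.
case: m => m; last by rewrite big_pred0 /= ?scale0r ?oppr0 // => i; apply/idP; lia.
rewrite -[m%:Z == 0]/(m == 0)%N -grassmann_nat; apply: eq_big => i.
  by have := leq_ord i; rewrite lez_nat => ->.
by move=> _; have im : (i <= m)%N := leq_ord i; rewrite subzn.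
Qed.

End LowBubbles.

(** * Curls as combinations of bubbles and dots *)

Section CurlExpansions.
Context {R : comPzRingType} {C : lmcat R} (HC : lmcat_axioms C).
Context {k : int} {D : heis_data C} (HD : heis_rels k D).
Local Notation xp := (xp D).
Local Notation c' := (cpr k D).
Local Notation d' := (dpr k D).
Local Notation cw := (cw k D).
Local Notation ccw := (ccw k D).

Lemma lcurl_base N : (`|k| < N)%N ->
  lcurl D d' 0 = \sum_(m < N) ccw (- m%:Z - 1) ⊗ xp m.
Proof.
move=> kN; rewrite (lcurl0 HC HD).
case: k HD kN => [K|n] HK kN.
  rewrite (@sum_truncate _ (fun m => Defs.ccw K D (- m%:Z - 1) ⊗ xp m) K.+1 N) // => [|m Km].
    rewrite (dpr_tE HC HK) !(linE HC) (reindex_inj rev_ord_inj); apply: eq_bigr => i _.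
    have iK := leq_ord i; rewrite /= subSS subKn //.
    have -> : (K - i)%N%:Z - K%:Z - 1 = - i%:Z - 1 by lia.
    by mon (heis_zig HK, heis_zag HK).
  by rewrite (ccw_eq0 HC HK) ?(tens0l HC) //; lia.
rewrite (dpr_t HK) !(linE HC) big1 // => m _.
by rewrite (ccw_eq0 HC HK) ?(tens0l HC) // NegzE; lia.
Qed.

Lemma rcurl_base N : (`|k| < N)%N ->
  rcurl D c' 0 = - \sum_(m < N) xp m ⊗ cw (- m%:Z - 1).
Proof.
move=> kN; rewrite (rcurl0 HC HD).
case: k HD kN => [K|n] HK kN.
  have [EK|K0] := posnP K.
    rewrite (t_cpr_eq0 HC HK EK) (@sum_truncate _ (fun m => xp m ⊗ Defs.cw K D (- m%:Z - 1)) 1 N).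
    - rewrite big_ord1 (cw_low HC HK); last by lia.
      have -> : - 0%:Z - 1 == K%:Z - 1 by apply/eqP; lia.
      by rewrite scale1r xp0; mon (heis_zig HK).
    - by lia.
    - by move=> m m0; rewrite (cw_eq0 HC HK) ?(tens0r HC) //; lia.
  rewrite (t_cpr_gt0 HC HK K0) !(linE HC) big1 ?oppr0 // => m _.
  by rewrite (cw_eq0 HC HK) ?(tens0r HC) //; lia.
rewrite (@sum_truncate _ (fun m => xp m ⊗ Defs.cw (Negz n) D (- m%:Z - 1)) n.+2 N) // => [|m Km].
  rewrite (t_cprE HC HK) !(linE HC) (reindex_inj rev_ord_inj); congr (- _).
  apply: eq_bigr => i _; have iK := leq_ord i; rewrite /= subSS subKn //.
  have -> : (n.+1 - i)%N%:Z + Negz n - 1 = - i%:Z - 1 by rewrite NegzE; lia.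
  by mon (heis_zig HK, heis_zag HK).
by rewrite (cw_eq0 HC HK) ?(tens0r HC) //; rewrite NegzE; lia.
Qed.

Lemma lcurlE r N : (`|k| + r < N)%N ->
  lcurl D d' r = \sum_(m < N) ccw (r%:Z - m%:Z - 1) ⊗ xp m.
Proof.
elim: r N => [|r IHr] [//|N] rN.
  by rewrite (@lcurl_base N.+1); [apply: eq_bigr => m _; rewrite sub0r | lia].
rewrite (lcurlS HC HD) (IHr N) ?[RHS]big_ord_recl; last by lia.
rewrite addrC (comp_suml HC); congr (_ + _).
  by rewrite xp0 (_ : r.+1%:Z - _ - 1 = r%:Z) //=; lia.
apply: eq_bigr => i _; rewrite lift0 (xpSr HC).
by rewrite (_ : r.+1%:Z - i.+1%:Z - 1 = r%:Z - i%:Z - 1); [mon tt | lia].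
Qed.

Lemma rcurlE r N : (`|k| + r < N)%N ->
  rcurl D c' r = - \sum_(m < N) xp m ⊗ cw (r%:Z - m%:Z - 1).
Proof.
elim: r N => [|r IHr] [//|N] rN.
  by rewrite (@rcurl_base N.+1); [congr (- _); apply: eq_bigr => m _; rewrite sub0r | lia].
rewrite (rcurlS HC HD) (IHr N) ?[in RHS]big_ord_recl; last by lia.
rewrite (compNl HC) -opprD addrC (comp_suml HC); congr (- (_ + _)).
  by rewrite xp0 (_ : r.+1%:Z - _ - 1 = r%:Z) //=; lia.
apply: eq_bigr => i _; rewrite lift0 (xpSr HC).
by rewrite (_ : r.+1%:Z - i.+1%:Z - 1 = r%:Z - i%:Z - 1); [mon tt | lia].
Qed.

End CurlExpansions.

(** * Bubble slides *)

Section BubbleSlides.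
Context {R : comPzRingType} {C : lmcat R} (HC : lmcat_axioms C).
Context {k : int} {D : heis_data C} (HD : heis_rels k D).
Local Notation x := (hx D).
Local Notation xp := (xp D).
Local Notation iU := (@idm _ C U).
Local Notation iD := (@idm _ C Dn).
Local Notation c' := (cpr k D).
Local Notation d' := (dpr k D).
Local Notation cw := (cw k D).
Local Notation ccw := (ccw k D).
Local Notation one := (@idm _ C [::]).
Local Notation E := (endo HC U).

Let A (i : nat) := cw (i%:Z + k - 1).
Let B (i : nat) := ccw (i%:Z - k - 1).
(** The second letter tells on which side of the strand the bubble stands. *)
Let al (i : nat) : E := A i ⊗ iU.
Let ar (i : nat) : E := iU ⊗ A i.
Let bl (i : nat) : E := B i ⊗ iU.
Let br (i : nat) : E := iU ⊗ B i.

(* The coefficients of 1 - (u - x)^-2 as a power series in u^-1. *)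
Let P (j : nat) : E :=
  match j with 0 => iU | 1 => 0 | m.+2 => - ((m.+1%:R : R) *: xp m) end.

Lemma conv_AB m : \sum_(i < m.+1) A i ∘ B (m - i) = - (((m == 0)%N%:R : R) *: one).
Proof. exact: (grassmann_nat HC HD). Qed.

Lemma conv_BA m : \sum_(i < m.+1) B i ∘ A (m - i) = - (((m == 0)%N%:R : R) *: one).
Proof.
rewrite -conv_AB [RHS](reindex_inj rev_ord_inj) /=; apply: eq_bigr => i _.
by rewrite subSS subKn ?leq_ord // (bubbleC HC).
Qed.

Lemma delta_idm m : ((m == 0)%N%:R : R) *: iU = delta E m.
Proof. by rewrite /delta; case: (m == 0)%N; rewrite ?scale1r ?scale0r. Qed.

Lemma conv_al_bl m : conv al bl m = - delta E m.
Proof.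
rewrite -delta_idm [LHS](_ : _ = (\sum_(i < m.+1) A i ∘ B (m - i)) ⊗ iU).
  by rewrite conv_AB !(linE HC) (tens1f HC).
rewrite (tens_suml HC); apply: eq_bigr => i _; rewrite /al /bl.
by rewrite [LHS](_ : _ = (A i ⊗ iU) ∘ (B (m - i) ⊗ iU)) //; mon tt.
Qed.

Lemma conv_bl_al m : conv bl al m = - delta E m.
Proof.
rewrite -delta_idm [LHS](_ : _ = (\sum_(i < m.+1) B i ∘ A (m - i)) ⊗ iU).
  by rewrite conv_BA !(linE HC) (tens1f HC).
rewrite (tens_suml HC); apply: eq_bigr => i _; rewrite /al /bl.
by rewrite [LHS](_ : _ = (B i ⊗ iU) ∘ (A (m - i) ⊗ iU)) //; mon tt.
Qed.

Lemma conv_ar_br m : conv ar br m = - delta E m.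
Proof.
rewrite -delta_idm [LHS](_ : _ = iU ⊗ (\sum_(i < m.+1) A i ∘ B (m - i))).
  by rewrite conv_AB !(linE HC); congr (- (_ *: _)); mon tt.
rewrite (tens_sumr HC); apply: eq_bigr => i _; rewrite /ar /br.
by rewrite [LHS](_ : _ = (iU ⊗ A i) ∘ (iU ⊗ B (m - i))) //; mon tt.
Qed.

Lemma conv_br_ar m : conv br ar m = - delta E m.
Proof.
rewrite -delta_idm [LHS](_ : _ = iU ⊗ (\sum_(i < m.+1) B i ∘ A (m - i))).
  by rewrite conv_BA !(linE HC); congr (- (_ *: _)); mon tt.
rewrite (tens_sumr HC); apply: eq_bigr => i _; rewrite /ar /br.
by rewrite [LHS](_ : _ = (iU ⊗ B i) ∘ (iU ⊗ A (m - i))) //; mon tt.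
Qed.



(** The product of the series [bl], [al], [br] is computed in two ways, as [bl] times [- P] and as
    [- br]. *)
Lemma slide_transfer_br : (forall i, al i = conv P ar i) -> forall i, br i = conv bl P i.
Proof.
move=> h m.
have alP i : conv al br i = - P i.
  by rewrite (conv_ext (f' := conv P ar) (g' := br)) // -convA (conv_deltar _ _ conv_ar_br).
have := convA bl al br m.
rewrite (conv_ext (f' := bl) (g' := fun i => - P i)) // (conv_opp m (fun i => erefl)).
by rewrite (conv_deltal _ _ conv_bl_al) => /oppr_inj.
Qed.

Lemma slide_transfer_al : (forall i, br i = conv bl P i) -> forall i, al i = conv P ar i.
Proof.
move=> h m.
have brP i : conv al br i = - P i.
  by rewrite (conv_ext (f' := al) (g' := conv bl P)) // convA (conv_deltal _ _ conv_al_bl).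
have := convA al br ar m.
rewrite [RHS](conv_ext (f' := fun i => - P i) (g' := ar)) // (conv_opp m (fun i => erefl)).
by rewrite (conv_deltar _ _ conv_br_ar) => /oppr_inj.
Qed.

Lemma conv_P_ar i N : (i <= N)%N -> conv P ar i =
  iU ⊗ A i - \sum_(m < N) (m.+1%:R : R) *: (xp m ⊗ cw (i%:Z + k - 1 - m%:Z - 2)).
Proof.
move=> iN; pose F (j : nat) : hom C U U := match j with 0 => iU ⊗ A i | 1 => 0
  | m.+2 => - ((m.+1%:R : R) *: (xp m ⊗ cw (i%:Z + k - 1 - m%:Z - 2))) end.
have -> : conv P ar i = \sum_(j < i.+1) F j.
  apply: eq_bigr => -[[|[|m]] mi] _ /=.
  - by rewrite subn0 /ar [LHS](comp1f HC).
  - exact: (comp0l HC).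
  rewrite [LHS](compNl HC) (compZl HC); congr (- (_ *: _)); rewrite /ar /A.
  have -> : (i - m.+2)%N%:Z + k - 1 = i%:Z + k - 1 - m%:Z - 2 by lia.
  by mon tt.
rewrite -(@sum_truncate _ F i.+1 N.+2) //; last 2 first.
- by rewrite ltnS leqW.
- case=> [|[|m]] // im; rewrite /F (cw_eq0 HC HD) ?(tens0r HC) ?scaler0 ?oppr0 //; lia.
rewrite !big_ord_recl /= add0r -sumrN; congr (_ + _).
Qed.

Lemma conv_bl_P i N : (i <= N)%N -> conv bl P i =
  B i ⊗ iU - \sum_(m < N) (m.+1%:R : R) *: (ccw (i%:Z - k - 1 - m%:Z - 2) ⊗ xp m).
Proof.
move=> iN; pose F (j : nat) : hom C U U := match j with 0 => B i ⊗ iU | 1 => 0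
  | m.+2 => - ((m.+1%:R : R) *: (ccw (i%:Z - k - 1 - m%:Z - 2) ⊗ xp m)) end.
rewrite conv_rev.
have -> : \sum_(j < i.+1) bl (i - j)%N * P j = \sum_(j < i.+1) F j.
  apply: eq_bigr => -[[|[|m]] mi] _ /=.
  - by rewrite subn0 /bl [LHS](compf1 HC).
  - exact: (comp0r HC).
  rewrite [LHS](compNr HC) (compZr HC); congr (- (_ *: _)); rewrite /bl /B.
  have -> : (i - m.+2)%N%:Z - k - 1 = i%:Z - k - 1 - m%:Z - 2 by lia.
  by mon tt.
rewrite -(@sum_truncate _ F i.+1 N.+2) //; last 2 first.
- by rewrite ltnS leqW.
- case=> [|[|m]] // im; rewrite /F (ccw_eq0 HC HD) ?(tens0l HC) ?scaler0 ?oppr0 //; lia.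
rewrite !big_ord_recl /= add0r -sumrN; congr (_ + _).
Qed.

Lemma tens_xp_cw_eq i m (z : int) : xp i ∘ (xp m ⊗ cw z) = xp (i + m) ⊗ cw z.
Proof. by rewrite (xpD HC); mon tt. Qed.

Lemma cw_slide_sum r N : (`|k| + r < N)%N -> 0 <= k ->
  \sum_(i < r) xp i ∘ rcurl D c' (r - i.+1)
  = - \sum_(m < N) (m.+1%:R : R) *: (xp m ⊗ cw (r%:Z - m%:Z - 2)).
Proof.
move=> rN k0; pose F m := xp m ⊗ cw (r%:Z - m%:Z - 2).
under [in RHS]eq_bigr => m _ do rewrite scaler_nat.
rewrite -(@sum_shifts _ F r) => [||m rm]; last 2 first.
- lia.
- by rewrite /F (cw_eq0 HC HD) ?(tens0r HC) //; lia.
rewrite -sumrN; apply: eq_bigr => i _; have ir := ltn_ord i.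
rewrite (@rcurlE _ _ HC _ _ HD _ N) ?(compNr HC) ?(comp_sumr HC); last by lia.
congr (- _); apply: eq_bigr => m _; rewrite tens_xp_cw_eq /F.
by rewrite (_ : (r - i.+1)%N%:Z - m%:Z - 1 = r%:Z - (i + m)%N%:Z - 2); last by lia.
Qed.

Lemma ccw_slide_sum r N : (`|k| + r < N)%N -> k < 0 ->
  \sum_(i < r) xp (r - i.+1) ∘ lcurl D d' i
  = \sum_(m < N) (m.+1%:R : R) *: (ccw (r%:Z - m%:Z - 2) ⊗ xp m).
Proof.
move=> rN k0; pose F m := ccw (r%:Z - m%:Z - 2) ⊗ xp m.
under [in RHS]eq_bigr => m _ do rewrite scaler_nat.
rewrite -(@sum_shifts _ F r) => [||m rm]; last 2 first.
- lia.
- by rewrite /F (ccw_eq0 HC HD) ?(tens0l HC) //; lia.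
rewrite (reindex_inj rev_ord_inj); apply: eq_bigr => i _; have ir := ltn_ord i.
rewrite /= (_ : (r - (r - i.+1).+1)%N = i); last by lia.
rewrite (@lcurlE _ _ HC _ _ HD _ N) ?(comp_sumr HC); last by lia.
apply: eq_bigr => m _; rewrite /F (xpD HC).
rewrite (_ : (r - i.+1)%N%:Z - m%:Z - 1 = r%:Z - (i + m)%N%:Z - 2); last by lia.
by mon tt.
Qed.

Lemma al_br_conv : (forall i, al i = conv P ar i) /\ (forall i, br i = conv bl P i).
Proof.
suff [h|h] : (forall i, al i = conv P ar i) \/ (forall i, br i = conv bl P i).
- by split=> //; apply: slide_transfer_br.
- by split=> //; apply: slide_transfer_al.
(* Degree 0 is apart for k >= 0 because its index k - 1 may be negative; there the bubble is a
   scalar. In all other cases the index is a number of dots, and a pitchfork closed with that many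
   dots gives the slide. *)
have [k0|k0] := lerP 0 k; [left => -[|i] | right => i].
- rewrite (@conv_P_ar 0 0) // big_ord0 subr0 /al /A (cw_low HC HD); last by lia.
  by rewrite !(linE HC); congr (- (_ *: _)); mon tt.
- have [r rE] : exists r : nat, i.+1%:Z + k - 1 = r by exists `|(i.+1%:Z + k - 1)%R|%N; lia.
  have rN : (`|k| + r < (`|k| + r).+1 + i.+1)%N by lia.
  rewrite (@conv_P_ar _ ((`|k| + r).+1 + i.+1)) ?leq_addl // /al /A rE.
  rewrite -(cw_slide_sum rN k0) /Defs.cw; move: rE rN; move: k0; case: k HD => // K HK _ _ _.
  rewrite -(rslide HC HK) (pitchfork_t HC HK) /cw0; mon tt.
have [r rE] : exists r : nat, i%:Z - k - 1 = r by exists `|(i%:Z - k - 1)%R|%N; lia.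
have rN : (`|k| + r < (`|k| + r).+1 + i)%N by lia.
rewrite (@conv_bl_P _ ((`|k| + r).+1 + i)) ?leq_addl // /br /B rE.
rewrite -(ccw_slide_sum rN k0) /Defs.ccw; move: rE rN; move: k0; case: k HD => // n HK _ _ _.
by rewrite -(lslide HC HK) /ccw0; lc (esym (ctxr [::] [::] (copitchfork_t HC HK)
    (iU ⊗ ((iD ⊗ xp r) ∘ hc D)))) tt.
Qed.

Lemma ccw_slide r : eventually (fun N => iU ⊗ ccw r
  = ccw r ⊗ iU - \sum_(m < N) (m.+1%:R : R) *: (ccw (r - m%:Z - 2) ⊗ xp m)).
Proof.
have [rk|rk] := ltrP r (- k - 1).
  exists 0 => N _; rewrite (ccw_eq0 HC HD rk) (tens0l HC) (tens0r HC) big1 ?subr0 // => m _.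
  by rewrite (ccw_eq0 HC HD) ?(tens0l HC) ?scaler0 //; lia.
have [i iE] : exists i : nat, i%:Z - k - 1 = r by exists `|(r + k + 1)%R|%N; lia.
exists i => N iN; have [_ /(_ i)] := al_br_conv.
by rewrite (conv_bl_P iN) /br /B iE.
Qed.

Lemma cw_slide r : eventually (fun N => cw r ⊗ iU
  = iU ⊗ cw r - \sum_(m < N) (m.+1%:R : R) *: (xp m ⊗ cw (r - m%:Z - 2))).
Proof.
have [rk|rk] := ltrP r (k - 1).
  exists 0 => N _; rewrite (cw_eq0 HC HD rk) (tens0l HC) (tens0r HC) big1 ?subr0 // => m _.
  by rewrite (cw_eq0 HC HD) ?(tens0r HC) ?scaler0 //; lia.
have [i iE] : exists i : nat, i%:Z + k - 1 = r by exists `|(r - k + 1)%R|%N; lia.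
exists i => N iN; have [/(_ i) + _] := al_br_conv.
by rewrite (conv_P_ar iN) /al /A iE.
Qed.

End BubbleSlides.

(** * The alternating braid relation *)

Section BraidDifference.
Context {R : comPzRingType} {C : lmcat R} (HC : lmcat_axioms C).
Context {D : heis_data C}.
Local Notation xp := (xp D).
Local Notation iD := (@idm _ C Dn).

Lemma braid_difference_ge0 K (HD : heis_rels K%:Z D) N : (K <= N)%N ->
  D1 K D - D2 K D = \sum_(a < N) \sum_(b < N) \sum_(m < N)
    (ccw K D (- a%:Z - b%:Z - m%:Z - 3)
     ⊗ ((xp a ⊗ iD) ∘ (cpr K D ∘ (hd D ∘ (xp b ⊗ iD))))) ⊗ xp m.
Proof.
move=> KN; rewrite (braid_difference HC HD).
pose F (a b m : nat) := (ccw K D (- a%:Z - b%:Z - m%:Z - 3)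
   ⊗ ((xp a ⊗ iD) ∘ (cpr K D ∘ (hd D ∘ (xp b ⊗ iD))))) ⊗ xp m.
rewrite -[RHS]/(\sum_(a < N) \sum_(b < N) \sum_(m < N) F a b m).
(* The indices [b] and [m] satisfy [r = b + m + 1], whereas [a] comes from the expansion of [e r];
   hence [a] is made innermost. *)
rewrite exchange_big; under eq_bigr => b _ do rewrite exchange_big.
rewrite (@sum_antidiagonals _ (fun b m => \sum_(a < N) F a b m) K) // => [|b m bm].
  rewrite -sumrN; apply: eq_bigr => r _; rewrite -sumrN; apply: eq_bigr => i _.
  rewrite (e_sum HC HD (ltn_ord r) KN) !(linE HC) opprK; apply: eq_bigr => a _.
  have ir := ltn_ord i; rewrite /F /dxr.
  have -> : - a%:Z - i%:Z - (r - i.+1)%N%:Z - 3 = - r%:Z - a%:Z - 2 by lia.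
  by mon tt.
apply: big1 => a _; rewrite /F (ccw_eq0 HC HD) ?(linE HC) //; lia.
Qed.

Lemma braid_difference_lt0 n (HD : heis_rels (Negz n) D) N : (n.+1 <= N)%N ->
  D1 (Negz n) D - D2 (Negz n) D = \sum_(a < N) \sum_(b < N) \sum_(m < N)
    (xp m ⊗ ((iD ⊗ xp a) ∘ (hc D ∘ (dpr (Negz n) D ∘ (iD ⊗ xp b)))))
    ⊗ cw (Negz n) D (- a%:Z - b%:Z - m%:Z - 3).
Proof.
move=> KN; rewrite (neg_braid_difference HC HD).
pose F (a b m : nat) := (xp m ⊗ ((iD ⊗ xp a) ∘ (hc D ∘ (dpr (Negz n) D ∘ (iD ⊗ xp b)))))
    ⊗ cw (Negz n) D (- a%:Z - b%:Z - m%:Z - 3).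
rewrite -[RHS]/(\sum_(a < N) \sum_(b < N) \sum_(m < N) F a b m).
under [in RHS]eq_bigr => a _ do rewrite exchange_big.
rewrite (@sum_antidiagonals _ (fun a m => \sum_(b < N) F a b m) n.+1) // => [|a m am].
  rewrite -sumrN; apply: eq_bigr => r _; rewrite -sumrN; apply: eq_bigr => i _.
  rewrite (f_sum HC HD (ltn_ord r) KN) !(linE HC) opprK; apply: eq_bigr => b _.
  have ir := ltn_ord i; rewrite /F /cxr.
  have -> : - i%:Z - b%:Z - (r - i.+1)%N%:Z - 3 = - r%:Z - b%:Z - 2 by lia.
  by mon tt.
apply: big1 => b _; rewrite /F (cw_eq0 HC HD) ?(linE HC) //; lia.
Qed.

(** Only [r = 0] can occur, and its inner sum is empty. *)
Lemma braid_difference0 k (HD : heis_rels k D) : -1 <= k -> k < 2 -> D1 k D - D2 k D = 0.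
Proof.
case: k HD => [K|n] HD k1 k2.
  rewrite (braid_difference HC HD) big1 ?oppr0 // => -[[|r] rK] _; first by rewrite big_ord0.
  by exfalso; move: rK; rewrite /=; lia.
rewrite (neg_braid_difference HC HD) big1 ?oppr0 // => -[[|r] rK] _; first by rewrite big_ord0.
by exfalso; move: rK; rewrite /= NegzE in k1 *; lia.
Qed.

End BraidDifference.

(** * Left adjunction and equality of mates for every k *)

Section Mates.
Context {R : comPzRingType} {C : lmcat R} (HC : lmcat_axioms C).
Context {k : int} {D : heis_data C} (HD : heis_rels k D).
Local Notation iU := (@idm _ C U).
Local Notation iD := (@idm _ C Dn).
Local Notation c' := (cpr k D).
Local Notation d' := (dpr k D).

Lemma left_zigzags : (iU ⊗ d') ∘ (c' ⊗ iU) = iU /\ (d' ⊗ iD) ∘ (iD ⊗ c') = iD.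
Proof.
case: k HD => [K|n] HK; split.
- exact: zigzag_up.
- exact: zigzag_down.
- exact: neg_zigzag_up.
- exact: neg_zigzag_down.
Qed.

Lemma dot_mates : (iD ⊗ hd D) ∘ ((iD ⊗ hx D ⊗ iD) ∘ (hc D ⊗ iD))
  = (d' ⊗ iD) ∘ ((iD ⊗ hx D ⊗ iD) ∘ (iD ⊗ c')).
Proof. by case: k HD => [K|n] HK; [apply: x_mates | apply: neg_x_mates]. Qed.

Lemma crossing_mates :
  (idm DD ⊗ (hd D ∘ (iU ⊗ hd D ⊗ iD))) ∘
     ((idm DD ⊗ hs D ⊗ idm DD) ∘ (((iD ⊗ hc D ⊗ iU) ∘ hc D) ⊗ idm DD))
  = ((d' ∘ (iD ⊗ d' ⊗ iU)) ⊗ idm DD) ∘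
     ((idm DD ⊗ hs D ⊗ idm DD) ∘ (idm DD ⊗ ((iU ⊗ c' ⊗ iD) ∘ c'))).
Proof.
have [_ zd] := left_zigzags.
case: k HD zd => [K|n] HK zd.
  by lc (esym (ctxl DD [::] (s_mates HC HK) ((dpr K D ∘ (iD ⊗ dpr K D ⊗ iU)) ⊗ idm DD))) zd.
by lc (esym (ctxr [::] DD (neg_s_mates HC HK)
  (idm DD ⊗ ((iU ⊗ cpr (Negz n) D ⊗ iD) ∘ cpr (Negz n) D)))) zd.
Qed.

End Mates.

Theorem theorem1p3 (R : comPzRingType) (C : lmcat R) (HC : lmcat_axioms C)
    (k : int) (D : heis_data C) (HD : heis_rels k D) :
  let x := hx D in let s := hs D in let c := hc D in let d := hd D in
  let c' := cpr k D in let d' := dpr k D in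
  let ccw := ccw k D in let cw := cw k D in
  let one := @idm _ C [::] in
  let xp := xp D in
  (* (i) *)
  [/\ (forall r : int, r < k -> cw r = - (((r == k - 1)%:R : R) *: one)),
      (forall r : int, r < - k -> ccw r = ((r == - k - 1)%:R : R) *: one) &
      (forall m : int,
        \sum_(r < `|m|.+1 | (r%:Z <= m)) mcomp (cw (r%:Z + k - 1)) (ccw ((m - r%:Z) - k - 1))
          = - (((m == 0)%:R : R) *: one))]
  /\
  (* (ii) *)
  [/\ mcomp (tens (idm U) d') (tens c' (idm U)) = idm U &
      mcomp (tens d' (idm Dn)) (tens (idm Dn) c') = idm Dn]
  /\
  (* (iii) *)
  [/\ mcomp (tens (idm Dn) d) (mcomp (tens (tens (idm Dn) x) (idm Dn)) (tens c (idm Dn)))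
        = mcomp (tens d' (idm Dn)) (mcomp (tens (tens (idm Dn) x) (idm Dn)) (tens (idm Dn) c')) &
      mcomp (tens (idm [:: false; false]) (mcomp d (tens (tens (idm U) d) (idm Dn))))
        (mcomp (tens (tens (idm [:: false; false]) s) (idm [:: false; false]))
           (tens (mcomp (tens (tens (idm Dn) c) (idm U)) c) (idm [:: false; false])))
      = mcomp (tens (mcomp d' (tens (tens (idm Dn) d') (idm U))) (idm [:: false; false]))
        (mcomp (tens (tens (idm [:: false; false]) s) (idm [:: false; false]))
           (tens (idm [:: false; false]) (mcomp (tens (tens (idm U) c') (idm Dn)) c')))]
  /\
  (* (iv) *)
  (forall r : nat,
    eventually (fun N =>
      mcomp (tens d' (idm U)) (mcomp (tens (tens (idm Dn) (xp r)) (idm U))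
        (mcomp (tens (idm Dn) s) (tens c (idm U))))
      = \sum_(m < N) tens (ccw (r%:Z - m%:Z - 1)) (xp m))
    /\
    eventually (fun N =>
      mcomp (tens (idm U) d) (mcomp (tens (tens (idm U) (xp r)) (idm Dn))
        (mcomp (tens s (idm Dn)) (tens (idm U) c')))
      = - \sum_(m < N) tens (xp m) (cw (r%:Z - m%:Z - 1))))
  /\
  (* (v) *)
  (forall r : int,
    eventually (fun N =>
      tens (idm U) (ccw r)
      = tens (ccw r) (idm U) - \sum_(m < N) ((m.+1)%:R : R) *: tens (ccw (r - m%:Z - 2)) (xp m))
    /\
    eventually (fun N =>
      tens (cw r) (idm U)
      = tens (idm U) (cw r) - \sum_(m < N) ((m.+1)%:R : R) *: tens (xp m) (cw (r - m%:Z - 2))))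
  /\
  (* (vi) *)
  (if 2 <= k then
     eventually (fun N =>
       D1 k D - D2 k D
       = \sum_(a < N) \sum_(b < N) \sum_(m < N)
           tens (tens (ccw (- a%:Z - b%:Z - m%:Z - 3))
                      (mcomp (tens (xp a) (idm Dn)) (mcomp c' (mcomp d (tens (xp b) (idm Dn))))))
                (xp m))
   else if -1 <= k then D1 k D - D2 k D = 0
   else
     eventually (fun N =>
       D1 k D - D2 k D
       = \sum_(a < N) \sum_(b < N) \sum_(m < N)
           tens (tens (xp m)
                      (mcomp (tens (idm Dn) (xp a)) (mcomp c (mcomp d' (tens (idm Dn) (xp b))))))
                (cw (- a%:Z - b%:Z - m%:Z - 3)))).
Proof.
move=> /=; split; [split | split; [| split; [| split; [| split]]]].
- exact: (cw_low HC HD).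
- exact: (ccw_low HC HD).
- exact: (grassmann_int HC HD).
- exact: (left_zigzags HC HD).
- split; [exact: (dot_mates HC HD) | exact: (crossing_mates HC HD)].
- move=> r; split; exists (`|k| + r).+1 => N rN.
    exact: (lcurlE HC HD rN).
  exact: (rcurlE HC HD rN).
- move=> r; split; [exact: (ccw_slide HC HD) | exact: (cw_slide HC HD)].
case: ifP => [k2|k2].
  case: k HD k2 => // K HK _; exists K => N KN; exact: (braid_difference_ge0 HC HK KN).
case: ifP => [k1|k1].
  by apply: (braid_difference0 HC HD) => //; rewrite ltNge k2.
case: k HD k2 k1 => [K|n] HK k2 k1; first by exfalso; lia.
exists n.+1 => N nN; exact: (braid_difference_lt0 HC HK nN).
Qed.
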